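(* Let $n,m\in\mathbb{N}$ with $m\ge 2$ and let $A=(a_{ij})\in\mathbb{R}^{m\times n}$. There is a deterministic parallel algorithm with work $\tilde O(\mathrm{nnz}(A)+n+m)$ and depth $\operatorname{poly}(\log(mn))$ that computes a vector $\chi\in\{-1,1\}^n$ such that for every $i\in[m]$, $\mathrm{disc}(i)=\big|\sum_{j=1}^n a_{ij}\chi_j\big| = O\Big(\sqrt{\sum_{j=1}^n a_{ij}^2\cdot\log m}\Big)$, where the $O(\cdot)$ hides an absolute constant.
   Context: Work-depth model of parallel computation: work is the total number of computational steps, depth is the longest chain of sequentially dependent steps. $\mathrm{nnz}(A)$ is the number of nonzero entries of $A$. $\tilde O(x)$ denotes $x\cdot\operatorname{poly}(\log(nm))$. *)

(* Defs.v *)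
From HB Require Import structures.
From mathcomp Require Import all_boot all_order all_algebra.
From mathcomp Require Import reals exp.

Set Implicit Arguments.
Unset Strict Implicit.
Unset Printing Implicit Defensive.

Import Order.TTheory GRing.Theory Num.Theory.
Local Open Scope ring_scope.

(* The work-depth model is the language-based one of Blelloch and Greiner: a
   call-by-value lambda calculus with arrays whose only source of parallelism
   is the tabulation of an array, evaluated by a semantics that counts work
   and depth. It runs on a real RAM with words of bounded size: words index
   arrays, reals are atomic and can only be combined by field operations and
   compared. There is no conversion (floor) from reals to words, and programs
   contain no real constants, so that a program cannot hide an unbounded
   amount of information. *)

Inductive binop := OpAdd | OpSub | OpMul | OpDiv | OpLe.

(* Variables are de Bruijn indices. [Fun b] is a recursive function: in [b],
   [Var 0] is the argument and [Var 1] is the function itself. [Tab k f] is the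
   array [f 0; ...; f (k - 1)], with all the calls made in parallel. *)
Inductive term :=
| Var of nat
| Fun of term
| App of term & term
| Lit of nat
| Bin of binop & term & term
| ToReal of term
| If of term & term & term
| MkPair of term & term
| Fst of term
| Snd of term
| Tab of term & term
| Get of term & term
| Len of term.

Inductive value (R : Type) :=
| Word of nat
| Real of R
| Pair of value R & value R
| Arr of seq (value R)
| Clos of term & seq (value R).
Arguments Word {R}.
Arguments Clos {R}.

(* [Some (a, w, d)]: result [a], work [w], depth [d]; [None]: failure. *)
Definition costed (A : Type) : Type := option (A * nat * nat).

Definition ret A (a : A) : costed A := Some (a, 0%N, 0%N).

Definition bind A B (x : costed A) (f : A -> costed B) : costed B :=
  if x is Some (a, w, d) then
    if f a is Some (b, w', d') then Some (b, (w + w')%N, (d + d')%N) else None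
  else None.

Definition tick A (x : costed A) : costed A :=
  if x is Some (a, w, d) then Some (a, w.+1, d.+1) else None.

Definition par A (xs : seq (costed A)) : costed (seq A) :=
  foldr (fun x acc =>
    if x is Some (a, w, d) then
      if acc is Some (s, w', d') then Some (a :: s, (w + w')%N, maxn d d')
      else None
    else None) (ret [::]) xs.

Lemma bind_mono A B (x y : costed A) (f g : A -> costed B) r :
  (forall s, x = Some s -> y = Some s) ->
  (forall a s, f a = Some s -> g a = Some s) ->
  bind x f = Some r -> bind y g = Some r.
Proof.
move=> xy fg; case: x xy => [[[a w] d]|//] xy /=; rewrite (xy _ erefl) /=.
by case E: (f a) => [[[b w'] d']|//]; rewrite (fg _ _ E).
Qed.

Lemma tick_mono A (x y : costed A) r :
  (forall s, x = Some s -> y = Some s) -> tick x = Some r -> tick y = Some r.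
Proof. by case: x => [[[a w] d]|//] xy; rewrite (xy _ erefl). Qed.

Lemma par_mono A I (f g : I -> costed A) s r :
  (forall i t, f i = Some t -> g i = Some t) ->
  par (map f s) = Some r -> par (map g s) = Some r.
Proof.
move=> fg; elim: s r => //= i s IH r.
case E: (f i) => [[[a w] d]|//]; rewrite (fg _ _ E).
by case: (par (map f s)) IH => [[[l w'] d']|//] IH; rewrite (IH _ erefl).
Qed.

Section Semantics.
Variables (R : realFieldType) (W : nat).

(* Words are the natural numbers below [W]; exceeding them is a failure. With
   [W] polynomial in the dimensions of the input, a word has O(log) bits. *)
Definition mkword (k : nat) : costed (value R) :=
  if (k < W)%N then ret (Word k) else None.

Definition binop_word (o : binop) (x y : nat) : costed (value R) :=
  mkword match o with
         | OpAdd => x + y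
         | OpSub => x - y
         | OpMul => x * y
         | OpDiv => x %/ y
         | OpLe => (x <= y)%N
         end%N.

Definition binop_real (o : binop) (x y : R) : costed (value R) :=
  match o with
  | OpAdd => ret (Real (x + y))
  | OpSub => ret (Real (x - y))
  | OpMul => ret (Real (x * y))
  | OpDiv => ret (Real (x / y))
  | OpLe => mkword (nat_of_bool (x <= y))
  end.

(* [fuel] only bounds the depth of the recursion, to make [eval] total. Each
   evaluation of a subterm costs one unit: environments have size bounded in
   terms of the program only, and arrays are passed by reference. *)
Fixpoint eval (fuel : nat) (e : seq (value R)) (t : term) : costed (value R) :=
  if fuel isn't fuel'.+1 then None else
  let ev := eval fuel' in
  tick match t with
  | Var i => if onth e i is Some v then ret v else None
  | Fun b => ret (Clos b e)
  | App f a =>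
      bind (ev e f) (fun vf => bind (ev e a) (fun va =>
        if vf is Clos b e' then ev [:: va, vf & e'] b else None))
  | Lit k => mkword k
  | Bin o a b =>
      bind (ev e a) (fun va => bind (ev e b) (fun vb =>
        match va, vb with
        | Word x, Word y => binop_word o x y
        | Real x, Real y => binop_real o x y
        | _, _ => None
        end))
  | ToReal a =>
      bind (ev e a) (fun va => if va is Word x then ret (Real x%:R) else None)
  | If c a b =>
      bind (ev e c) (fun vc =>
        if vc is Word x then ev e (if x != 0%N then a else b) else None)
  | MkPair a b =>
      bind (ev e a) (fun va => bind (ev e b) (fun vb => ret (Pair va vb)))
  | Fst a => bind (ev e a) (fun va => if va is Pair v _ then ret v else None)
  | Snd a => bind (ev e a) (fun va => if va is Pair _ v then ret v else None)
  | Tab k f =>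
      bind (ev e k) (fun vk => bind (ev e f) (fun vf =>
        match vk, vf with
        | Word x, Clos b e' =>
            bind (par [seq ev [:: Word i, vf & e'] b | i <- iota 0 x])
              (fun s => ret (Arr s))
        | _, _ => None
        end))
  | Get a i =>
      bind (ev e a) (fun va => bind (ev e i) (fun vi =>
        match va, vi with
        | Arr s, Word x => if onth s x is Some v then ret v else None
        | _, _ => None
        end))
  | Len a =>
      bind (ev e a) (fun va => if va is Arr s then mkword (size s) else None)
  end.

Lemma eval_step f g :
  (forall e t r, eval f e t = Some r -> eval g e t = Some r) ->
  forall e t r, eval f.+1 e t = Some r -> eval g.+1 e t = Some r.
Proof.
move=> IH e t r /=; apply: tick_mono => {}r.
case: t => [i|b|a b|k|o a b|a|c a b|a b|a|a|a b|a b|a] //.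
- apply: bind_mono => [s|v s]; first exact: IH.
  by apply: bind_mono => [s'|v' s']; [exact: IH | case: v => // b' e'; exact: IH].
- by apply: bind_mono => [s|v s]; [exact: IH | apply: bind_mono => [s'|//]; exact: IH].
- by apply: bind_mono => [s|//]; exact: IH.
- by apply: bind_mono => [s|v s]; [exact: IH | case: v => // x; exact: IH].
- by apply: bind_mono => [s|v s]; [exact: IH | apply: bind_mono => [s'|//]; exact: IH].
- by apply: bind_mono => [s|//]; exact: IH.
- by apply: bind_mono => [s|//]; exact: IH.
- apply: bind_mono => [s|v s]; first exact: IH.
  apply: bind_mono => [s'|v' s']; first exact: IH.
  case: v => // x; case: v' => // b' e'; apply: bind_mono => // s''.
  by apply: par_mono => i t'; exact: IH.
- by apply: bind_mono => [s|v s]; [exact: IH | apply: bind_mono => [s'|//]; exact: IH].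
- by apply: bind_mono => [s|//]; exact: IH.
Qed.

Lemma eval_mono fuel e t r : eval fuel e t = Some r -> eval fuel.+1 e t = Some r.
Proof. by elim: fuel e t r => // f IH; exact: eval_step. Qed.

(* On the inputs [e], the program [p] outputs [v] with work [w] and depth [d]. *)
Definition runs (p : term) (e : seq (value R)) (v : value R) (w d : nat) :=
  exists fuel, eval fuel e p = Some (v, w, d).

Lemma runs_det p e v w d v' w' d' :
  runs p e v w d -> runs p e v' w' d' -> (v, w, d) = (v', w', d').
Proof.
move=> [f H] [f' H'].
have M g k r : eval g e p = Some r -> eval (k + g) e p = Some r.
  by move=> E; elim: k => // k; exact: eval_mono.
by move: (M _ f' _ H) (M _ f _ H'); rewrite addnC => -> [-> -> ->].
Qed.

End Semantics.

Section Matrices.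
Variables (R : realFieldType) (m n : nat).

Definition nnz (A : 'M[R]_(m, n)) : nat :=
  #|[set ij : 'I_m * 'I_n | A ij.1 ij.2 != 0]|.

(* Sparse input format: the array of the rows of [A], each of which is the
   array of the pairs (column, entry) of its nonzero entries, by increasing
   column. *)
Definition sparse_row (A : 'M[R]_(m, n)) (i : 'I_m) : value R :=
  Arr [seq Pair (Word (val j)) (Real (A i j)) | j <- enum 'I_n & A i j != 0].

Definition sparse (A : 'M[R]_(m, n)) : value R :=
  Arr [seq sparse_row A i | i <- enum 'I_m].

Definition vec (x : 'I_n -> R) : value R :=
  Arr [seq Real (x j) | j <- enum 'I_n].

Definition disc (A : 'M[R]_(m, n)) (x : 'I_n -> R) (i : 'I_m) : R :=
  `|\sum_(j < n) A i j * x j|.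

End Matrices.

(* The number of binary digits of [x]: within a factor 2 of the binary logarithm
   of [x] for [2 <= x], and positive. *)
Definition lg (x : nat) : nat := (trunc_log 2 x).+1.

(* Main.v *)
Require Import Defs.
From mathcomp Require Import all_boot all_order all_algebra.
From mathcomp Require Import reals exp.
From mathcomp Require Import sequences.
From mathcomp Require Import zify ring lra.

(** The obstacle is that the potential is a product over all columns, so its expectation involves
    terms of every degree, while pairwise independent signs control only degree two. Small steps
    turn this into a budget. Each level may lose a factor [expR (3 / D)]: one third for the
    accumulated third-order errors, one third for the initial size of the second potential, one
    third for the final rounding. The [D] levels together then lose only [expR 3]. With [l] the
    number of digits of [m], the rows start with total weight at most [expR (2 * l)]. So [L = 4 * l]
    bounds the logarithm of the potential at all levels, and the parameter [b = L * D] sets all step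
    sizes. The machine has no roots, exponentials or logarithms. The scaling is therefore found by
    repeated doubling, hyperbolic functions appear as rational functions of [z], and logarithms
    occur only in the analysis. Sparse vectors never shrink, so each pass costs the size of the
    whole input; this is affordable since there are only polylogarithmically many passes. *)

(* The signs are found by merging columns. Scale row i by y such that x_ij = a_ij / y has
   squared norm about log m, and start with z_ij = 1 + x_ij, which replaces exp x_ij. At each
   of about log n levels the columns 2c and 2c + 1 are replaced by one with entries z z' or
   z / z', according to a sign e_c: in the end one column of products of z_ij ^ (+-1) is left,
   whose logarithms are the scaled discrepancies up to O(log m). With f z = (z + 1 / z) / 2
   and t z = (z - 1 / z) / (z + 1 / z), we have f (z z' ^ e) = f z * f z' * (1 + e * t z * t z'), so
   that independent random signs would preserve the potential sum_i prod_c f z_ic in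
   expectation. It is at most poly m at the beginning, and poly m at the end is what we want.

   The point of pairing the columns is that for each row the sum of the |t z * t z'| is at most
   the logarithm of its product of f z, hence O(log m). So if the signs e_c are relaxed to
   reals in [-1, 1] that move from 0 by +-delta for a small delta = 1 / polylog, then the
   potential of a row changes at each step by a factor 1 + O(delta * polylog): the terms of
   order at least 3 are negligible, and those of order at most 2 are controlled by pairwise
   independent signs. These are derandomized by the method of conditional expectations in
   log n rounds: the quadratic terms are the cross terms of squares of sums, computed by merging
   columns once more. A second potential, the sum of the 1 - e_c ^ 2 with an exponentially growing
   coefficient, forces all e_c close to -1 or 1 after polylog many steps; then they are rounded. *)

Set Implicit Arguments.
Unset Strict Implicit.
Unset Printing Implicit Defensive.

Import Order.TTheory GRing.Theory Num.Theory.
Local Open Scope ring_scope.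
Local Notation Real := Defs.Real.

(** * Evaluation with bounded costs *)

Section Costs.
Variables (R : realFieldType) (W : nat).
Notation value := (value R).

(** Costs are upper bounds, so that the two branches of a conditional, or all calls of a tabulation,
    can share one bound. *)
Definition ev (e : seq value) (t : term) (v : value) (w d : nat) : Prop :=
  exists f w' d',
    [/\ eval W f e t = Some (v, w', d'), (w' <= w)%N & (d' <= d)%N].

(** Counts the evaluation of the body alone; [ev_app] adds the costs of function and argument.
    Functions are recursive, so the closure is itself the second variable of its body. *)
Definition calls (vf va v : value) (w d : nat) : Prop :=
  if vf is Clos b e then ev [:: va, vf & e] b v w d else False.

Lemma eval_monoD k f (e : seq value) t r :
  eval W f e t = Some r -> eval W (k + f) e t = Some r.
Proof. by move=> E; elim: k => // k; exact: eval_mono. Qed.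

Lemma eval_le f g (e : seq value) t r :
  (f <= g)%N -> eval W f e t = Some r -> eval W g e t = Some r.
Proof. by move=> fg /(eval_monoD (g - f)); rewrite subnK. Qed.

Lemma ev_runs e t v w d : ev e t v w d ->
  exists w' d', [/\ runs W t e v w' d', (w' <= w)%N & (d' <= d)%N].
Proof. by move=> [f [w' [d' [E ww dd]]]]; exists w', d'; split=> //; exists f. Qed.

Lemma ev_le (e : seq value) t v w d w' d' :
  ev e t v w d -> (w <= w')%N -> (d <= d')%N -> ev e t v w' d'.
Proof.
move=> [f [w1 [d1 [E ww dd]]]] ww' dd'; exists f, w1, d1.
by split; [|exact: leq_trans ww'|exact: leq_trans dd'].
Qed.

Lemma ev_eq e t v v' w d : ev e t v w d -> v = v' -> ev e t v' w d.
Proof. by move=> h <-. Qed.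

Lemma ev_var e i v : onth e i = Some v -> ev e (Var i) v 1 1.
Proof. by move=> E; exists 1%N, 1%N, 1%N; rewrite /= E. Qed.

Lemma ev_lit e k : (k < W)%N -> ev e (Lit k) (Word k) 1 1.
Proof. by move=> E; exists 1%N, 1%N, 1%N; rewrite /= /mkword E. Qed.

Lemma ev_fun e b : ev e (Fun b) (Clos b e) 1 1.
Proof. by exists 1%N, 1%N, 1%N. Qed.

Lemma ev_app e f a vf va v w1 d1 w2 d2 w3 d3 :
  ev e f vf w1 d1 -> ev e a va w2 d2 -> calls vf va v w3 d3 ->
  ev e (App f a) v (w1 + w2 + w3).+1 (d1 + d2 + d3).+1.
Proof.
move=> [f1 [x1 [y1 [E1 l1 k1]]]] [f2 [x2 [y2 [E2 l2 k2]]]].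
case: vf E1 => // b e' E1 [f3 [x3 [y3 [E3 l3 k3]]]].
pose F := maxn f1 (maxn f2 f3).
exists F.+1, (x1 + (x2 + x3)).+1, (y1 + (y2 + y3)).+1.
rewrite /= (@eval_le f1 F _ _ _ _ E1) ?(@eval_le f2 F _ _ _ _ E2) /= /F; try lia.
by rewrite (@eval_le f3 _ _ _ _ _ E3) /=; [split=> //; lia | lia].
Qed.

(** A [let] is an immediate call, which also binds the function itself; the body is evaluated with
    an arbitrary value [self] in that place. *)
Lemma ev_let e b a va v w1 d1 w2 d2 :
  ev e a va w1 d1 -> (forall self, ev [:: va, self & e] b v w2 d2) ->
  ev e (App (Fun b) a) v (w1 + w2).+2 (d1 + d2).+2.
Proof. by move=> h1 h2; exact: (ev_app (ev_fun _ _) h1 (h2 _)). Qed.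

Variant binv : binop -> value -> value -> value -> Prop :=
| bin_addw x y : (x + y < W)%N -> binv OpAdd (Word x) (Word y) (Word (x + y))
| bin_subw x y : (x < W)%N -> binv OpSub (Word x) (Word y) (Word (x - y))
| bin_mulw x y : (x * y < W)%N -> binv OpMul (Word x) (Word y) (Word (x * y))
| bin_divw x y : (x < W)%N -> binv OpDiv (Word x) (Word y) (Word (x %/ y))
| bin_lew x y : binv OpLe (Word x) (Word y) (Word (x <= y)%N)
| bin_addr x y : binv OpAdd (Real x) (Real y) (Real (x + y))
| bin_subr x y : binv OpSub (Real x) (Real y) (Real (x - y))
| bin_mulr x y : binv OpMul (Real x) (Real y) (Real (x * y))
| bin_divr x y : binv OpDiv (Real x) (Real y) (Real (x / y))
| bin_ler x y : binv OpLe (Real x) (Real y) (Word (x <= y)%R).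

Lemma mkwordE k : (k < W)%N -> mkword R W k = ret (Word k).
Proof. by rewrite /mkword => ->. Qed.

Lemma ev_bin e o a b va vb v w1 d1 w2 d2 :
  (1 < W)%N ->
  ev e a va w1 d1 -> ev e b vb w2 d2 -> binv o va vb v ->
  ev e (Bin o a b) v (w1 + w2).+1 (d1 + d2).+1.
Proof.
move=> W_gt1 [f1 [x1 [y1 [E1 l1 k1]]]] [f2 [x2 [y2 [E2 l2 k2]]]] B.
pose F := maxn f1 f2.
exists F.+1, (x1 + (x2 + 0)).+1, (y1 + (y2 + 0)).+1.
rewrite /= (@eval_le f1 F _ _ _ _ E1) ?(@eval_le f2 F _ _ _ _ E2) /= /F; try lia.
have wb (c : bool) : (c < W)%N by case: c; lia.
by case: B => [x y H|x y H|x y H|x y H|x y|x y|x y|x y|x y|x y];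
  rewrite /= /binop_word ?mkwordE //=; try (by split=> //; lia);
  apply: leq_ltn_trans H; rewrite ?leq_div ?leq_subr.
Qed.

Lemma ev_real e a x r w d :
  ev e a (Word x) w d -> x%:R = r -> ev e (ToReal a) (Real r) w.+1 d.+1.
Proof.
move=> + <-; move=> [f1 [x1 [y1 [E1 l1 k1]]]]; exists f1.+1, (x1 + 0).+1, (y1 + 0).+1.
by rewrite /= E1 /=; split=> //; lia.
Qed.

Lemma ev_if e c a b (x : bool) v w1 d1 w2 d2 :
  ev e c (Word x) w1 d1 -> (x -> ev e a v w2 d2) -> (~~ x -> ev e b v w2 d2) ->
  ev e (If c a b) v (w1 + w2).+1 (d1 + d2).+1.
Proof.
move=> [f1 [x1 [y1 [E1 l1 k1]]]] h1 h2.
have [f2 [x2 [y2 [E2 l2 k2]]]] : ev e (if x then a else b) v w2 d2.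
  by case: x h1 h2 {E1} => h1 h2; [exact: h1 | exact: h2].
pose F := maxn f1 f2.
exists F.+1, (x1 + x2).+1, (y1 + y2).+1.
rewrite /= (@eval_le f1 F _ _ _ _ E1) /= /F; last by lia.
have -> : (x : nat) != 0%N = x by case: (x).
by rewrite (@eval_le f2 _ _ _ _ _ E2) /=; [split=> //; lia | lia].
Qed.

Lemma ev_ifE e c a b (x : bool) v1 v2 w1 d1 w2 d2 w3 d3 :
  ev e c (Word x) w1 d1 -> (x -> ev e a v1 w2 d2) -> (~~ x -> ev e b v2 w3 d3) ->
  ev e (If c a b) (if x then v1 else v2)
    (w1 + maxn w2 w3).+1 (d1 + maxn d2 d3).+1.
Proof.
move=> h1 h2 h3; apply: (ev_if h1) => hx.
  by rewrite hx; apply: ev_le (h2 hx) _ _; rewrite leq_maxl.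
by rewrite (negbTE hx); apply: ev_le (h3 hx) _ _; rewrite leq_maxr.
Qed.

Lemma ev_pair e a b va vb w1 d1 w2 d2 :
  ev e a va w1 d1 -> ev e b vb w2 d2 ->
  ev e (MkPair a b) (Pair va vb) (w1 + w2).+1 (d1 + d2).+1.
Proof.
move=> [f1 [x1 [y1 [E1 l1 k1]]]] [f2 [x2 [y2 [E2 l2 k2]]]].
pose F := maxn f1 f2.
exists F.+1, (x1 + (x2 + 0)).+1, (y1 + (y2 + 0)).+1.
rewrite /= (@eval_le f1 F _ _ _ _ E1) ?(@eval_le f2 F _ _ _ _ E2) /= /F; try lia.
by split=> //; lia.
Qed.

Lemma ev_fst e a va vb w d :
  ev e a (Pair va vb) w d -> ev e (Fst a) va w.+1 d.+1.
Proof.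
move=> [f1 [x1 [y1 [E1 l1 k1]]]]; exists f1.+1, (x1 + 0).+1, (y1 + 0).+1.
by rewrite /= E1 /=; split=> //; lia.
Qed.

Lemma ev_snd e a va vb w d :
  ev e a (Pair va vb) w d -> ev e (Snd a) vb w.+1 d.+1.
Proof.
move=> [f1 [x1 [y1 [E1 l1 k1]]]]; exists f1.+1, (x1 + 0).+1, (y1 + 0).+1.
by rewrite /= E1 /=; split=> //; lia.
Qed.

Lemma ev_get e a i s k v w1 d1 w2 d2 :
  ev e a (Arr s) w1 d1 -> ev e i (Word k) w2 d2 -> onth s k = Some v ->
  ev e (Get a i) v (w1 + w2).+1 (d1 + d2).+1.
Proof.
move=> [f1 [x1 [y1 [E1 l1 k1]]]] [f2 [x2 [y2 [E2 l2 k2]]]] O.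
pose F := maxn f1 f2.
exists F.+1, (x1 + (x2 + 0)).+1, (y1 + (y2 + 0)).+1.
rewrite /= (@eval_le f1 F _ _ _ _ E1) ?(@eval_le f2 F _ _ _ _ E2) /= /F; try lia.
by rewrite O /=; split=> //; lia.
Qed.

Lemma ev_len e a s n w d :
  ev e a (Arr s) w d -> size s = n -> (n < W)%N ->
  ev e (Len a) (Word n) w.+1 d.+1.
Proof.
move=> [f1 [x1 [y1 [E1 l1 k1]]]] <- sW; exists f1.+1, (x1 + 0).+1, (y1 + 0).+1.
by rewrite /= E1 /= mkwordE //=; split=> //; lia.
Qed.

(** [Tab] gives the same fuel to all of its calls; finitely many calls have a common sufficient
    fuel, by taking maxima. *)
Lemma common_fuel x (e : nat -> seq value) b vs ws d :
  (forall i, (i < x)%N -> ev (e i) b (vs i) (ws i) d) ->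
  exists F, forall i, (i < x)%N -> exists w' d',
    [/\ eval W F (e i) b = Some (vs i, w', d'), (w' <= ws i)%N & (d' <= d)%N].
Proof.
elim: x => [|x IH] H; first by exists 0%N.
have [|F HF] := IH; first by move=> i ix; apply: H; lia.
have [f [w' [d' [E l k]]]] := H x (ltnSn x).
exists (maxn F f) => i; rewrite ltnS leq_eqVlt => /orP[/eqP->|/HF].
  by exists w', d'; split=> //; apply: eval_le E; lia.
by move=> [w1 [d1 [E1 ? ?]]]; exists w1, d1; split=> //; apply: eval_le E1; lia.
Qed.

Lemma par_map (f : nat -> costed value) vs ws d a x :
  (forall i, (i < x)%N -> exists w' d',
     [/\ f (a + i)%N = Some (vs i, w', d'), (w' <= ws i)%N & (d' <= d)%N]) ->
  exists w' d', [/\ par [seq f i | i <- iota a x] = Some (mkseq vs x, w', d'),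
    (w' <= \sum_(i < x) ws i)%N & (d' <= d)%N].
Proof.
elim: x a vs ws => [|x IH] a vs ws H; first by exists 0%N, 0%N.
have [|w1 [d1 [E1 l1 k1]]] := IH a.+1 (fun i => vs i.+1) (fun i => ws i.+1).
  by move=> i ix; rewrite addSnnS; exact: H.
have [w2 [d2 [E2 l2 k2]]] := H 0%N isT; rewrite addn0 in E2.
exists (w2 + w1)%N, (maxn d2 d1); rewrite /= E2 E1; split.
- suff -> : mkseq vs x.+1 = vs 0%N :: mkseq (fun i => vs i.+1) x by [].
  by rewrite /mkseq /= (iotaDl 1 0 x) -map_comp.
- by rewrite big_ord_recl leq_add.
- by rewrite geq_max k2.
Qed.

Lemma ev_tab_clos e k x b vs w1 d1 ws d2 :
  ev e k (Word x) w1 d1 ->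
  (forall i, (i < x)%N -> ev [:: Word i, Clos b e & e] b (vs i) (ws i) d2) ->
  ev e (Tab k (Fun b)) (Arr (mkseq vs x))
    (w1 + \sum_(i < x) ws i).+2 (d1 + d2).+2.
Proof.
move=> [f1 [x1 [y1 [E1 l1 k1]]]] H.
have [|F HF] := @common_fuel x (fun i => [:: Word i, Clos b e & e]) b vs ws d2.
  by move=> i ix; exact: H.
have [w2 [d3 [E2 l2 k2]]] := @par_map
  (fun i => eval W (maxn f1 F).+1 [:: Word i, Clos b e & e] b) vs ws d2 0 x
  (fun i ix => let: ex_intro w' (ex_intro d' (And3 E l k)) := HF i ix in
     ex_intro _ w' (ex_intro _ d' (And3 (eval_le (leqW (leq_maxr f1 F)) E) l k))).
have E3 : eval W (maxn f1 F).+1 e (Fun b) = Some (Clos b e, 1%N, 1%N) by [].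
have {}E1 : eval W (maxn f1 F).+1 e k = Some (Word x, x1, y1).
  by apply: eval_le E1; lia.
exists (maxn f1 F).+2, (x1 + (1 + (w2 + 0))).+1, (y1 + (1 + (d3 + 0))).+1.
move: E1 E2 E3; set g := (maxn f1 F).+1; move: g => g E1 E2 E3.
rewrite /= E1 E3 /= E2 /=; split=> //; last by lia.
by move: l2; set w' := (\sum_(i < x) _)%N; lia.
Qed.

Lemma ev_tab e k x b vs w1 d1 ws d2 :
  ev e k (Word x) w1 d1 ->
  (forall i, (i < x)%N -> forall self, ev [:: Word i, self & e] b (vs i) (ws i) d2) ->
  ev e (Tab k (Fun b)) (Arr (mkseq vs x))
    (w1 + \sum_(i < x) ws i).+2 (d1 + d2).+2.
Proof. by move=> h1 h2; apply: ev_tab_clos h1 _ => i /h2. Qed.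

Lemma ev_tab_const e k x b vs w1 d1 w d2 :
  ev e k (Word x) w1 d1 ->
  (forall i, (i < x)%N -> forall self, ev [:: Word i, self & e] b (vs i) w d2) ->
  ev e (Tab k (Fun b)) (Arr (mkseq vs x)) (w1 + x * w).+2 (d1 + d2).+2.
Proof.
move=> h1 h2; have := ev_tab h1 h2.
by rewrite sum_nat_const card_ord.
Qed.

(** One function has many representations as a sparse vector, which differ for instance in their
    dead cells. Hence results are specified by a predicate instead of a value. *)
Definition evP (e : seq value) (t : term) (P : value -> Prop) (w d : nat) : Prop :=
  exists2 v, P v & ev e t v w d.

Definition callsP (vf va : value) (P : value -> Prop) (w d : nat) : Prop :=
  exists2 v, P v & calls vf va v w d.

Lemma evP_ev e t v (P : value -> Prop) w d : ev e t v w d -> P v -> evP e t P w d.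
Proof. by move=> h Pv; exists v. Qed.

Lemma evP_le e t (P : value -> Prop) w d w' d' :
  evP e t P w d -> (w <= w')%N -> (d <= d')%N -> evP e t P w' d'.
Proof. by move=> [v Pv h] ww dd; exists v => //; exact: ev_le h ww dd. Qed.

Lemma evP_sub e t (P Q : value -> Prop) w d :
  evP e t P w d -> (forall v, P v -> Q v) -> evP e t Q w d.
Proof. by move=> [v Pv h] PQ; exists v => //; exact: PQ. Qed.

Lemma evP_let e b a (P Q : value -> Prop) w1 d1 w2 d2 :
  evP e a P w1 d1 ->
  (forall va self, P va -> evP [:: va, self & e] b Q w2 d2) ->
  evP e (App (Fun b) a) Q (w1 + w2).+2 (d1 + d2).+2.
Proof.
move=> [va Pa h1] h2; have [v Qv h3] := h2 va (Clos b e) Pa.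
by exists v => //; exact: (ev_app (ev_fun _ _) h1 h3).
Qed.

Lemma evP_if e c a b (x : bool) (P : value -> Prop) w1 d1 w2 d2 w3 d3 :
  ev e c (Word x) w1 d1 -> (x -> evP e a P w2 d2) -> (~~ x -> evP e b P w3 d3) ->
  evP e (If c a b) P (w1 + maxn w2 w3).+1 (d1 + maxn d2 d3).+1.
Proof.
move=> h1; case: x h1 => h1 h2 h3.
  have [v Pv h] := h2 isT; exists v => //.
  by apply: (ev_if h1) => // _; apply: ev_le h _ _; rewrite leq_maxl.
have [v Pv h] := h3 isT; exists v => //.
by apply: (ev_if h1) => // _; apply: ev_le h _ _; rewrite leq_maxr.
Qed.

(** The results of parallel calls are only known to exist, and the rule for tabulation wants them as
    one function of the index. *)
Lemma finite_choice (x0 : value) (P : nat -> value -> Prop) x :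
  (forall i, (i < x)%N -> exists v, P i v) ->
  exists vs : nat -> value, forall i, (i < x)%N -> P i (vs i).
Proof.
elim: x => [|x IH] H; first by exists (fun _ => x0).
have [|vs Hvs] := IH; first by move=> i ix; apply: H; exact: ltnW.
have [v Pv] := H x (ltnSn x).
exists (fun i => if i == x then v else vs i) => i.
by rewrite ltnS leq_eqVlt; case: eqP => [-> //|_ /Hvs].
Qed.

Definition is_array x (P : nat -> value -> Prop) (v : value) : Prop :=
  exists2 vs, v = Arr (mkseq vs x) & forall i, (i < x)%N -> P i (vs i).

Lemma evP_tab e k x b (P : nat -> value -> Prop) w1 d1 ws d2 :
  ev e k (Word x) w1 d1 ->
  (forall i self, (i < x)%N -> evP [:: Word i, self & e] b (P i) (ws i) d2) ->
  evP e (Tab k (Fun b)) (is_array x P) (w1 + \sum_(i < x) ws i).+2 (d1 + d2).+2.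
Proof.
move=> h1 h2; pose e' i := [:: Word i, Clos b e & e].
have [|vs Hvs] := @finite_choice (Word 0)
    (fun i v => P i v /\ ev (e' i) b v (ws i) d2) x.
  by move=> i ix; have [v Pv h] := h2 i (Clos b e) ix; exists v.
exists (Arr (mkseq vs x)); first by exists vs => // i /Hvs[].
by apply: ev_tab_clos h1 _ => i /Hvs[].
Qed.

End Costs.

(** * Programs on sparse vectors *)

(* Terms in higher-order syntax: a builder maps the number of variables in scope
   to a de Bruijn term, and a variable is represented by its level. *)
Definition bld := nat -> term.
Definition bvar (l : nat) : bld := fun d => Var (d - l.+1).
Definition brec (f : bld -> bld -> bld) : bld :=
  fun d => Fun (f (bvar d) (bvar d.+1) d.+2).
Definition bfun (f : bld -> bld) : bld := brec (fun _ => f).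
Definition bapp (f a : bld) : bld := fun d => App (f d) (a d).
Definition blet (a : bld) (f : bld -> bld) : bld := bapp (bfun f) a.
Definition blit (k : nat) : bld := fun _ => Lit k.
Definition bbin (o : binop) (a b : bld) : bld := fun d => Bin o (a d) (b d).
Definition breal (a : bld) : bld := fun d => ToReal (a d).
Definition bif (c a b : bld) : bld := fun d => If (c d) (a d) (b d).
Definition bpair (a b : bld) : bld := fun d => MkPair (a d) (b d).
Definition bfst (a : bld) : bld := fun d => Fst (a d).
Definition bsnd (a : bld) : bld := fun d => Snd (a d).
Definition btab (k : bld) (f : bld -> bld) : bld := fun d => Tab (k d) (bfun f d).
Definition bget (a i : bld) : bld := fun d => Get (a d) (i d).
Definition blen (a : bld) : bld := fun d => Len (a d).
(** A term without free variables means the same at every depth, so it is inserted without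
    shifting. *)
Definition bclosed (t : term) : bld := fun _ => t.
Definition bcall (t : term) (a : bld) : bld := bapp (bclosed t) a.

Declare Scope bld_scope.
Delimit Scope bld_scope with bld.
Bind Scope bld_scope with bld.
Notation "'LET' x ':=' a 'IN' b" := (blet a%bld (fun x => b%bld))
  (at level 200, x name, b at level 200) : bld_scope.
Notation "'IF' c 'THEN' a 'ELSE' b" := (bif c%bld a%bld b%bld)
  (at level 200, b at level 200) : bld_scope.
Notation "'TAB' i '<' k 'OF' b" := (btab k%bld (fun i => b%bld))
  (at level 200, i name, k at level 69, b at level 200) : bld_scope.
Notation "'FUN' x '=>' b" := (bfun (fun x => b%bld))
  (at level 200, x name, b at level 200) : bld_scope.
Notation "'REC' f x => b" := (brec (fun f x => b%bld))
  (at level 200, f name, x name, b at level 200) : bld_scope.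
Notation "a + b" := (bbin OpAdd a b) : bld_scope.
Notation "a - b" := (bbin OpSub a b) : bld_scope.
Notation "a * b" := (bbin OpMul a b) : bld_scope.
Notation "a / b" := (bbin OpDiv a b) : bld_scope.
Notation "a <= b" := (bbin OpLe a b) : bld_scope.
Notation "a ;; b" := (bpair a b) (at level 80, right associativity) : bld_scope.
Notation "a .[ i ]" := (bget a i) : bld_scope.
Notation "# k" := (blit k) (at level 1, format "# k") : bld_scope.

(** Normalizes the builder at depth 0 to a plain de Bruijn term, on whose constructors [evs] can
    match. *)
Notation "'COMPILE' b" := (ltac:(let t := constr:((b : bld) 0%N) in
  let t := eval cbv beta iota zeta delta
  [bvar brec bfun bapp blet blit bbin breal bif bpair bfst bsnd btab bget blen
   bclosed bcall subn subn_rec Nat.sub] in t in exact t)) (at level 200, only parsing).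

(* Merges the columns [2 c] and [2 c + 1] of the sparse vector [a]: see [cell] for
   the format. The argument is [(F, (d, a))]; those of the other programs are
   given in the same way. *)
Definition t_collapse : term := COMPILE (
  FUN arg =>
  LET F := bfst arg IN
  LET d := bfst (bsnd arg) IN
  LET a := bsnd (bsnd arg) IN
  LET s := blen a IN
  TAB p < s OF
  LET x := a.[p] IN
  LET c := bfst x IN
  LET v := bfst (bsnd x) IN
  LET q := bsnd (bsnd x) IN
  LET h := c / #2 IN
  IF c <= h * #2 THEN
    IF s <= q THEN (h ;; bapp F (h ;; v ;; d) ;; q)
    ELSE LET y := a.[q] IN
      IF bfst y <= c + #1 THEN
        (h ;; bapp F (h ;; v ;; bfst (bsnd y)) ;; bsnd (bsnd y))
      ELSE (h ;; bapp F (h ;; v ;; d) ;; q)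
  ELSE (h ;; bapp F (h ;; d ;; v) ;; q))%bld.

Lemma onth_nth_some T (x0 : T) s i : (i < size s)%N -> onth s i = Some (nth x0 s i).
Proof. by elim: s i => // x s IH [|i] //= /IH. Qed.

Lemma onth_mkseq T (f : nat -> T) n i : (i < n)%N -> onth (mkseq f n) i = Some (f i).
Proof.
by move=> i_n; rewrite (onth_nth_some (f 0%N)) ?size_mkseq // nth_mkseq.
Qed.

(* Symbolic evaluation, which leaves the calls to closed programs and the bounds on
   words to the user. *)
Ltac evs := lazymatch goal with
| |- ev _ _ (Var _) _ _ _ => eapply ev_var; reflexivity
| |- ev _ _ (Lit _) _ _ _ => eapply ev_lit
| |- ev _ _ (Fun _) _ _ _ => eapply ev_fun
| |- ev _ _ (App (Fun _) _) _ _ _ => eapply ev_let; [evs | intros ?; evs]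
| |- ev _ _ (App (Var _) _) _ _ _ =>
    eapply ev_app; [evs | evs |
      try match goal with H : _ |- calls _ _ _ _ _ _ => eapply H end]
| |- ev _ _ (App (Fst _) _) _ _ _ => eapply ev_app; [evs | evs | ]
| |- ev _ _ (App (Snd _) _) _ _ _ => eapply ev_app; [evs | evs | ]
| |- ev _ _ (Bin _ _ _) _ _ _ =>
    eapply ev_bin; [try assumption | evs | evs |
      first [eapply bin_lew | eapply bin_ler | eapply bin_addw | eapply bin_addr |
        eapply bin_mulw | eapply bin_mulr | eapply bin_divw | eapply bin_divr |
        eapply bin_subw | eapply bin_subr]]
| |- ev _ _ (ToReal _) _ _ _ => eapply ev_real; [evs | reflexivity]
| |- ev _ _ (If _ _ _) _ _ _ => eapply ev_ifE; [evs | intros ?; evs | intros ?; evs]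
| |- ev _ _ (MkPair _ _) _ _ _ => eapply ev_pair; [evs | evs]
| |- ev _ _ (Fst _) _ _ _ => eapply ev_fst; evs
| |- ev _ _ (Snd _) _ _ _ => eapply ev_snd; evs
| |- ev _ _ (Get _ _) _ _ _ => eapply ev_get; [evs | evs |
    try (rewrite onth_mkseq; [reflexivity | eassumption])]
| |- ev _ _ (Len _) _ _ _ => eapply ev_len; [evs | rewrite ?size_mkseq ?size_map; reflexivity | ]
| |- _ => idtac
end.

Section Vectors.
Variables (R : realFieldType) (W : nat).
Hypothesis W_gt1 : (1 < W)%N.
Notation value := (value R).
Notation ev := (@ev R W).
Notation calls := (@calls R W).

(* A sparse vector is an array of cells (column, value, position of the next cell),
   whose live cells form a list starting at position 0, by increasing column. When
   two cells merge, the second one is not removed but merely no longer reachable, so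
   that no compaction is needed and the position 0 stays live. *)
Definition cell : Type := nat * R * nat.
Definition vcell (x : cell) : value := Pair (Word x.1.1) (Pair (Real x.1.2) (Word x.2)).
Definition svec (l : seq cell) : value := Arr (map vcell l).
Definition cell0 : cell := (0%N, 0, 0%N).

Lemma map_mkseq_nth S T (x0 : S) (f : S -> T) s :
  map f s = mkseq (fun i => f (nth x0 s i)) (size s).
Proof. by rewrite -[in LHS](mkseq_nth x0 s) -map_comp. Qed.

(** Restricted to columns below [N], since the function passed may use the column as an index into
    an array of length [N]. The bound [k] serves for both work and depth. *)
Definition pairs2 N vf (F : nat -> R -> R -> R) k :=
  forall c v v', (c < N)%N ->
  calls vf (Pair (Word c) (Pair (Real v) (Real v'))) (Real (F c v v')) k k.

(** The test [c <= h * 2] says that [c] is even. A live odd cell has no live even partner, hence the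
    default [d] on its left. An odd cell absorbed by its partner is transformed as well, but its new
    value is unreachable. *)
Definition collapse_cell (F : nat -> R -> R -> R) d (l : seq cell) (x : cell) : cell :=
  let: (c, v, q) := x in let h := (c %/ 2)%N in
  if (c <= h * 2)%N then
    if (size l <= q)%N then (h, F h v d, q)
    else let: (c', v', q') := nth cell0 l q in
      if (c' <= c + 1)%N then (h, F h v v', q') else (h, F h v d, q)
  else (h, F h d v, q).

Definition collapse_cells F d l := map (collapse_cell F d l) l.

(** Dead cells are included: the programs run on them too and must not fail there. *)
Definition wf_cells N (l : seq cell) :=
  forall x, x \in l -> (x.1.1 < N)%N /\ (x.2 <= size l)%N.

Lemma ev_collapse e a vf F k N d l w1 d1 :
  (N < W)%N -> (2 < W)%N -> (size l < W)%N -> wf_cells N l -> pairs2 N vf F k ->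
  ev e a (Pair vf (Pair (Real d) (svec l))) w1 d1 ->
  ev e (App t_collapse a) (svec (collapse_cells F d l))
    (w1 + 30 + size l * (k + 80)) (d1 + k + 110).
Proof.
move=> NW W2 lW wf HF ha; rewrite /t_collapse.
rewrite [svec (collapse_cells _ _ _)]/svec /collapse_cells -map_comp (map_mkseq_nth cell0) /comp.
eapply ev_le.
eapply ev_let; first exact ha.
move=> ?; evs; first exact lW.
eapply (@ev_tab_const _ _ _ _ _ _ _ _ _ (k + 80) (k + 80)); first by evs.
move=> i il ?.
have [] := wf _ (mem_nth cell0 il).
have Ei := onth_nth_some cell0 il.
case: (nth cell0 l i) Ei => [[c v] q] Ei /= cN ql.
eapply ev_eq; first eapply ev_le.
evs.
- by rewrite onth_map Ei; reflexivity.
all: try (simpl; lia).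
- simpl in *; rewrite onth_map (onth_nth_some cell0) /=; [reflexivity | lia].
- by case: (nth cell0 l q) => [[c' v'] q'] /=; do 3!case: ifP => //.
Qed.

End Vectors.

(** * Sparse vectors as linked lists *)

Section Sparse.
Variable R : realFieldType.
Implicit Types (l : seq (cell R)) (r : seq (nat * R)) (F : nat -> R -> R -> R).

(** The end of the list is the position [size l], which remains the end marker after a merge because
    the array keeps its size. *)
Inductive linked l : nat -> seq (nat * R) -> Prop :=
| linked_nil : linked l (size l) [::]
| linked_cons p c v q r :
    onth l p = Some (c, v, q) -> linked l q r -> linked l p ((c, v) :: r).

Fixpoint assoc (d : R) r (c : nat) : R :=
  if r is (c', v) :: r' then if c' == c then v else assoc d r' c else d.

Definition incr r := pairwise ltn (map fst r).
Definition keys_ge k r := all (leq k) (map fst r).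

Fixpoint lcollapse F (d : R) r : seq (nat * R) :=
  if r is (c, v) :: r' then
    let h := (c %/ 2)%N in
    if (c <= h * 2)%N then
      if r' is (c', v') :: r'' then
        if (c' <= c + 1)%N then (h, F h v v') :: lcollapse F d r''
        else (h, F h v d) :: lcollapse F d r'
      else [:: (h, F h v d)]
    else (h, F h d v) :: lcollapse F d r'
  else [::].

Lemma linked_lt l p c v r : linked l p ((c, v) :: r) -> (p < size l)%N.
Proof. by move=> h; inversion h; rewrite -onthTE; case: onth H2. Qed.

(** The induction is on the length because a merge consumes two cells: the pointer of the first cell
    then jumps over the second. *)
Lemma linked_collapse F d l p r :
  linked l p r -> linked (collapse_cells F d l) p (lcollapse F d r).
Proof.
have [n] := ubnP (size r); elim: n r p => // n IH [|[c v] r] p.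
  by move=> _ h; inversion h; rewrite -(size_map (collapse_cell F d l)); constructor.
rewrite [size _]/= ltnS => rn h; inversion h as [|p' c' v' q r' Hp Hr]; subst.
have Hc : onth (collapse_cells F d l) p = Some (collapse_cell F d l (c, v, q)).
  by rewrite onth_map Hp.
rewrite [lcollapse _ _ _]/=; move: Hc; rewrite [collapse_cell _ _ _ _]/=.
case: ifP => c_even; last by move=> Hc; apply: (linked_cons Hc); exact: IH rn Hr.
case: r Hr rn {h} => [|[c' v'] r] Hr rn.
  inversion Hr; subst; rewrite leqnn => Hc; apply: (linked_cons Hc).
  by rewrite -[X in linked _ X _](size_map (collapse_cell F d l)); constructor.
have ql := linked_lt Hr; rewrite leqNgt ql /=.
inversion Hr as [|q1 c1 v1 q' r1 Hq Hr']; subst.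
have -> : nth (cell0 R) l q = (c', v', q').
  by move: Hq; rewrite (onth_nth_some (cell0 R)) // => -[].
move: rn => /= rn; case: ifP => cc Hc; apply: (linked_cons Hc).
  by apply: IH Hr'; rewrite (leq_trans _ rn).
by apply: (IH ((c', v') :: r)).

Qed.

Lemma keys_geW k k' r : (k' <= k)%N -> keys_ge k r -> keys_ge k' r.
Proof. by move=> kk; apply: sub_all => x /(leq_trans kk). Qed.

Lemma incr_cons c v r : incr ((c, v) :: r) = keys_ge c.+1 r && incr r.
Proof. by []. Qed.

Lemma assoc_out d k r c : keys_ge k r -> (c < k)%N -> assoc d r c = d.
Proof.
by elim: r => //= -[c' v] r IH /= /andP[/= kc' kr] ck; rewrite IH //; case: eqP => //; lia.
Qed.

(** Missing partners read as [d], and missing pairs as [d' = F c d d]. The lower bound [k] on the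
    columns is carried through the induction because it yields the strict increase of the halved
    columns. *)
Lemma lcollapseP F d d' k r : (forall c, F c d d = d') -> incr r -> keys_ge k r ->
  [/\ incr (lcollapse F d r), keys_ge (k %/ 2) (lcollapse F d r) &
    forall c, assoc d' (lcollapse F d r) c =
      F c (assoc d r (c * 2)) (assoc d r (c * 2 + 1))].
Proof.
move=> Fd; have [n] := ubnP (size r).
elim: n r k => // n IH [|[c v] r] k; first by move=> *; split=> //= c; rewrite Fd.
rewrite [size _]/= ltnS incr_cons => rn /andP[cr ir] /andP[/= kc kr].
set h := (c %/ 2)%N; case: ifP => c_even.
- case: r rn cr ir kr => [|[c' v'] r] rn cr ir kr.
    split=> //=; first by rewrite /keys_ge /= andbT; lia.
    move=> x; case: (h =P x) => [<-|hx].
      have -> : (c == h * 2)%N by lia.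
      by case: eqP => //; lia.
    by do 2!(case: eqP; first lia); rewrite Fd.
  move: cr; rewrite /keys_ge /= => /andP[cc' cr].
  case: ifP => c'c.
    move: ir; rewrite incr_cons => /andP[c'r ir].
    have [|i1 k1 a1] := IH r c'.+1 _ ir c'r; first by move: rn => /=; lia.
    split=> /=.
    + by rewrite incr_cons i1 andbT; apply: keys_geW k1; lia.
    + by apply/andP; split; [rewrite /= /h; lia | apply: keys_geW k1; lia].
    + move=> x; case: (h =P x) => [<-|hx].
        have -> : (c == h * 2)%N by lia.
        have -> : (c == h * 2 + 1)%N = false by lia.
        by have -> : (c' == h * 2 + 1)%N by lia.
      by rewrite a1; do 4!(case: eqP; first lia).
  have kr2 : keys_ge c' ((c', v') :: r).
    rewrite /keys_ge /= leqnn /=; move: ir; rewrite incr_cons => /andP[+ _].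
    exact: keys_geW.
  have [//|i1 k1 a1] := IH ((c', v') :: r) c' _ ir kr2.
  split.
  + by rewrite incr_cons i1 andbT; apply: keys_geW k1; lia.
  + by apply/andP; split; [rewrite /= /h; lia | apply: keys_geW k1; lia].
  + move=> x; rewrite [LHS]/= -/(lcollapse F d ((c', v') :: r)) [in RHS]/=.
    rewrite -!/(assoc d ((c', v') :: r) _) -/(assoc d' _ _).
    case: (h =P x) => [<-|hx].
      have -> : (c == h * 2)%N by lia.
      have -> : (c == h * 2 + 1)%N = false by lia.
      by rewrite (assoc_out _ kr2) //; lia.
    by rewrite a1; do 2!(case: eqP; first lia).
- have [|i1 k1 a1] := IH r c.+1 _ ir cr; first by [].
  split=> /=.
  + by rewrite incr_cons i1 andbT; apply: keys_geW k1; lia.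
  + by apply/andP; split; [rewrite /= /h; lia | apply: keys_geW k1; lia].
  + move=> x; case: (h =P x) => [<-|hx].
      have -> : (c == h * 2)%N = false by lia.
      have -> : (c == h * 2 + 1)%N by lia.
      by rewrite (assoc_out _ cr) //; lia.
    by rewrite a1; do 2!(case: eqP; first lia).
Qed.
End Sparse.

(* [(k, (f, x))] *)
Definition t_iter : term := COMPILE (
  REC self arg =>
  IF bfst arg <= #0 THEN bsnd (bsnd arg)
  ELSE LET y := bapp (bfst (bsnd arg)) (bsnd (bsnd arg)) IN
    bapp self (bfst arg - #1 ;; bfst (bsnd arg) ;; y))%bld.

(* [(G, a)] *)
Definition t_map : term := COMPILE (
  FUN arg =>
  LET G := bfst arg IN
  LET a := bsnd arg IN
  TAB p < blen a OF
  LET x := a.[p] IN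
  (bfst x ;; bapp G (bfst x ;; bfst (bsnd x)) ;; bsnd (bsnd x)))%bld.

(* [(k, (F, (d, a)))] *)
Definition t_fold : term := COMPILE (
  FUN arg =>
  LET F := bfst (bsnd arg) IN
  LET d := bfst (bsnd (bsnd arg)) IN
  LET r := bcall t_iter (bfst arg ;; (FUN y => bcall t_collapse (F ;; d ;; y)) ;;
                         bsnd (bsnd (bsnd arg))) IN
  IF blen r <= #0 THEN d ELSE bfst (bsnd (r.[#0])))%bld.

Section Library.
Variables (R : realFieldType) (W : nat).
Hypothesis W_gt2 : (2 < W)%N.
Let W_gt1 : (1 < W)%N := ltnW W_gt2.
Notation value := (value R).

Lemma ev_fun_app e b a va (P : value -> Prop) w1 d1 w2 d2 :
  ev W e a va w1 d1 -> callsP W (Clos b e) va P w2 d2 ->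
  evP W e (App (Fun b) a) P (w1 + w2).+2 (d1 + d2).+2.
Proof.
by move=> h [v Pv h']; exists v => //; exact: (ev_app (ev_fun _ _ _) h h').
Qed.

Lemma evP_iter e a k vf (I : nat -> value -> Prop) x w1 d1 w d :
  (k < W)%N ->
  (forall i x, (i < k)%N -> I i x -> callsP W vf x (I i.+1) w d) -> I 0%N x ->
  ev W e a (Pair (Word k) (Pair vf x)) w1 d1 ->
  evP W e (App t_iter a) (I k) (w1 + (k * (w + 30) + 30)) (d1 + (k * (d + 30) + 30)).
Proof.
move=> kW step I0 ha; rewrite /t_iter.
set b := (X in Fun X).
suff H j i y : (i + j = k)%N -> I i y ->
    callsP W (Clos b e) (Pair (Word j) (Pair vf y)) (I k)
      (j * (w + 30) + 20) (j * (d + 30) + 20).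
  by apply: evP_le (ev_fun_app ha (H k 0%N x _ I0)) _ _; lia.
elim: j i y => [|j IH] i y ij Iy.
- exists y; first by rewrite -ij addn0.
  rewrite /calls /b; eapply ev_le.
  eapply ev_if; [evs; lia | move=> _; evs | by []].
  all: try lia.
- have [z Iz hz] := step i y (ltac:(lia)) Iy.
  have [t It ht] := IH i.+1 z (ltac:(lia)) Iz.
  exists t => //; rewrite /calls /b -/b; eapply ev_le.
  eapply ev_if; [evs; lia | by [] | move=> _].
  eapply ev_let; first (evs; exact hz).
  move=> ?; eapply ev_app; [evs|evs; lia|].
  by rewrite subn1; exact: ht.
  all: lia.
Qed.

Definition singles N vf (G : nat -> R -> R) k :=
  forall c v, (c < N)%N -> calls W vf (Pair (Word c) (Real v)) (Real (G c v)) k k.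

(* [g] has the value [d] outside the live cells of [v], which has [s] cells, all with
   a column below [N]. *)
Definition srep N s d (g : nat -> R) (v : value) : Prop :=
  exists l r, [/\ v = svec l, size l = s, wf_cells N l, linked l 0 r &
    incr r /\ forall c, g c = assoc d r c].

Definition collapse (F : nat -> R -> R -> R) (g : nat -> R) (c : nat) : R :=
  F c (g (c * 2)%N) (g (c * 2 + 1)%N).

Lemma wf_collapse N N' F d (l : seq (cell R)) : (forall c, (c < N)%N -> (c %/ 2 < N')%N) ->
  wf_cells N l -> wf_cells N' (collapse_cells F d l).
Proof.
move=> NN wf x /mapP[[[c v] q] /wf[/= cN ql] ->]; have h := NN _ cN.
rewrite size_map /=; case: ifP => // _; case: ifP => // sq.
have /wf : nth (cell0 R) l q \in l by rewrite mem_nth // ltnNge sq.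
by case: (nth _ _ _) => [[c' v'] q'] /= [_ q's]; case: ifP.
Qed.

Lemma evP_collapse e a vf v F k N N' s d d' g w1 d1 :
  (N < W)%N -> (s < W)%N -> (forall c, (c < N)%N -> (c %/ 2 < N')%N) ->
  (forall c, F c d d = d') -> pairs2 W N vf F k -> srep N s d g v ->
  ev W e a (Pair vf (Pair (Real d) v)) w1 d1 ->
  evP W e (App t_collapse a) (srep N' s d' (collapse F g))
    (w1 + 30 + s * (k + 80)) (d1 + k + 110).
Proof.
move=> NW sW NN Fd HF [l [r [-> ls wf lr [ir gr]]]] ha.
exists (svec (collapse_cells F d l)); last first.
  by rewrite -ls; apply: (ev_collapse W_gt1 NW W_gt2 _ wf HF ha); rewrite ls.
exists (collapse_cells F d l), (lcollapse F d r); split=> //.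
- by rewrite size_map.
- exact: wf_collapse wf.
- exact: linked_collapse.
- have [i1 _ a1] := @lcollapseP _ F d d' 0 r Fd ir (all_predT _).
  by split=> // c; rewrite a1 /collapse !gr.
Qed.

Definition map_cell (G : nat -> R -> R) (x : cell R) : cell R :=
  (x.1.1, G x.1.1 x.1.2, x.2).

Lemma evP_map e a vf v G k N s d d' g w1 d1 :
  (N < W)%N -> (s < W)%N -> (forall c, G c d = d') -> singles N vf G k ->
  srep N s d g v -> ev W e a (Pair vf v) w1 d1 ->
  evP W e (App t_map a) (srep N s d' (fun c => G c (g c)))
    (w1 + 30 + s * (k + 30)) (d1 + k + 60).
Proof.
move=> NW sW Gd HG [l [r [-> ls wf lr [ir gr]]]] ha.
subst s; pose l' := map (map_cell G) l; pose r' := [seq (x.1, G x.1 x.2) | x <- r].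
exists (svec l').
  exists l', r'; split=> //.
  - by rewrite size_map.
  - by move=> x /mapP[y /wf[yN yl] ->]; rewrite size_map.
  - rewrite {}/r' {}/l'; elim: lr => [|p c v' q r0 Hp _ IH] /=.
      by rewrite -(size_map (map_cell G)); constructor.
    by apply: linked_cons IH; rewrite onth_map Hp.
  - split; first by rewrite /incr -map_comp.
    by move=> c; rewrite gr {}/r'; elim: r {lr ir gr} => //= -[c' v'] r /=; case: eqP => // ->.
rewrite /l' [svec (map _ _)]/svec -map_comp (map_mkseq_nth (cell0 R)) /comp /t_map.
eapply ev_le.
eapply ev_let; first exact ha.
move=> ?; evs.
eapply (@ev_tab_const _ _ _ _ _ _ _ _ _ (k + 30) (k + 30)).
  by evs.
move=> i il ?.
have [cN ql] := wf _ (mem_nth (cell0 R) il).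
have Ei := onth_nth_some (cell0 R) il.
eapply ev_eq; first eapply ev_le.
evs.
- by rewrite onth_map Ei.
- exact: cN.
all: try lia.
by [].
Qed.

(** After [k] merges all columns are below 1, so the only live cell is column 0, stored at position
    0; an empty array stands for the default. Each merge has constant depth and goes over all [s]
    cells. *)
Lemma ev_fold e a vf v F k kf s d g w1 d1 :
  (2 ^ k < W)%N -> (s < W)%N -> (forall c, F c d d = d) ->
  pairs2 W (2 ^ k) vf F kf -> srep (2 ^ k) s d g v ->
  ev W e a (Pair (Word k) (Pair vf (Pair (Real d) v))) w1 d1 ->
  ev W e (App t_fold a) (Real (iter k (collapse F) g 0%N))
    (w1 + (k + 1) * ((s + 1) * (kf + 200))) (d1 + (k + 1) * (kf + 200)).
Proof.
move=> kW sW Fd HF Hv ha.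
have kk : (k < 2 ^ k)%N by rewrite ltn_expl.
suff [_ <- //] : evP W e (App t_fold a) (eq (Real (iter k (collapse F) g 0%N)))
    (w1 + (k + 1) * ((s + 1) * (kf + 200))) (d1 + (k + 1) * (kf + 200)).
rewrite /t_fold; eapply evP_le.
apply: evP_let; first exact: (evP_ev ha (erefl _)).
move=> _ ? <-; apply: evP_let.
  by eapply evP_ev; [evs | exact: erefl].
move=> _ ? <-; apply: evP_let.
  by eapply evP_ev; [evs | exact: erefl].
move=> _ ? <-; apply: evP_let.
  apply: (@evP_iter _ _ _ _ (fun i => srep (2 ^ (k - i)) s d (iter i (collapse F) g))
    v _ _ (s * (kf + 80) + 45) (kf + 125)); last by evs.
  - exact: ltn_trans kW.
  - move=> i x ik Hx; rewrite /callsP /=; eapply evP_le.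
    apply: (evP_collapse (N := 2 ^ (k - i)) (d := d)); last by evs.
    + by apply: leq_ltn_trans kW; rewrite leq_exp2l ?leq_subr.
    + exact: sW.
    + move=> c; have -> : (k - i = (k - i.+1).+1)%N by lia.
      by rewrite expnS; lia.
    + exact: Fd.
    + move=> c x1 x2 cN; apply: HF; apply: leq_trans cN _.
      by rewrite leq_exp2l ?leq_subr.
    + exact: Hx.
    + lia.
    + lia.
  - by rewrite subn0.
rewrite subnn expn0 => r ? [l [r' [-> ls wf lr [ir gr]]]].
apply: evP_if.
- by evs; rewrite ?size_map ?ls //; lia.
- move=> l0; eapply evP_ev; first by evs.
  rewrite gr; case: lr ir gr => // p c v' q r0 Hp.
  by have := onthTE l p; rewrite Hp /=; lia.
- move=> l0; have l0' : (0 < size l)%N by lia.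
  inversion lr as [E|p c v' q r0 Hp Hr E1 E2]; first by lia.
  subst.
    have [/= c1 _] := wf (c, v', q) (ltac:(apply/onthP; by exists 0%N)).
  eapply evP_ev; first evs.
  + lia.
  + by rewrite onth_map Hp.
  + by rewrite gr /=; have -> : (c == 0)%N by lia.
all: lia.
Qed.

End Library.

(** * Pairwise independent signs *)

Section BigHalves.
Variables (T : Type) (idx : T) (op : Monoid.com_law idx).

Lemma big_double (n : nat) (g : nat -> T) :
  \big[op/idx]_(c < n * 2) g c =
  \big[op/idx]_(c < n) op (g (c * 2)%N) (g (c * 2 + 1)%N).
Proof.
elim: n => [|n IH]; first by rewrite !big_ord0.
by rewrite mulSn addnC addn2 !big_ord_recr /= IH addn1 Monoid.mulmA.
Qed.

(** All [n] pairs are taken, not only the first half: the others lie outside the support. The range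
    of columns thus stays the same at all levels. *)
Lemma big_half (n : nat) (g : nat -> T) : (forall c, (n <= c)%N -> g c = idx) ->
  \big[op/idx]_(c < n) g c =
  \big[op/idx]_(c < n) op (g (c * 2)%N) (g (c * 2 + 1)%N).
Proof.
move=> g0; rewrite -big_double muln2 -addnn big_split_ord /=.
by rewrite [X in op _ X]big1 ?Monoid.mulm1 // => i _; rewrite g0 // leq_addr.
Qed.

End BigHalves.

Section Inner.
Variables (R : realFieldType) (m D : nat) (w : nat -> R).
Implicit Types u : nat -> nat -> R.
Local Notation N := (2 ^ D)%N.

Definition sg (r : R) : R := if r <= 0 then 1 else -1.

Lemma sg_mul r : sg r * r <= 0.
Proof. by rewrite /sg; case: ifP; lra. Qed.

Lemma sg_sqr r : sg r ^+ 2 = 1.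
Proof. by rewrite /sg; case: ifP => _; ring. Qed.

(** Half the coefficient of a common sign [s] in the weighted energy of the merged entries
    [u (2 c) + s * u (2 c + 1)]; the next bit is chosen against it. *)
Definition corr u : R :=
  \sum_(i < m) w i * \sum_(c < N) (u i (c * 2)%N * u i (c * 2 + 1)%N).

(* The first component is the vector of the signs: the sign of column [c] is the product
   of one bit for each binary digit 1 of [c], so that random bits would make the signs
   pairwise independent. The bits are chosen one after the other, each of them so as
   not to increase the energy [inner_energy] of the merged vectors. *)
Fixpoint inner u k : (nat -> R) * (nat -> nat -> R) :=
  if k is k'.+1 then
    let: (e, v) := inner u k' in
    (fun c => if odd (c %/ 2 ^ k') then e c * sg (corr v) else e c,
     fun i c => v i (c * 2)%N + sg (corr v) * v i (c * 2 + 1)%N)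
  else (fun _ => 1, u).

Definition supported u := forall i c, (N <= c)%N -> u i c = 0.

Lemma inner_supported u k : supported u -> supported (inner u k).2.
Proof.
move=> u0; elim: k => //= k; case: (inner u k) => e v /= IH i c Nc.
by rewrite !IH ?mulr0 ?addr0 //; lia.
Qed.

Lemma inner_sqr u k c : (inner u k).1 c ^+ 2 = 1.
Proof.
elim: k => [|k] /=; first by rewrite expr1n.
by case: (inner u k) => e v /= IH; case: ifP => // _; rewrite exprMn IH sg_sqr mulr1.
Qed.

(** As [s ^+ 2 = 1], merging changes the energy only by the cross terms [2 * s * corr v], and [sg]
    makes this nonpositive. *)
Lemma inner_energy u k : supported u ->
  \sum_(i < m) w i * \sum_(c < N) (inner u k).2 i c ^+ 2 <=
  \sum_(i < m) w i * \sum_(c < N) u i c ^+ 2.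
Proof.
move=> u0; elim: k => //= k IH; apply: le_trans IH.
have := inner_supported k u0; case: (inner u k) => e v /= v0.
have -> : \sum_(i < m) w i * \sum_(c < N) v i c ^+ 2 = \sum_(i < m) w i *
    \sum_(c < N) (v i (c * 2)%N ^+ 2 + v i (c * 2 + 1)%N ^+ 2).
  apply: eq_bigr => i _; congr (_ * _).
  by rewrite (@big_half _ _ _ N (fun c => v i c ^+ 2)) // => c Nc; rewrite v0 // expr0n.
set s := sg _.
have -> : \sum_(i < m) w i * \sum_(c < N) (v i (c * 2)%N + s * v i (c * 2 + 1)%N) ^+ 2 =
    \sum_(i < m) w i * \sum_(c < N) (v i (c * 2)%N ^+ 2 + v i (c * 2 + 1)%N ^+ 2)
    + 2 * (s * corr v).
  rewrite /corr !mulr_sumr -big_split /=; apply: eq_bigr => i _.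
  rewrite !mulr_sumr -big_split /=; apply: eq_bigr => c _.
  have := sg_sqr (corr v); rewrite -/s => s2.
  by rewrite sqrrD exprMn s2; ring.
by have := sg_mul (corr v); rewrite -/s; lra.
Qed.

(** Column [c] after [k] rounds has collected a block of [2 ^ k] original columns. Round [k + 1]
    acts on binary digit [k], which is 0 on the left half of the doubled block and 1 on the right
    half. *)
Lemma inner_sum u k i c :
  (inner u k).2 i c =
  \sum_(j < 2 ^ k) (inner u k).1 (c * 2 ^ k + j)%N * u i (c * 2 ^ k + j)%N.
Proof.
elim: k c => [|k IH] c; first by rewrite big_ord1 /= expn0 muln1 addn0 mul1r.
rewrite [in RHS]expnS mul2n -addnn big_split_ord /=.
move: IH; case: (inner u k) => e v /= IH.
rewrite !IH mulr_sumr; congr (_ + _); apply: eq_bigr => j _.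
  have -> : (c * (2 ^ k + 2 ^ k) + j = c * 2 * 2 ^ k + j)%N by lia.
  by rewrite divnMDl ?expn_gt0 // divn_small // addn0 oddM andbF.
have -> : (c * (2 ^ k + 2 ^ k) + (2 ^ k + j) = (c * 2 + 1) * 2 ^ k + j)%N by lia.
rewrite divnMDl ?expn_gt0 // divn_small // addn0 oddD oddM andbF /=; ring.
Qed.

(** After [D] rounds every column but 0 comes from outside the support. The program can thus read
    the signed sums off the merged vectors. *)
Lemma inner_total u i : supported u ->
  \sum_(c < N) (inner u D).2 i c = \sum_(c < N) (inner u D).1 c * u i c.
Proof.
move=> u0; have Npos : (0 < N)%N by rewrite expn_gt0.
rewrite (bigD1 (Ordinal Npos)) //= [X in _ + X]big1 => [|c c0].
  by rewrite addr0 inner_sum; apply: eq_bigr => j _; rewrite mul0n add0n.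
rewrite inner_sum big1 // => j _; rewrite u0 ?mulr0 //.
have : (0 < c)%N by rewrite lt0n; move: c0; apply: contra => /eqP c0; apply/eqP/val_inj.
by move=> c1; apply: leq_trans (leq_addr _ _); rewrite leq_pmull.
Qed.

(** The square of column 0 is part of the final energy, which never increased. Random pairwise
    independent signs would give this with equality in expectation. *)
Lemma inner_variance u : supported u -> (forall i, 0 <= w i) ->
  \sum_(i < m) w i * (\sum_(c < N) (inner u D).1 c * u i c) ^+ 2 <=
  \sum_(i < m) w i * \sum_(c < N) u i c ^+ 2.
Proof.
move=> u0 w0; apply: le_trans (inner_energy D u0).
apply: ler_sum => i _; apply: ler_wpM2l => //.
have Npos : (0 < N)%N by rewrite expn_gt0.
have -> : \sum_(c < N) (inner u D).1 c * u i c = (inner u D).2 i 0%N.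
  by rewrite inner_sum; apply: eq_bigr => c _; rewrite mul0n.
rewrite [X in _ <= X](bigD1 (Ordinal Npos)) //=.
by rewrite lerDl sumr_ge0 // => c _; rewrite sqr_ge0.
Qed.

End Inner.

Section ProductExpansion.
Variable R : realFieldType.
Implicit Types y : nat -> R.

(** Taylor expansion of the product to orders 0, 1 and 2; the quadratic term is the second
    elementary symmetric polynomial. The three bounds are proved together because appending a factor
    [1 + a] adds to each error [a] times the quantity bounded just before. *)
Lemma prod_expansion n y : \sum_(c < n) `|y c| <= 1 / 2 ->
  let s := \sum_(c < n) `|y c| in
  let S := \sum_(c < n) y c in
  let P := \prod_(c < n) (1 + y c) in
  [/\ `|P - 1| <= 2 * s, `|P - 1 - S| <= s ^+ 2 &
      `|P - 1 - S - (S ^+ 2 - \sum_(c < n) y c ^+ 2) / 2| <= s ^+ 3].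
Proof.
elim: n => [|n IH] /=.
  by rewrite !big_ord0 => _; rewrite !(expr0n, subrr, subr0, mul0r, mulr0, normr0).
rewrite !big_ord_recr /=; move: IH.
set s := \sum_(c < n) `|y c|; set S := \sum_(c < n) y c.
set P := \prod_(c < n) _; set Q := \sum_(c < n) y c ^+ 2; set a := y n.
have s0 : 0 <= s by apply: sumr_ge0.
have a0 := normr_ge0 a.
move=> IH sa; have [|h1 h2 h3] := IH; first by lra.
split.
- have -> : P * (1 + a) - 1 = (P - 1) + a * P by ring.
  apply: le_trans (ler_normD _ _) _; rewrite normrM.
  have : `|P| <= 2.
    have -> : P = 1 + (P - 1) by ring.
    by apply: le_trans (ler_normD _ _) _; rewrite normr1; lra.
  by nra.
- have -> : P * (1 + a) - 1 - (S + a) = (P - 1 - S) + a * (P - 1) by ring.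
  by apply: le_trans (ler_normD _ _) _; rewrite normrM; nra.
- have -> : P * (1 + a) - 1 - (S + a) - ((S + a) ^+ 2 - (Q + a ^+ 2)) / 2 =
    (P - 1 - S - (S ^+ 2 - Q) / 2) + a * (P - 1 - S) by field.
  apply: le_trans (ler_normD _ _) _; rewrite normrM.
  have : `|a| * `|P - 1 - S| <= `|a| * s ^+ 2 by apply: ler_wpM2l.
  have : 0 <= `|a| ^+ 2 by apply: exprn_ge0.
  have : 0 <= s ^+ 2 by apply: exprn_ge0.
  have : 0 <= s * `|a| ^+ 2 by apply: mulr_ge0 => //; apply: exprn_ge0.
  have : 0 <= `|a| ^+ 3 by apply: exprn_ge0.
  have : 0 <= `|a| * s ^+ 2 by apply: mulr_ge0 => //; apply: exprn_ge0.
  have -> : (s + `|a|) ^+ 3 = s ^+ 3 + 3 * (`|a| * s ^+ 2) + 3 * (s * `|a| ^+ 2) + `|a| ^+ 3.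
    by ring.
  by lra.
Qed.

End ProductExpansion.

(** * The walk *)

Section Walk.
Variables (R : realFieldType) (m D : nat) (W : nat -> R) (t : nat -> nat -> R).
Variables (delta beta : R).
Local Notation N := (2 ^ D)%N.
Implicit Types (x e : nat -> R) (gamma : R).

(** States [|x c| < 1 - beta] by squares, which is the test that the program performs. *)
Definition alive x c : bool := ~~ ((1 - beta) * (1 - beta) <= x c * x c).

(** In the application [W] and [t] are [row_weight] and [pair_tanh]. Then this is the multilinear
    function of [x] that gives the current weight of row [i] at 0 and, by [cosh_of_combine], its
    weight after the merge at a vector of signs. *)
Definition weight x i : R := W i * \prod_(c < N) (1 + x c * t i c).

(** The relative change of factor [c] of row [i] when [x c] moves by [delta]. *)
Definition incr_of x i c : R :=
  if alive x c then delta * t i c / (1 + x c * t i c) else 0.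

Definition drift x e : R := \sum_(c < N) (if alive x c then x c * e c else 0).

(** Negating all of [e] leaves the second-order terms alone, so one global sign [s] settles the
    first-order terms of both potentials: it makes [s] times their combination
    [lin - 2 * gamma' * delta * drift] nonpositive. Apart from drift, [unrest] shrinks by the factor
    [1 - delta ^+ 2], and [gamma] grows by the inverse factor to compensate. *)
Definition walk_step (st : (nat -> R) * R) : (nat -> R) * R :=
  let: (x, gamma) := st in
  let: (e, u) := inner m D (weight x) (incr_of x) D in
  let gamma' := gamma / (1 - delta * delta) in
  let s := if \sum_(i < m) weight x i * \sum_(c < N) u i c
              <= 2 * gamma' * delta * drift x e then delta else - delta in
  (fun c => if alive x c then x c + s * e c else x c, gamma').

Definition potential x : R := \sum_(i < m) weight x i.

Definition unrest x : R := \sum_(c < N) (if alive x c then 1 - x c ^+ 2 else 0).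

Variable L : R.
(** Factors of alive columns are at least [beta], so [eta] bounds the total relative change of a row
    in one step. *)
Let eta := delta / beta * L.

Hypotheses (delta_gt0 : 0 < delta) (delta_beta : delta <= beta) (beta_le1 : beta < 1).
Hypothesis W_ge0 : forall i, 0 <= W i.
Hypothesis t_le1 : forall i c, `|t i c| <= 1.
Hypothesis t_supp : forall i c, (N <= c)%N -> t i c = 0.
Hypothesis t_sum : forall i, \sum_(c < N) `|t i c| <= L.
Hypothesis eta_small : eta <= 1 / 2.

Lemma norm_sqr1 (a : R) : a ^+ 2 = 1 -> `|a| = 1.
Proof. by move/eqP; rewrite sqrf_eq1 => /orP[] /eqP ->; rewrite ?normrN normr1. Qed.

Lemma alive_lt x c : alive x c -> `|x c| < 1 - beta.
Proof.
rewrite /alive; apply: contraNT; rewrite -leNgt => h.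
rewrite -!expr2 -[x c ^+ 2]real_normK ?num_real // lerXn2r ?nnegrE //.
by rewrite subr_ge0 ltW.
Qed.

Lemma factor_ge0 x i c : `|x c| <= 1 -> 0 <= 1 + x c * t i c.
Proof.
move=> x1; have : `|x c * t i c| <= 1.
  by rewrite normrM mulr_ile1.
by rewrite ler_norml; lra.
Qed.

Lemma factor_alive x i c : alive x c -> beta <= 1 + x c * t i c.
Proof.
move=> /alive_lt x1; have : `|x c * t i c| <= 1 - beta.
  rewrite normrM; apply: le_trans (ltW x1).
  by rewrite ler_piMr.
by rewrite ler_norml; lra.
Qed.

Lemma weight_ge0 x i : (forall c, `|x c| <= 1) -> 0 <= weight x i.
Proof.
by move=> x1; rewrite mulr_ge0 // prodr_ge0 // => c _; exact: factor_ge0.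
Qed.

Lemma incr_le x i c : `|incr_of x i c| <= delta / beta * `|t i c|.
Proof.
have b0 : 0 < beta by exact: lt_le_trans delta_beta.
rewrite /incr_of; case: ifP => al; last first.
  by rewrite normr0 mulr_ge0 // divr_ge0 // ltW.
have f0 := factor_alive i al.
have fp : 0 < 1 + x c * t i c by exact: lt_le_trans f0.
rewrite !normrM normfV (gtr0_norm fp) (gtr0_norm delta_gt0) mulrAC.
by rewrite ler_wpM2r // ler_wpM2l ?(ltW delta_gt0) // lef_pV2.
Qed.

Lemma incr_sum x i : \sum_(c < N) `|incr_of x i c| <= eta.
Proof.
have b0 : 0 < beta by exact: lt_le_trans delta_beta.
apply: le_trans (_ : \sum_(c < N) delta / beta * `|t i c| <= _).
  by apply: ler_sum => c _; exact: incr_le.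
by rewrite -mulr_sumr ler_wpM2l // divr_ge0 // ltW.
Qed.

Lemma incr_supp x : supported D (incr_of x).
Proof.
by move=> i c Nc; rewrite /incr_of; case: ifP => // _; rewrite t_supp // mulr0 mul0r.
Qed.

(* The only terms besides the linear one are [S ^+ 2 - \sum_c incr_of x i c ^+ 2], whose
   weighted sum is at most 0 by [inner_variance], and an error of the third order. *)
Lemma weight_step x e (s : R) i : (forall c, `|x c| <= 1) ->
  (forall c, e c ^+ 2 = 1) -> s ^+ 2 = 1 ->
  weight (fun c => if alive x c then x c + s * delta * e c else x c) i <=
  weight x i * (1 + s * \sum_(c < N) e c * incr_of x i c +
    ((\sum_(c < N) e c * incr_of x i c) ^+ 2 - \sum_(c < N) incr_of x i c ^+ 2) / 2
    + eta ^+ 3).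
Proof.
move=> x1 e1 s1; pose y c := s * (e c * incr_of x i c).
have ny c : `|y c| = `|incr_of x i c|.
  by rewrite /y !normrM (norm_sqr1 s1) (norm_sqr1 (e1 c)) !mul1r.
have sy : \sum_(c < N) `|y c| <= eta.
  by under eq_bigr => c _ do rewrite ny; exact: incr_sum.
have [_ _ h] := prod_expansion (le_trans sy eta_small).
have -> : weight (fun c => if alive x c then x c + s * delta * e c else x c) i =
    weight x i * \prod_(c < N) (1 + y c).
  rewrite /weight -mulrA -big_split /=; congr (_ * _); apply: eq_bigr => c _.
  rewrite /y /incr_of; case: ifP => al; last by rewrite !mulr0 addr0 mulr1.
  have f0 := factor_alive i al.
  have : 1 + x c * t i c != 0.
    by rewrite gt_eqF //; apply: lt_le_trans f0; exact: lt_le_trans delta_beta.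
  by move=> fn; field.
apply: ler_wpM2l; first exact: weight_ge0.
have Sy : \sum_(c < N) y c = s * \sum_(c < N) e c * incr_of x i c.
  by rewrite mulr_sumr.
have Qy : \sum_(c < N) y c ^+ 2 = \sum_(c < N) incr_of x i c ^+ 2.
  by apply: eq_bigr => c _; rewrite /y !exprMn s1 e1 !mul1r.
move: h; rewrite Qy Sy exprMn s1 mul1r.
have : (\sum_(c < N) `|y c|) ^+ 3 <= eta ^+ 3.
  rewrite lerXn2r ?nnegrE // ?sumr_ge0 //.
  by apply: le_trans sy; rewrite sumr_ge0.
move=> h3 /ler_normlP[_ h]; move: h h3; lra.
Qed.

(** Each square grows by [delta ^+ 2] plus its drift term, and [delta ^+ 2 >= delta ^+ 2 * (1 - x c
    ^+ 2)]. A column that freezes contributes 0 instead of [1 - x' c ^+ 2], which is nonnegative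
    because [delta <= beta] keeps it inside the cube. *)
Lemma unrest_step x e (s : R) : (forall c, `|x c| <= 1) ->
  (forall c, e c ^+ 2 = 1) -> s ^+ 2 = 1 ->
  unrest (fun c => if alive x c then x c + s * delta * e c else x c) <=
  (1 - delta ^+ 2) * unrest x - 2 * s * delta * drift x e.
Proof.
move=> x1 e1 s1; rewrite /unrest /drift !mulr_sumr -sumrB.
apply: ler_sum => c _; set x' := fun c => _.
case al: (alive x c); last first.
  have -> : alive x' c = false by rewrite -al /alive /x' al.
  by rewrite !mulr0 subrr.
have x'E : x' c = x c + s * delta * e c by rewrite /x' al.
have ax := alive_lt al.
have E : (x c + s * delta * e c) ^+ 2 = x c ^+ 2 + 2 * s * delta * (x c * e c) + delta ^+ 2.
  by rewrite sqrrD !exprMn s1 e1; ring.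
have xc2 : 0 <= x c ^+ 2 by exact: sqr_ge0.
have d2 : 0 <= delta ^+ 2 by exact: sqr_ge0.
have : 0 <= delta ^+ 2 * x c ^+ 2 by exact: mulr_ge0.
case: ifP => al'; rewrite ?x'E ?E; first by nra.
have : 0 <= 1 - (x c + s * delta * e c) ^+ 2.
  have : `|x c + s * delta * e c| <= 1.
    apply: le_trans (ler_normD _ _) _.
    have -> : `|s * delta * e c| = delta.
      by rewrite !normrM (norm_sqr1 s1) (norm_sqr1 (e1 c)) mul1r mulr1 gtr0_norm.
    by have := lerD (ltW ax) delta_beta; rewrite subrK.
  rewrite -[X in 1 - X]real_normK ?num_real // => h.
  by rewrite subr_ge0 expr_le1.
by rewrite E; nra.
Qed.

Lemma walk_stepP x gamma : (forall c, `|x c| <= 1) -> 0 <= gamma ->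
  let: (x', gamma') := walk_step (x, gamma) in
  [/\ forall c, `|x' c| <= 1, 0 <= gamma', gamma' = gamma / (1 - delta ^+ 2) &
    potential x' + gamma' * unrest x' <=
    (1 + eta ^+ 3) * (potential x + gamma * unrest x)].
Proof.
move=> x1 g0; rewrite /walk_step.
have e1 := inner_sqr m D (weight x) (incr_of x) D.
have tot i := @inner_total R m D (weight x) (incr_of x) i (@incr_supp x).
have var := @inner_variance R m D (weight x) (incr_of x) (@incr_supp x)
  (fun i => weight_ge0 i x1).
move: e1 tot var; case: (inner _ _ _ _ _) => e u /= e1 tot var.
set g' := gamma / _; set b := (_ <= _).
pose s : R := if b then 1 else -1.
have -> : (if b then delta else - delta) = s * delta.
  by rewrite /s; case: (b); rewrite ?mul1r ?mulN1r.
have s1 : s ^+ 2 = 1 by rewrite /s; case: (b); ring.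
have d1 : delta * delta < 1.
  by rewrite -expr2 expr_lt1 ?(ltW delta_gt0) //; exact: le_lt_trans beta_le1.
have g'0 : 0 <= g' by rewrite divr_ge0 // subr_ge0 ltW.
split=> //.
- move=> c; case: ifP => // al; have := alive_lt al.
  have -> : x c + s * delta * e c = x c + s * e c * delta by ring.
  move=> xb; apply: le_trans (ler_normD _ _) _.
  rewrite !normrM (norm_sqr1 s1) (norm_sqr1 (e1 c)) !mul1r (gtr0_norm delta_gt0).
  by apply: le_trans (lerD (ltW xb) delta_beta) _; rewrite subrK.
- have U := unrest_step x1 e1 s1.
  have gU : g' * unrest (fun c => if alive x c then x c + s * delta * e c else x c)
      <= gamma * unrest x - 2 * s * delta * g' * drift x e.
    apply: le_trans (ler_wpM2l g'0 U) _.
    have -> : g' * ((1 - delta ^+ 2) * unrest x - 2 * s * delta * drift x e) =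
      g' * (1 - delta * delta) * unrest x - 2 * s * delta * g' * drift x e by ring.
    by rewrite /g' divfK // gt_eqF // subr_gt0.
  have Phi : potential (fun c => if alive x c then x c + s * delta * e c else x c) <=
      (1 + eta ^+ 3) * potential x + s * \sum_(i < m) weight x i * \sum_(c < N) u i c.
    apply: le_trans (ler_sum (index_enum _) (fun (i : 'I_m) _ => weight_step i x1 e1 s1)) _.
    have -> : \sum_(i < m) weight x i * (1 + s * \sum_(c < N) e c * incr_of x i c +
        ((\sum_(c < N) e c * incr_of x i c) ^+ 2 - \sum_(c < N) incr_of x i c ^+ 2) / 2
        + eta ^+ 3) =
      (1 + eta ^+ 3) * potential x + s * (\sum_(i < m) weight x i * \sum_(c < N) u i c)
      + (\sum_(i < m) weight x i * (\sum_(c < N) e c * incr_of x i c) ^+ 2 -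
         \sum_(i < m) weight x i * \sum_(c < N) incr_of x i c ^+ 2) / 2.
      rewrite /potential !mulr_sumr -sumrB mulr_suml -!big_split /=.
      by apply: eq_bigr => i _; rewrite tot; field.
    by move: var; lra.
  have sgn : s * \sum_(i < m) weight x i * (\sum_(c < N) u i c) <=
      2 * s * delta * g' * drift x e.
    have -> : 2 * s * delta * g' * drift x e = s * (2 * g' * delta * drift x e) by ring.
    rewrite /s; case: ifP; rewrite /b ?mul1r // => /negbT; rewrite -ltNge => /ltW h.
    by rewrite !mulN1r lerN2.
  have : 0 <= eta ^+ 3 * (gamma * unrest x).
    apply: mulr_ge0.
      by rewrite exprn_ge0 // /eta; apply: le_trans (incr_sum x 0); exact: sumr_ge0.
    apply: mulr_ge0 => //; apply: sumr_ge0 => c _; case: ifP => // al.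
    have := alive_lt al; move=> _; rewrite subr_ge0 -real_normK ?num_real //.
    by rewrite expr_le1.
  rewrite mulrDr; move: gU Phi sgn; lra.
Qed.

End Walk.

Section WalkDefs.
Variables (R : realFieldType) (m D b : nat) (W : nat -> R) (t : nat -> nat -> R).

(* The step is 1 / (2 b ^ 8): the walk needs about (2 b ^ 8) ^ 2 * 2 b steps to freeze all
   columns, and the errors of the third order, at most 1 / (2 b ^ 6) ^ 3 each, add up to
   at most 1 / b. *)
Definition steps_inv : nat := 2 * b ^ 8.
Definition num_steps : nat := 8 * b ^ 17.
Definition delta : R := steps_inv%:R^-1.
Definition beta : R := b%:R^-1.
(** As [unrest] is at most [2 ^ D], the second potential starts at no more than a fraction [1 / D]
    of the first. *)
Definition gamma0 : R := (\sum_(i < m) W i) / ((2 ^ D)%:R * D%:R).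
Definition walk k : (nat -> R) * R :=
  iter k (walk_step m D W t delta beta) (fun=> 0, gamma0).
Definition sign_of (x : nat -> R) c : R := if 0 <= x c then 1 else -1.

Lemma num_stepsE : num_steps = (8 * b ^ 17)%N.
Proof. by []. Qed.

End WalkDefs.

Section WalkEnd.
Variables (R : realType) (m D b : nat) (W : nat -> R) (t : nat -> nat -> R) (L : R).
Local Notation N := (2 ^ D)%N.
Local Notation steps_inv := (steps_inv b).
Local Notation num_steps := (num_steps b).
Local Notation delta := (delta R b).
Local Notation beta := (beta R b).
Local Notation gamma0 := (gamma0 m D W).
Local Notation walk := (walk m D b W t).

Hypotheses (D_gt0 : (0 < D)%N) (b_large : (2 + 2 * D <= b)%N).
Hypothesis L_b : L * D%:R <= b%:R.
Hypothesis W_ge0 : forall i, 0 <= W i.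
Hypothesis t_le1 : forall i c, `|t i c| <= 1.
Hypothesis t_supp : forall i c, (N <= c)%N -> t i c = 0.
Hypothesis t_sum : forall i, \sum_(c < N) `|t i c| <= L.

Let L_ge0 : 0 <= L.
Proof. by apply: le_trans (t_sum 0); apply: sumr_ge0. Qed.

Let D1 : 1 <= D%:R :> R. Proof. by rewrite ler1n. Qed.
Let b4 : 4 <= b%:R :> R. Proof. by rewrite ler_nat; lia. Qed.
Let bD : 2 + 2 * D%:R <= b%:R :> R.
Proof. by rewrite -natrM -natrD ler_nat. Qed.

Let qE : steps_inv%:R = 2 * b%:R ^+ 8 :> R.
Proof. by rewrite natrM natrX. Qed.

Let q_gt0 : 0 < steps_inv%:R :> R.
Proof. by rewrite qE mulr_gt0 // exprn_gt0 //; have := b4; lra. Qed.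

Let delta_gt0 : 0 < delta. Proof. by rewrite invr_gt0. Qed.
Let beta_gt0 : 0 < beta. Proof. by rewrite invr_gt0; have := b4; lra. Qed.

Let Lb : L <= b%:R.
Proof. by apply: le_trans L_b; rewrite ler_peMr. Qed.

Let b_le_q : b%:R <= steps_inv%:R :> R.
Proof.
rewrite qE; have b0 := b4; have : b%:R ^+ 1 <= b%:R ^+ 8 :> R by apply: ler_weXn2l => //; lra.
by rewrite expr1; lra.
Qed.

Let delta_beta : delta <= beta.
Proof. by rewrite lef_pV2 ?posrE //; have := b4; lra. Qed.

Let beta_lt1 : beta < 1.
Proof. by rewrite invf_lt1; have := b4; lra. Qed.

Let eta := delta / beta * L.
Let eta_ge0 : 0 <= eta.
Proof. by rewrite mulr_ge0 // divr_ge0 // ltW. Qed.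

Let eta_le : eta <= (2 * b%:R ^+ 6)^-1.
Proof.
have b0 : 0 < b%:R :> R by have := b4; lra.
have -> : (2 * b%:R ^+ 6)^-1 = delta / beta * b%:R :> R.
  by rewrite /delta /beta qE; field; rewrite gt_eqF.
by rewrite ler_wpM2l // divr_ge0 // ltW.
Qed.

Let eta_small : eta <= 1 / 2.
Proof.
apply: le_trans eta_le _; have b0 := b4.
have : 1 <= b%:R ^+ 6 :> R by apply: exprn_ege1; lra.
by move=> h; rewrite div1r lef_pV2 ?posrE; lra.
Qed.

Let eta_steps : num_steps%:R * eta ^+ 3 <= D%:R^-1.
Proof.
have b0 : 0 < b%:R :> R by have := b4; lra.
have h : eta ^+ 3 <= ((2 * b%:R ^+ 6)^-1) ^+ 3.
  by rewrite lerXn2r ?nnegrE // invr_ge0 mulr_ge0 // exprn_ge0 // ltW.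
apply: le_trans (ler_wpM2l (ler0n _ _) h) _.
have -> : num_steps%:R * ((2 * b%:R ^+ 6)^-1) ^+ 3 = b%:R^-1 :> R.
  by rewrite natrM natrX; field; rewrite gt_eqF.
by rewrite lef_pV2 ?posrE //; move: D1 bD; lra.
Qed.

Let x_ k := (walk k).1.
Let g_ k := (walk k).2.
Let Phi := potential m D W t.
Let Psi := unrest D beta.

Lemma walkP k : [/\ forall c, `|x_ k c| <= 1, 0 <= g_ k,
  g_ k = gamma0 / (1 - delta ^+ 2) ^+ k &
  Phi (x_ k) + g_ k * Psi (x_ k) <=
  (1 + eta ^+ 3) ^+ k * (Phi (x_ 0%N) + g_ 0%N * Psi (x_ 0%N))].
Proof.
elim: k => [|k [x1 g0 gE IH]].
  split=> //=; rewrite ?expr0 ?mul1r ?divr1 //.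
    by move=> c; rewrite normr0.
  by rewrite /g_ /= /gamma0 divr_ge0 ?sumr_ge0 // mulr_ge0.
have := @walk_stepP _ m D W t delta beta L delta_gt0 delta_beta beta_lt1 W_ge0
  t_le1 t_supp t_sum eta_small (x_ k) (g_ k) x1 g0.
have -> : walk_step m D W t delta beta (x_ k, g_ k) = (x_ k.+1, g_ k.+1).
  rewrite /x_ /g_ {3 4}/walk iterS -/(walk k).
  by rewrite -[in LHS](surjective_pairing) -surjective_pairing.
move=> [x1' g0' gE' step]; split=> //.
  by rewrite gE' gE (exprSr (1 - delta ^+ 2)) invfM mulrA mulrAC.
apply: le_trans step _; rewrite (exprS (1 + eta ^+ 3)) -[X in _ <= X]mulrA ler_wpM2l //.
by rewrite addr_ge0 // exprn_ge0.
Qed.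

Let Phi0E : Phi (x_ 0%N) = \sum_(i < m) W i.
Proof.
apply: eq_bigr => i _; rewrite /weight big1 ?mulr1 // => c _.
by rewrite /x_ /= mul0r addr0.
Qed.

Let Phi0_ge0 : 0 <= \sum_(i < m) W i. Proof. exact: sumr_ge0. Qed.

Let Nn0 : 0 < N%:R :> R. Proof. by rewrite ltr0n expn_gt0. Qed.

(** One factor [expR (1 / D)] pays for the third-order errors of all steps, the other for the second
    potential at the start. *)
Let total_le : Phi (x_ num_steps) + g_ num_steps * Psi (x_ num_steps) <=
  expR (2 / D%:R) * \sum_(i < m) W i.
Proof.
have [_ _ _ h] := walkP num_steps; apply: le_trans h _.
have D0 : 0 < D%:R :> R by exact: lt_le_trans D1.
have h1 : (1 + eta ^+ 3) ^+ num_steps <= expR (D%:R^-1).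
  apply: le_trans (_ : expR (num_steps%:R * eta ^+ 3) <= _); last by rewrite ler_expR.
  rewrite expRM_natl lerXn2r ?nnegrE ?expR_ge0 ?expR_ge1Dx //.
  by rewrite addr_ge0 // exprn_ge0.
have h2 : Phi (x_ 0%N) + g_ 0%N * Psi (x_ 0%N) <= expR (D%:R^-1) * \sum_(i < m) W i.
  apply: le_trans (ler_wpM2r Phi0_ge0 (expR_ge1Dx _)).
  rewrite Phi0E mulrDl mul1r lerD2l /g_ /= /gamma0.
  apply: le_trans (_ : (\sum_(i < m) W i) / (N%:R * D%:R) * N%:R <= _).
    apply: ler_wpM2l; first by rewrite divr_ge0 // mulr_ge0 // ltW.
    rewrite /Psi /unrest -[N in N%:R]card_ord -sum1_card natr_sum.
    apply: ler_sum => c _; rewrite /x_ /=; case: ifP => // _.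
    by rewrite expr0n subr0.
  by rewrite le_eqVlt; apply/orP; left; apply/eqP; field; rewrite !gt_eqF.
have -> : 2 / D%:R = D%:R^-1 + D%:R^-1 :> R by field; rewrite gt_eqF.
rewrite expRD -mulrA; apply: ler_pM => //.
- by rewrite exprn_ge0 // addr_ge0 // exprn_ge0.
- rewrite Phi0E; apply: addr_ge0 => //; apply: mulr_ge0; first by have [] := walkP 0.
  by apply: sumr_ge0 => c _; rewrite /x_ /=; case: ifP => // _; rewrite expr0n subr0.
Qed.

Let x_end := x_ num_steps.

Let Psi_ge (x : nat -> R) c : (forall c, `|x c| <= 1) -> (c < N)%N ->
  alive beta x c -> 1 - x c ^+ 2 <= Psi x.
Proof.
move=> x1 cN al; rewrite /Psi /unrest (bigD1 (Ordinal cN)) //= al lerDl.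
apply: sumr_ge0 => c' _; case: ifP => // _.
by rewrite subr_ge0 -real_normK ?num_real // expr_le1.
Qed.

(** One alive column alone gives [unrest >= beta]. But [gamma] has grown by at least [expR (2 * b)],
    since [num_steps * delta ^+ 2 = 2 * b]. With [2 ^ D] and [D] at most [expR D] and [b < expR b],
    the bound on the total potential would then contradict [2 + 2 * D <= b]. *)
Lemma walk_dead c : 0 < \sum_(i < m) W i -> (c < N)%N -> ~~ alive beta x_end c.
Proof.
move=> W0 cN; apply/negP => al.
have [x1 g0 gE _] := walkP num_steps.
have D0 : 0 < D%:R :> R by exact: lt_le_trans D1.
have b0 : 0 < b%:R :> R by have := b4; lra.
have := @Psi_ge x_end c x1 cN al.
have ax := alive_lt beta_lt1 al.
have x2 : x_end c ^+ 2 <= `|x_end c|.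
  by rewrite -real_normK ?num_real // expr2 ler_piMl // ltW // (lt_trans ax) // ltrBlDr ltrDl.
move=> hP.
have Pb : beta <= Psi x_end by apply: le_trans hP; move: ax x2; lra.
have Phige : 0 <= Phi x_end.
  by apply: sumr_ge0 => i _; apply: weight_ge0.
have gP : g_ num_steps * beta <= expR 2 * \sum_(i < m) W i.
  apply: le_trans (_ : g_ num_steps * Psi x_end <= _); first exact: ler_wpM2l.
  apply: le_trans (_ : expR (2 / D%:R) * \sum_(i < m) W i <= _).
    by move: total_le Phige; rewrite -/x_end; lra.
  by rewrite ler_wpM2r // ler_expR ler_pdivrMr // ler_peMr.
have dpow : (1 - delta ^+ 2) ^+ num_steps <= expR (- (2 * b%:R)).
  have d1 : 0 <= 1 - delta ^+ 2.
    rewrite subr_ge0 expr_le1 ?(ltW delta_gt0) //.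
    by apply: le_trans delta_beta _; exact: ltW.
  apply: le_trans (_ : expR (num_steps%:R * - delta ^+ 2) <= _).
    by rewrite expRM_natl lerXn2r ?nnegrE ?expR_ge0 ?expR_ge1Dx.
  rewrite ler_expR mulrN lerN2 natrM natrX /delta qE.
  by rewrite le_eqVlt; apply/orP; left; apply/eqP; field; rewrite gt_eqF.
have dpos : 0 < (1 - delta ^+ 2) ^+ num_steps.
  rewrite exprn_gt0 // subr_gt0 expr_lt1 ?(ltW delta_gt0) //.
  exact: le_lt_trans beta_lt1.
have Nle : N%:R <= expR D%:R :> R.
  rewrite natrX -[X in expR X]mulr1 expRM_natl lerXn2r ?nnegrE ?expR_ge0 //.
  by apply: le_trans (expR_ge1Dx _); lra.
have Dle : D%:R <= expR D%:R :> R.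
  by apply: le_trans (expR_ge1Dx _); rewrite lerDr.
have ble : b%:R < expR b%:R :> R.
  by apply: lt_le_trans (expR_ge1Dx _); rewrite ltrDr.
move: gP; rewrite gE /gamma0 /beta.
set S := \sum_(i < m) W i in W0 *; set p := (1 - _) ^+ _ in dpow dpos *.
have -> : S / (N%:R * D%:R) / p / b%:R = S * (N%:R * D%:R * p * b%:R)^-1.
  by field; rewrite !gt_eqF.
rewrite [_ * S]mulrC ler_pM2l // => h.
have : 1 <= expR 2 * (N%:R * D%:R * p * b%:R).
  have pos : 0 < N%:R * D%:R * p * b%:R by rewrite !mulr_gt0.
  by rewrite -(ler_pM2r (x := (N%:R * D%:R * p * b%:R)^-1)) ?invr_gt0 // mul1r mulfK ?gt_eqF.
apply/negP; rewrite -ltNge.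
have e0 (y : R) := expR_gt0 y.
have l1 : N%:R * D%:R <= expR D%:R * expR D%:R :> R by apply: ler_pM => //; exact: ltW.
have l2 : N%:R * D%:R * p <= expR D%:R * expR D%:R * expR (- (2 * b%:R)).
  by apply: ler_pM => //; rewrite ?mulr_ge0 // ltW.
have l3 : N%:R * D%:R * p * b%:R < expR D%:R * expR D%:R * expR (- (2 * b%:R)) * expR b%:R.
  apply: le_lt_trans (ler_wpM2r (ltW b0) l2) _.
  by rewrite ltr_pM2l ?mulr_gt0.
have : expR 2 * (N%:R * D%:R * p * b%:R) <
    expR 2 * (expR D%:R * expR D%:R * expR (- (2 * b%:R)) * expR b%:R).
  by rewrite ltr_pM2l.
move=> l4; apply: lt_le_trans l4 _; rewrite -!expRD -[X in _ <= X]expR0 ler_expR.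
by move: bD; lra.
Qed.

(** Rounding a frozen coordinate multiplies a factor by at most [1 + beta * |t|]: if [x] and [t]
    have opposite signs the factor does not even grow, otherwise [|x| >= 1 - beta] suffices. The row
    gains at most [expR (beta * L)], and [beta * L <= 1 / D]. *)
Lemma walk_round : (forall c, (c < N)%N -> ~~ alive beta x_end c) ->
  \sum_(i < m) W i * \prod_(c < N) (1 + sign_of x_end c * t i c) <=
  expR (3 / D%:R) * \sum_(i < m) W i.
Proof.
move=> dead; have [x1 g0 _ _] := walkP num_steps.
have D0 : 0 < D%:R :> R by exact: lt_le_trans D1.
have b0 : 0 < b%:R :> R by have := b4; lra.
have Phile : Phi x_end <= expR (2 / D%:R) * \sum_(i < m) W i.
  apply: le_trans total_le; rewrite lerDl mulr_ge0 //.
  apply: sumr_ge0 => c _; case: ifP => // al.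
  by rewrite subr_ge0 -real_normK ?num_real // expr_le1.
have -> : 3 / D%:R = D%:R^-1 + 2 / D%:R :> R by field; rewrite gt_eqF.
rewrite expRD -mulrA; apply: le_trans (ler_wpM2l (expR_ge0 _) Phile).
rewrite /Phi /potential mulr_sumr; apply: ler_sum => i _.
rewrite /weight mulrCA; apply: ler_wpM2l => //.
apply: le_trans (_ : expR (beta * \sum_(c < N) `|t i c|) *
    \prod_(c < N) (1 + x_end c * t i c) <= _); last first.
  apply: ler_wpM2r.
    by apply: prodr_ge0 => c _; apply: (factor_ge0 t_le1).
  rewrite ler_expR; apply: le_trans (ler_wpM2l (ltW beta_gt0) (t_sum i)) _.
  by rewrite /beta -(ler_pM2r D0) mulVf ?gt_eqF // -mulrA mulrC ler_pdivrMr // mul1r.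
rewrite mulr_sumr expR_sum -big_split /=; apply: ler_prod => c _.
have tc := t_le1 i c; have xc : `|x_end c| <= 1 := x1 c.
apply/andP; split.
  have : `|sign_of x_end c * t i c| <= 1.
    by rewrite normrM /sign_of; case: ifP; rewrite ?normrN normr1 mul1r.
  by rewrite ler_norml; lra.
apply: le_trans (_ : (1 + beta * `|t i c|) * (1 + x_end c * t i c) <= _); last first.
  by apply: ler_wpM2r; [exact: (factor_ge0 t_le1) | exact: expR_ge1Dx].
have : 1 - beta <= `|x_end c|.
  have := dead c (ltn_ord c); rewrite negbK -!expr2 -[x_end c ^+ 2]real_normK ?num_real //.
  rewrite ler_pXn2r ?nnegrE // subr_ge0; exact: ltW.
have bt : 0 <= beta * `|t i c| by rewrite mulr_ge0 // ltW.
rewrite /sign_of; case: ifP => xs.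
  rewrite ger0_norm // mul1r => h; move: xc; rewrite ger0_norm // => xc.
  case: (lerP 0 (t i c)) => ts.
    move: bt tc; rewrite ger0_norm // => bt tc.
    have : 0 <= (x_end c - 1 + beta) * t i c by apply: mulr_ge0 => //; lra.
    have : 0 <= beta * t i c * (x_end c * t i c) by apply: mulr_ge0 => //; exact: mulr_ge0.
    by nra.
  move: bt tc; rewrite ltr0_norm // => bt tc.
  have : 0 <= (1 - x_end c) * - t i c by apply: mulr_ge0; lra.
  have : 0 <= beta * - t i c * (1 + x_end c * t i c).
    by apply: mulr_ge0 => //; exact: (factor_ge0 t_le1).
  by nra.
have xn : x_end c < 0 by rewrite ltNge xs.
rewrite ltr0_norm // mulN1r => h; move: xc; rewrite ltr0_norm // => xc.
case: (lerP 0 (t i c)) => ts.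
  move: bt tc; rewrite ger0_norm // => bt tc.
  have : 0 <= (1 + x_end c) * t i c by apply: mulr_ge0 => //; lra.
  have : 0 <= beta * t i c * (1 + x_end c * t i c).
    by apply: mulr_ge0 => //; exact: (factor_ge0 t_le1).
  by nra.
move: bt tc; rewrite ltr0_norm // => bt tc.
have : 0 <= (- x_end c - 1 + beta) * - t i c by apply: mulr_ge0; lra.
have : 0 <= beta * - t i c * (- x_end c * - t i c).
  by apply: mulr_ge0 => //; apply: mulr_ge0; lra.
by nra.
Qed.

End WalkEnd.

(** * Merging the columns *)

Section TreeDefs.
Variables (R : realFieldType) (m D b : nat).
Local Notation N := (2 ^ D)%N.
Implicit Types (z : nat -> nat -> R) (r : R).

(** With [tanh_of], the hyperbolic functions of [ln r], in a rational form that the machine can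
    compute. *)
Definition cosh_of r : R := (r + r^-1) / 2.
Definition tanh_of r : R := (r - r^-1) / (r + r^-1).

Definition row_weight z i : R := \prod_(c < N) cosh_of (z i c).
Definition pair_tanh z i c : R := tanh_of (z i (c * 2)%N) * tanh_of (z i (c * 2 + 1)%N).
Definition signs z : nat -> R := (walk m D b (row_weight z) (pair_tanh z) (num_steps b)).1.
Definition combine (x : nat -> R) c r r' : R := if 0 <= x c then r * r' else r / r'.
(** At level [k] the original column [j] has become part of column [j %/ 2 ^ k]. Its sign changes
    only if that column is the right one of its pair and the pair has a negative sign. *)
Definition flip (x : nat -> R) k (chi : nat -> R) j : R :=
  if odd (j %/ 2 ^ k) then
    if 0 <= x (j %/ 2 ^ k %/ 2)%N then chi j else 0 - chi j
  else chi j.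

(* The matrices have [2 ^ D] columns at all levels: columns without meaning have the
   entry 1, which has no effect on the products. *)
Fixpoint tree z k : (nat -> nat -> R) * (nat -> R) :=
  if k is k'.+1 then
    let: (v, chi) := tree z k' in
    (fun i c => combine (signs v) c (v i (c * 2)%N) (v i (c * 2 + 1)%N),
     flip (signs v) k' chi)
  else (z, fun=> 1).

Lemma tanh_of1 : tanh_of 1 = 0.
Proof. by rewrite /tanh_of invr1 subrr mul0r. Qed.

Lemma cosh_of1 : cosh_of 1 = 1.
Proof. by rewrite /cosh_of invr1; lra. Qed.

End TreeDefs.

Section Tree.
Variables (R : realType) (m D b : nat).
Local Notation N := (2 ^ D)%N.
Local Notation row_weight := (@row_weight R D).
Local Notation signs := (@signs R m D b).
Local Notation tree := (@tree R m D b).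
Implicit Types (z : nat -> nat -> R) (r : R).

Lemma cosh_of_ge1 r : 0 < r -> 1 <= cosh_of r.
Proof.
move=> r0; have h : 0 <= (r - 1) ^+ 2 / (2 * r).
  by rewrite divr_ge0 ?sqr_ge0 // mulr_ge0 // ltW.
have : cosh_of r = 1 + (r - 1) ^+ 2 / (2 * r) by rewrite /cosh_of; field; rewrite gt_eqF.
by lra.
Qed.

Lemma tanh_of_sqr r : 0 < r -> tanh_of r ^+ 2 = 1 - (cosh_of r ^+ 2)^-1.
Proof.
move=> r0; rewrite /tanh_of /cosh_of; field.
have : 0 < r ^+ 2 + 1 by rewrite ltr_wpDl ?sqr_ge0.
have : 0 < r * r + 1 by rewrite ltr_wpDl // mulr_ge0 ?ltW.
by move=> h1 h2; rewrite !gt_eqF.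
Qed.

Lemma tanh_of_lt1 r : 0 < r -> `|tanh_of r| <= 1.
Proof.
move=> r0; rewrite -(expr_le1 (n := 2)) // real_normK ?num_real // tanh_of_sqr //.
by rewrite lerBlDr lerDl invr_ge0 sqr_ge0.
Qed.

(** This is [ln y <= y - 1] at [y = 1 / cosh ^+ 2 = 1 - tanh ^+ 2]. *)
Lemma tanh_of_le_ln r : 0 < r -> tanh_of r ^+ 2 <= 2 * ln (cosh_of r).
Proof.
move=> r0; have c1 := cosh_of_ge1 r0.
have c0 : 0 < cosh_of r by exact: lt_le_trans c1.
rewrite tanh_of_sqr // mulrC mulr_natr -lnXn //.
rewrite -[X in ln X]invrK lnV ?posrE ?invr_gt0 ?exprn_gt0 //.
set y := (cosh_of r ^+ 2)^-1.
have y0 : 0 < y by rewrite invr_gt0 exprn_gt0.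
have := @le_ln1Dx R (y - 1); have -> : 1 + (y - 1) = y by ring.
by move=> h; have := h (ltac:(lra)); lra.
Qed.

(** The addition formula [cosh (u + e v) = cosh u * cosh v * (1 + e * tanh u * tanh v)] for a sign
    [e]. *)
Lemma cosh_of_combine x c r r' : 0 < r -> 0 < r' ->
  cosh_of (combine x c r r') =
  cosh_of r * cosh_of r' * (1 + sign_of x c * (tanh_of r * tanh_of r')).
Proof.
move=> r0 r'0; have r1 : 0 < r ^+ 2 + 1 by rewrite ltr_wpDl ?sqr_ge0.
have r'1 : 0 < r' ^+ 2 + 1 by rewrite ltr_wpDl ?sqr_ge0.
have r2 : 0 < r * r + 1 by rewrite -expr2.
have r'2 : 0 < r' * r' + 1 by rewrite -expr2.
rewrite /cosh_of /tanh_of /combine /sign_of; case: ifP => _; field.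
  by rewrite !gt_eqF.
by rewrite !gt_eqF.
Qed.

Section Level.
Variable z : nat -> nat -> R.
Hypothesis z_gt0 : forall i c, 0 < z i c.
Hypothesis z_supp : forall i c, (N <= c)%N || (m <= i)%N -> z i c = 1.

Lemma row_weight_ge1 i : 1 <= row_weight z i.
Proof.
rewrite /row_weight; elim/big_rec: _ => // c x _ x1.
by apply: mulr_ege1 => //; exact: cosh_of_ge1.
Qed.

Lemma pair_tanh_supp i c : (N <= c)%N -> pair_tanh z i c = 0.
Proof. by move=> Nc; rewrite /pair_tanh !z_supp ?tanh_of1 ?mul0r //; lia. Qed.

Lemma pair_tanh_le1 i c : `|pair_tanh z i c| <= 1.
Proof. by rewrite normrM mulr_ile1 ?tanh_of_lt1. Qed.

(* Since [tanh ^+ 2 <= 2 * ln cosh], the total variation of the factors of the walk is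
   bounded by the logarithm of the potential. *)
Lemma pair_tanh_sum i : \sum_(c < N) `|pair_tanh z i c| <= ln (row_weight z i).
Proof.
have -> : ln (row_weight z i) = \sum_(c < N) ln (cosh_of (z i c)).
  rewrite /row_weight.
  suff [_ ->] : 0 < \prod_(c < N) cosh_of (z i c) /\
    ln (\prod_(c < N) cosh_of (z i c)) = \sum_(c < N) ln (cosh_of (z i c)) by [].
  elim/big_rec2: _ => [|c s p _ [p0 IHs]]; first by rewrite ln1.
  have c0 : 0 < cosh_of (z i c) by exact: lt_le_trans (cosh_of_ge1 _).
  by split; [rewrite mulr_gt0 | rewrite lnM ?posrE // IHs].
rewrite (@big_half _ _ _ N (fun c => ln (cosh_of (z i c)))); last first.
  by move=> c Nc; rewrite z_supp ?Nc // cosh_of1 ln1.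
apply: ler_sum => c _; rewrite /pair_tanh.
have := tanh_of_le_ln (z_gt0 i (c * 2)); have := tanh_of_le_ln (z_gt0 i (c * 2 + 1)).
set u := tanh_of _; set v := tanh_of _; rewrite /= normrM => h1 h2.
(* AM-GM: [|u * v|] is at most half of [u ^+ 2 + v ^+ 2], and each square is at most twice a
   logarithm. *)
have : 0 <= (`|u| - `|v|) ^+ 2 by rewrite sqr_ge0.
rewrite sqrrB !real_normK ?num_real // => h3.
rewrite mulrC; move: h1 h2 h3; nra.
Qed.

Variable L : R.
Hypotheses (D_gt0 : (0 < D)%N) (b_large : (2 + 2 * D <= b)%N).
Hypothesis L_b : L * D%:R <= b%:R.
Hypothesis L_ge0 : 0 <= L.
Hypothesis W_le : \sum_(i < m) row_weight z i <= expR L.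
Hypothesis m_gt0 : (0 < m)%N.

Let z' i c := combine (signs z) c (z i (c * 2)%N) (z i (c * 2 + 1)%N).

Lemma level_gt0 i c : 0 < z' i c.
Proof. by rewrite /z' /combine; case: ifP => _; rewrite ?divr_gt0 ?mulr_gt0. Qed.

Lemma level_supp i c : (N <= c)%N || (m <= i)%N -> z' i c = 1.
Proof.
move=> h; have [h1 h2] : ((N <= c * 2) || (m <= i))%N /\ ((N <= c * 2 + 1) || (m <= i))%N.
  by move: h; clear; lia.
by rewrite /z' /combine !z_supp // divr1 mulr1; case: ifP.
Qed.

(** All row weights are at least 1 and sum to at most [expR L], so each has logarithm at most [L],
    as the walk requires. The rounded products then regroup into the weights of the merged rows. *)
Lemma level_weight :
  \sum_(i < m) row_weight z' i <= expR (3 / D%:R) * \sum_(i < m) row_weight z i.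
Proof.
have W0 i : 0 <= row_weight z i by apply: le_trans (row_weight_ge1 i).
have ts i : \sum_(c < N) `|pair_tanh z i c| <= L.
  case: (ltnP i m) => im.
    apply: le_trans (pair_tanh_sum i) _; rewrite -[L]expRK ler_ln ?posrE ?expR_gt0 //.
      apply: le_trans W_le; rewrite (bigD1 (Ordinal im)) //= lerDl sumr_ge0 //.
    exact: lt_le_trans (row_weight_ge1 i).
  (* The walk assumes its bounds for all indices of rows; from [m] on, the entries are all 1. *)
  rewrite big1 // => c _; rewrite /pair_tanh !z_supp ?im ?orbT //.
  by rewrite tanh_of1 mul0r normr0.
have Wpos : 0 < \sum_(i < m) row_weight z i.
  rewrite (bigD1 (Ordinal m_gt0)) //= ltr_wpDr ?sumr_ge0 //.
  exact: lt_le_trans (row_weight_ge1 0).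
have dead := fun c => @walk_dead R m D b _ _ L D_gt0 b_large L_b W0 pair_tanh_le1
  pair_tanh_supp ts c Wpos.
apply: le_trans (@walk_round R m D b _ _ L D_gt0 b_large L_b W0 pair_tanh_le1
  pair_tanh_supp ts dead).
apply: ler_sum => i _; rewrite /row_weight (@big_half _ _ _ N (fun c => cosh_of (z i c))).
  by rewrite -big_split /=; apply: ler_prod => c _; rewrite cosh_of_combine // lexx andbT
    -cosh_of_combine // (le_trans _ (cosh_of_ge1 _)) // level_gt0.
by move=> c Nc; rewrite z_supp ?Nc // cosh_of1.
Qed.

End Level.

Section Run.
Variables (z : nat -> nat -> R) (L : R).
Hypothesis z_gt0 : forall i c, 0 < z i c.
Hypothesis z_supp : forall i c, (N <= c)%N || (m <= i)%N -> z i c = 1.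
Hypotheses (D_gt0 : (0 < D)%N) (b_large : (2 + 2 * D <= b)%N).
Hypothesis L_b : L * D%:R <= b%:R.
Hypothesis L_ge0 : 0 <= L.
Hypothesis W_le : expR 3 * \sum_(i < m) row_weight z i <= expR L.
Hypothesis m_gt0 : (0 < m)%N.

(** The slack [expR 3] in [W_le] covers the losses of all [D] levels, so that one [L] is valid
    throughout. *)
Lemma treeP k : (k <= D)%N ->
  [/\ forall i c, 0 < (tree z k).1 i c,
      forall i c, (N <= c)%N || (m <= i)%N -> (tree z k).1 i c = 1 &
      \sum_(i < m) row_weight (tree z k).1 i <=
        expR (k%:R * (3 / D%:R)) * \sum_(i < m) row_weight z i].
Proof.
elim: k => [|k IH] kD; first by split=> //=; rewrite mul0r expR0 mul1r.
have [v0 v1 vW] := IH (ltnW kD); rewrite [tree _ _]/=.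
case E : (tree z k) v0 v1 vW => [v chi] /= v0 v1 vW.
have D0 : 0 < D%:R :> R by rewrite ltr0n.
have S0 : 0 <= \sum_(i < m) row_weight z i.
  by apply: sumr_ge0 => i _; apply: le_trans (row_weight_ge1 z_gt0 i).
split.
- exact: (level_gt0 v0).
- exact: (level_supp v1).
- apply: le_trans (level_weight v0 v1 D_gt0 b_large L_b L_ge0 _ m_gt0) _.
    apply: le_trans vW _; apply: le_trans W_le; rewrite ler_wpM2r // ler_expR.
    rewrite mulrCA ger_pMr // ler_pdivrMr // mul1r ler_nat; exact: ltnW.
  have -> : k.+1%:R * (3 / D%:R) = 3 / D%:R + k%:R * (3 / D%:R) :> R.
    by rewrite -(@natr1 _ k); ring.
  by rewrite expRD -[X in _ <= X]mulrA ler_wpM2l ?expR_ge0.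
Qed.

Lemma tree_sign k j : (tree z k).2 j = 1 \/ (tree z k).2 j = -1.
Proof.
elim: k => [|k]; first by left.
rewrite [tree z k.+1]/=; case: (tree z k) => v chi /=.
by rewrite /flip; case: ifP => // _; case: ifP => // _ [] ->; [right|left]; ring.
Qed.

(** Merging with a sign adds or subtracts logarithms, and [flip] applies the same sign to the right
    half of the block. *)
Lemma tree_sum k i c : (k <= D)%N ->
  \sum_(j < 2 ^ k) (tree z k).2 (c * 2 ^ k + j)%N * ln (z i (c * 2 ^ k + j)%N) =
  ln ((tree z k).1 i c).
Proof.
elim: k c => [|k IH] c kD; first by rewrite big_ord1 /= expn0 muln1 addn0 mul1r.
have [v0 _ _] := treeP (ltnW kD).
rewrite [in LHS]expnS mul2n -addnn big_split_ord.
move: (fun c => IH c (ltnW kD)) v0; rewrite [tree z k.+1]/=.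
case: (tree z k) => v chi /= {}IH v0.
have e1 j : (j < 2 ^ k)%N -> flip (signs v) k chi (c * (2 ^ k + 2 ^ k) + j)%N =
    chi (c * 2 * 2 ^ k + j)%N.
  move=> jk; rewrite /flip; have -> : (c * (2 ^ k + 2 ^ k) + j = c * 2 * 2 ^ k + j)%N by lia.
  by rewrite divnMDl ?expn_gt0 // divn_small // addn0 oddM andbF.
have e2 j : (j < 2 ^ k)%N -> flip (signs v) k chi (c * (2 ^ k + 2 ^ k) + (2 ^ k + j))%N =
    sign_of (signs v) c * chi ((c * 2 + 1) * 2 ^ k + j)%N.
  move=> jk; rewrite /flip /sign_of.
  have -> : (c * (2 ^ k + 2 ^ k) + (2 ^ k + j) = (c * 2 + 1) * 2 ^ k + j)%N by lia.
  rewrite divnMDl ?expn_gt0 // divn_small // addn0 oddD oddM andbF /=.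
  have -> : ((c * 2 + 1) %/ 2 = c)%N by lia.
  by case: ifP => _; ring.
have -> : ln (combine (signs v) c (v i (c * 2)%N) (v i (c * 2 + 1)%N)) =
    ln (v i (c * 2)%N) + sign_of (signs v) c * ln (v i (c * 2 + 1)%N).
  rewrite /combine /sign_of; case: ifP => _; first by rewrite lnM ?posrE // mul1r.
  by rewrite ln_div ?posrE // mulN1r.
rewrite -!IH mulr_sumr; congr (_ + _); apply: eq_bigr => j _ /=.
  by rewrite e1 //; congr (_ * ln (z i _)); lia.
by rewrite e2 // mulrA; congr (_ * ln (z i _)); lia.
Qed.

(** Column 0 of the last level carries the whole signed sum as its logarithm. Its [cosh_of] is at
    most the total weight, hence at most [expR L], so the entry and its inverse are at most
    [2 * expR L <= expR (L + 1)]. *)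
Lemma tree_bound i : (i < m)%N ->
  `|\sum_(j < N) (tree z D).2 j * ln (z i j)| <= L + 1.
Proof.
move=> im; have := tree_sum i 0 (leqnn D); under eq_bigr => j _ do rewrite mul0n add0n.
move=> ->; have [v0 v1 vW] := treeP (leqnn D); set v := (tree z D).1 in v0 v1 vW *.
have D0 : D%:R != 0 :> R by rewrite pnatr_eq0 -lt0n.
have cl : cosh_of (v i 0%N) <= expR L.
  apply: le_trans W_le; move: vW; have -> : D%:R * (3 / D%:R) = 3 :> R by field. move=> {}vW.
  apply: le_trans vW; apply: le_trans (_ : row_weight v i <= _).
    have Npos : (0 < N)%N by rewrite expn_gt0.
    rewrite /row_weight (bigD1 (Ordinal Npos)) //= ler_peMr //.
      by apply: le_trans (cosh_of_ge1 _).
    by elim/big_rec: _ => // c x _ x1; apply: mulr_ege1 => //; exact: cosh_of_ge1.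
  rewrite (bigD1 (Ordinal im)) //= lerDl sumr_ge0 // => i' _.
  by apply: le_trans (row_weight_ge1 v0 i').
have p := v0 i 0%N; have ip : 0 < (v i 0%N)^-1 by rewrite invr_gt0.
have e2 : 2 * expR L <= expR (L + 1).
  rewrite expRD mulrC ler_wpM2l ?expR_ge0 //.
  by apply: le_trans (expR_ge1Dx _); lra.
have b1 : v i 0%N <= expR (L + 1) by move: cl; rewrite /cosh_of; lra.
have b2 : (v i 0%N)^-1 <= expR (L + 1) by move: cl; rewrite /cosh_of; lra.
rewrite ler_norml; apply/andP; split.
  rewrite lerNl -lnV ?posrE // -[L + 1]expRK ler_ln ?posrE ?expR_gt0 //.
by rewrite -[L + 1]expRK ler_ln ?posrE ?expR_gt0.
Qed.

End Run.
End Tree.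

(** * Scaling the rows *)

Section ScalingDefs.
Variables (R : realFieldType) (n D l : nat).
Local Notation N := (2 ^ D)%N.
Implicit Types (a : nat -> R) (r y : R).

Definition sqr_norm a : R := \sum_(c < N) a c * a c.
Definition l1_norm a : R := \sum_(c < N) `|a c|.
Definition grow (S y : R) : R := if S <= y * y * l%:R then y else y + y.
(* Within a factor 2 of [sqrt (sqr_norm a / l)]: there is no square root on the machine. *)
Definition scale a : R :=
  iter (D + l) (grow (sqr_norm a)) (l1_norm a / (n%:R * l%:R)).
(* Approximates the exponential of [r / y] with an error of the second order. *)
Definition start y r : R :=
  if r / y * (r / y) * 4 <= 1 then 1 + r / y else 1.

Lemma start0 y : start y 0 = 1.
Proof. by rewrite /start !mul0r; case: ifP => //; rewrite addr0. Qed.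

End ScalingDefs.

Section Scaling.
Variables (R : realType) (n D l : nat).
Local Notation N := (2 ^ D)%N.
Local Notation sqr_norm := (@sqr_norm R D).
Local Notation l1_norm := (@l1_norm R D).
Local Notation grow := (@grow R l).
Local Notation scale := (@scale R n D l).
Implicit Types (a : nat -> R) (r y : R).

Hypotheses (n_gt0 : (0 < n)%N) (nN : (n <= N)%N) (l_gt0 : (0 < l)%N).

Lemma sum_sqr_le k a : \sum_(c < k) a c * a c <= (\sum_(c < k) `|a c|) ^+ 2.
Proof.
elim: k => [|k IH]; first by rewrite !big_ord0 expr0n.
rewrite !big_ord_recr /= sqrrD -[a k * a k]expr2 -[a k ^+ 2]real_normK ?num_real //.
have : 0 <= \sum_(c < k) `|a c| by apply: sumr_ge0.
have := normr_ge0 (a k); set u := `|a k|; set s := \sum_(c < k) `|a c| in IH *.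
by move=> u0 s0; have su : 0 <= s * u := mulr_ge0 s0 u0; lra.
Qed.

Lemma sqr_sum_le k a : (\sum_(c < k) `|a c|) ^+ 2 <= k%:R * \sum_(c < k) a c * a c.
Proof.
have -> : k%:R * \sum_(c < k) a c * a c =
    \sum_(c < k) \sum_(d < k) (a c * a c / 2 + a d * a d / 2).
  under [in RHS]eq_bigr => c _ do rewrite big_split /= sumr_const card_ord.
  rewrite big_split /= sumr_const card_ord sumrMnl -mulrnDl -mulr_suml.
  by rewrite -splitr mulr_natl.
rewrite expr2 mulr_suml; apply: ler_sum => c _.
rewrite mulr_sumr; apply: ler_sum => d _.
have := sqr_ge0 (`|a c| - `|a d|).
rewrite sqrrB !real_normK ?num_real // !expr2 => h; lra.
Qed.

Lemma l1_sqr_le a : (forall c, (n <= c)%N -> a c = 0) ->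
  l1_norm a ^+ 2 <= n%:R * sqr_norm a.
Proof.
move=> a0; have sub (g : nat -> R) : (forall c, (n <= c)%N -> g c = 0) ->
    \sum_(c < N) g c = \sum_(c < n) g c.
  move=> g0; rewrite (big_ord_widen _ g nN) [RHS]big_mkcond /=.
  by apply: eq_bigr => c _; case: ltnP => // /g0.
rewrite /l1_norm /sqr_norm (sub (fun c => `|a c|)) ?(sub (fun c => a c * a c)).
- exact: sqr_sum_le.
- by move=> c /a0 ->; rewrite mul0r.
- by move=> c /a0 ->; rewrite normr0.
Qed.

Section ScaleBounds.
Variable a : nat -> R.
Hypothesis a_supp : forall c, (n <= c)%N -> a c = 0.

(** The start [l1_norm a / (n * l)] is not too large by Cauchy-Schwarz on the [n] columns of the
    support. A doubling happens only while [y ^+ 2 * l] is below [sqr_norm a], which explains the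
    factor 4. *)
Lemma scale_bounds : [/\ 0 <= scale a, sqr_norm a <= scale a ^+ 2 * l%:R &
  scale a ^+ 2 * l%:R <= 4 * sqr_norm a].
Proof.
have S0 : 0 <= sqr_norm a by apply: sumr_ge0 => c _; rewrite -expr2 sqr_ge0.
have B0 : 0 <= l1_norm a by apply: sumr_ge0.
have l1 : 1 <= l%:R :> R by rewrite ler1n.
have n1 : 1 <= n%:R :> R by rewrite ler1n.
have nl0 : 0 < n%:R * l%:R :> R by rewrite mulr_gt0 //; lra.
set y0 : R := l1_norm a / (n%:R * l%:R).
have y00 : 0 <= y0 by rewrite divr_ge0 // ltW.
have inv k : [/\ 0 <= iter k (grow (sqr_norm a)) y0,
    iter k (grow (sqr_norm a)) y0 ^+ 2 * l%:R <= 4 * sqr_norm a &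
    sqr_norm a <= iter k (grow (sqr_norm a)) y0 ^+ 2 * l%:R \/
    iter k (grow (sqr_norm a)) y0 = 2 ^+ k * y0].
  elim: k => [|k [h0 h1 h2]] /=.
    split=> //; last by right; rewrite expr0 mul1r.
    apply: le_trans (_ : sqr_norm a <= _); last by lra.
    have -> : y0 ^+ 2 * l%:R = l1_norm a ^+ 2 / (n%:R ^+ 2 * l%:R).
      by rewrite /y0; field; rewrite !gt_eqF //; lra.
    rewrite ler_pdivrMr; last by rewrite mulr_gt0 ?exprn_gt0 //; lra.
    apply: le_trans (l1_sqr_le a_supp) _; rewrite mulrC ler_wpM2l //.
    by rewrite expr2 -mulrA ler_peMr ?mulr_ege1 //; lra.
  move: h0 h1 h2; set y := iter k _ _ => h0 h1 h2; rewrite /grow -expr2.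
  case: ifP => h; first by split=> //; left.
  split; [by rewrite addr_ge0 | | ].
    have -> : (y + y) ^+ 2 * l%:R = 4 * (y ^+ 2 * l%:R) by ring.
    by rewrite ler_pM2l //; move/negbT: h; rewrite -ltNge => /ltW.
  case: h2 => h2; first by rewrite h2 in h.
  by right; rewrite h2 exprS; ring.
rewrite /scale -/y0; have [h0 h1 h2] := inv (D + l)%N; split=> //.
(* If the value doubled every time, it has reached [l1_norm a] because [n * l <= 2 ^ (D + l)], and
   this norm dominates the Euclidean one. *)
case: h2 => // ->; rewrite exprMn -mulrA.
have h3 : n%:R * l%:R <= 2 ^+ (D + l) :> R.
  rewrite exprD; apply: ler_pM => //; try lra.
    by rewrite -natrX ler_nat.
  by rewrite -natrX ler_nat ltnW // ltn_expl.
apply: le_trans (sum_sqr_le N a) _; rewrite -/(l1_norm a).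
apply: le_trans (_ : (2 ^+ (D + l) * y0) ^+ 2 <= _); last first.
  by rewrite exprMn ler_wpM2l ?exprn_ge0 // ler_peMr ?exprn_ge0.
rewrite lerXn2r ?nnegrE // ?mulr_ge0 ?exprn_ge0 //.
  by rewrite invr_ge0 ltW.
by rewrite /y0 mulrCA ler_peMr // ler_pdivlMr // mul1r.
Qed.

Lemma scaled_energy : \sum_(c < N) (a c / scale a) ^+ 2 <= l%:R.
Proof.
have [h0 h1 h2] := scale_bounds; move: h0; rewrite le_eqVlt => /orP[/eqP E|s0].
  by rewrite big1 // => c _; rewrite -E invr0 mulr0 expr0n.
have -> : \sum_(c < N) (a c / scale a) ^+ 2 = sqr_norm a / scale a ^+ 2.
  by rewrite /sqr_norm mulr_suml; apply: eq_bigr => c _; rewrite exprMn exprVn expr2.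
by rewrite ler_pdivrMr ?exprn_gt0 // mulrC.
Qed.

Lemma small_abs r y : r / y * (r / y) * 4 <= 1 -> `|r / y| <= 1 / 2.
Proof.
by set x := r / y => h; rewrite ler_norml; apply/andP; split; nra.
Qed.

Lemma start_gt0 y r : 0 < start y r.
Proof.
by rewrite /start; case: ifP => // /small_abs; rewrite ler_norml; lra.
Qed.

Lemma cosh_start_le y r : cosh_of (start y r) <= expR ((r / y) ^+ 2).
Proof.
rewrite /start; case: ifP => [/small_abs|_]; last first.
  by rewrite cosh_of1 -[X in X <= _]expR0 ler_expR sqr_ge0.
set x := r / y; rewrite ler_norml => xs.
apply: le_trans (expR_ge1Dx _).
have p : 0 < 1 + x by lra.
have -> : cosh_of (1 + x) = 1 + x ^+ 2 / (2 * (1 + x)).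
  by rewrite /cosh_of; field; rewrite gt_eqF.
by rewrite lerD2l ler_pdivrMr ?mulr_gt0 // ler_peMr ?sqr_ge0 //; lra.
Qed.

(** Entries that are too large for the approximation start at 1. Their logarithm 0 is still within
    the error, since [|x| <= 2 * x ^+ 2] once [|x| >= 1 / 2]. *)
Lemma ln_start_near y r : `|ln (start y r) - r / y| <= 2 * (r / y) ^+ 2.
Proof.
rewrite /start; case: ifP => [/small_abs|/negbT]; set x := r / y.
  move=> xs; have /andP[x1 x2] : - (1 / 2) <= x <= 1 / 2 by rewrite -ler_norml.
  have p : 0 < 1 + x by lra.
  have u : ln (1 + x) <= x by apply: le_ln1Dx; lra.
  have v : - ln (1 + x) <= - x + 2 * x ^+ 2.
    rewrite -lnV ?posrE //.
    have -> : (1 + x)^-1 = 1 + (- x / (1 + x)) by field; rewrite gt_eqF.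
    apply: le_trans (le_ln1Dx _) _.
      by rewrite ltr_pdivlMr //; lra.
    rewrite ler_pdivrMr //; have := sqr_ge0 x; nra.
  by rewrite ler_norml; have := sqr_ge0 x; lra.
rewrite -ltNge ln1 sub0r normrN => h.
rewrite -[x ^+ 2]real_normK ?num_real //.
move: h; rewrite -expr2 -[x ^+ 2]real_normK ?num_real //; set u := `|x|.
have : 0 <= u by exact: normr_ge0.
by nra.
Qed.

Lemma start_weight i z : (forall c, (c < N)%N -> z i c = start (scale a) (a c)) ->
  row_weight D z i <= expR l%:R.
Proof.
move=> zE; apply: le_trans (_ : expR (\sum_(c < N) (a c / scale a) ^+ 2) <= _).
  rewrite expR_sum; apply: ler_prod => c _; rewrite zE // cosh_start_le andbT.
  by apply: le_trans (cosh_of_ge1 (start_gt0 _ _)).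
by rewrite ler_expR scaled_energy.
Qed.

(** Passing from logarithms to the scaled entries costs twice the scaled energy, which is at most
    [l]. *)
Lemma scaled_disc (chi : nat -> R) (L : R) :
  (forall c, chi c = 1 \/ chi c = -1) ->
  `|\sum_(c < N) chi c * ln (start (scale a) (a c))| <= L ->
  `|\sum_(c < N) a c * chi c| <= scale a * (L + 2 * l%:R).
Proof.
move=> chi1 hL; have [h0 h1 h2] := scale_bounds.
have nchi c : `|chi c| = 1 by case: (chi1 c) => ->; rewrite ?normrN normr1.
have x_le : `|\sum_(c < N) chi c * (a c / scale a)| <= L + 2 * l%:R.
  have -> : \sum_(c < N) chi c * (a c / scale a) =
      \sum_(c < N) chi c * ln (start (scale a) (a c)) -
      \sum_(c < N) chi c * (ln (start (scale a) (a c)) - a c / scale a).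
    by rewrite -sumrB; apply: eq_bigr => c _; ring.
  apply: le_trans (ler_normB _ _) _; apply: lerD => //.
  apply: le_trans (ler_norm_sum _ _ _) _.
  apply: le_trans (_ : \sum_(c < N) 2 * (a c / scale a) ^+ 2 <= _).
    by apply: ler_sum => c _; rewrite normrM nchi mul1r ln_start_near.
  by rewrite -mulr_sumr ler_wpM2l // scaled_energy.
(* If the scale is 0 then so is the norm, and the whole row vanishes. *)
move: h0; rewrite le_eqVlt => /orP[/eqP E|s0].
  rewrite -E mul0r big1 ?normr0 // => c _.
  suff -> : a c = 0 by rewrite mul0r.
  have S0 : sqr_norm a = 0.
    apply/eqP; rewrite eq_le sumr_ge0 ?andbT => [|c' _]; last by rewrite -expr2 sqr_ge0.
    by apply: le_trans h1 _; rewrite -E expr0n mul0r.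
  apply/eqP; have /eqP := S0; rewrite psumr_eq0 => [|c' _]; last by rewrite -expr2 sqr_ge0.
  by move=> /allP/(_ c (mem_index_enum _)); rewrite mulf_eq0 orbb.
have -> : \sum_(c < N) a c * chi c = scale a * \sum_(c < N) chi c * (a c / scale a).
  by rewrite mulr_sumr; apply: eq_bigr => c _; field; rewrite gt_eqF.
by rewrite normrM gtr0_norm // ler_wpM2l // ltW.
Qed.

End ScaleBounds.
End Scaling.

Section ColoringDefs.
Variables (R : realFieldType) (n m D l : nat) (a : nat -> nat -> R).

Definition start_mx i c : R := start (scale n D l (a i)) (a i c).
Definition coloring : nat -> R := (tree m D (4 * l * D) start_mx D).2.

End ColoringDefs.

Section Main.
Variables (R : realType) (n m D l : nat) (a : nat -> nat -> R).
Local Notation N := (2 ^ D)%N.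
Hypotheses (n_gt0 : (0 < n)%N) (nN : (n <= N)%N) (D_gt0 : (0 < D)%N).
Local Notation start_mx := (start_mx n D l a).
Local Notation coloring := (coloring n m D l a).
Hypotheses (m_gt1 : (1 < m)%N) (mN : (m <= 2 ^ l)%N) (l_gt1 : (1 < l)%N).
Hypothesis a_supp : forall i c, (n <= c)%N || (m <= i)%N -> a i c = 0.

(** Each row starts with weight at most [expR l] and [m <= 2 ^ l <= expR l]; with the slack [expR 3]
    and [l >= 2] this fits [L = 4 * l]. The total [(L + 1) + 2 * l] is at most [7 * l]. *)
Lemma coloring_disc i : (i < m)%N ->
  `|\sum_(c < N) a i c * coloring c| <= scale n D l (a i) * (7 * l%:R).
Proof.
move=> im; have l_gt0 := ltnW l_gt1.
have as_ i' c : (n <= c)%N -> a i' c = 0 by move=> nc; rewrite a_supp ?nc.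
have l2 : 2 <= l%:R :> R by rewrite ler_nat.
apply: le_trans (_ : scale n D l (a i) * ((4 * l%:R + 1) + 2 * l%:R) <= _); last first.
  apply: ler_wpM2l; first by have [] := scale_bounds n_gt0 nN l_gt0 (as_ i).
  by lra.
apply: (scaled_disc n_gt0 nN l_gt0 (as_ i)); first exact: tree_sign.
apply: (@tree_bound R m D (4 * l * D) start_mx (4 * l%:R)) => //.
- by move=> *; exact: start_gt0.
- move=> i' c h; rewrite /start_mx a_supp ?start0 //.
  by case/orP: h => h; rewrite ?h ?orbT // (leq_trans nN h).
- by nia.
- by rewrite -!natrM.
- by rewrite mulr_ge0.
- have Wl i' : row_weight D start_mx i' <= expR l%:R.
    exact: (start_weight n_gt0 nN l_gt0 (as_ i')).
  apply: le_trans (_ : expR 3 * (expR l%:R * expR l%:R) <= _); last first.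
    by rewrite -!expRD ler_expR; lra.
  rewrite ler_wpM2l ?expR_ge0 //.
  apply: le_trans (ler_sum (index_enum _) (fun (i : 'I_m) _ => Wl i)) _.
  rewrite sumr_const card_ord -[X in X <= _]mulr_natl ler_wpM2r ?expR_ge0 //.
  apply: le_trans (_ : (2 ^ l)%:R <= _); first by rewrite ler_nat.
  rewrite natrX -[X in expR X]mulr1 expRM_natl lerXn2r ?nnegrE ?expR_ge0 //.
  by apply: le_trans (expR_ge1Dx _); lra.
- by rewrite ltnW.
Qed.

End Main.

(** * The program *)

(* [(k, v)] *)
Definition t_vsum : term := COMPILE (
  FUN arg =>
  bcall t_fold (bfst arg ;; (FUN z => bfst (bsnd z) + bsnd (bsnd z)) ;; breal #0 ;;
                bsnd arg))%bld.

(* [(k, v)] *)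
Definition t_vprod : term := COMPILE (
  FUN arg =>
  bcall t_fold (bfst arg ;; (FUN z => bfst (bsnd z) * bsnd (bsnd z)) ;; breal #1 ;;
                bsnd arg))%bld.

(* [(k, a)] *)
Definition t_sum : term := COMPILE (
  FUN arg =>
  LET a := bsnd arg IN
  LET v := TAB i < blen a OF (i ;; a.[i] ;; i + #1) IN
  bcall t_vsum (bfst arg ;; v))%bld.

(* [(D, (l, (n, row)))] *)
Definition t_prep : term := COMPILE (
  FUN arg =>
  LET D := bfst arg IN
  LET l := bfst (bsnd arg) IN
  LET n := bfst (bsnd (bsnd arg)) IN
  LET row := bsnd (bsnd (bsnd arg)) IN
  LET v := TAB p < blen row OF (LET x := row.[p] IN (bfst x ;; bsnd x ;; p + #1)) IN
  LET sq := bcall t_map ((FUN z => bsnd z * bsnd z) ;; v) IN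
  LET S := bcall t_vsum (D ;; sq) IN
  LET ab := bcall t_map
    ((FUN z => IF breal #0 <= bsnd z THEN bsnd z ELSE breal #0 - bsnd z) ;; v) IN
  LET B := bcall t_vsum (D ;; ab) IN
  LET y := bcall t_iter (D + l ;; (FUN y => IF S <= y * y * breal l THEN y ELSE y + y) ;;
                         B / (breal n * breal l)) IN
  bcall t_map ((FUN z => LET x := bsnd z / y IN
    IF x * x * breal #4 <= breal #1 THEN breal #1 + x ELSE breal #1) ;; v))%bld.

Lemma iter_collapse (R : realFieldType) (idx : R) (op : Monoid.com_law idx) k g c :
  iter k (collapse (fun _ => op)) g c =
  \big[op/idx]_(j < 2 ^ k) g (c * 2 ^ k + j)%N.
Proof.
elim: k c => [|k IH] c; first by rewrite big_ord1 /= expn0 muln1 addn0.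
rewrite iterS /collapse !IH [in RHS]expnS mul2n -addnn big_split_ord /=.
by congr (op _ _); apply: eq_bigr => j _; congr g; lia.
Qed.

Lemma iter_collapse0 (R : realFieldType) (idx : R) (op : Monoid.com_law idx) k g :
  iter k (collapse (fun _ => op)) g 0%N = \big[op/idx]_(j < 2 ^ k) g j.
Proof. by rewrite iter_collapse; apply: eq_bigr => j _; rewrite mul0n add0n. Qed.

Ltac pure_let :=
  apply: evP_let; [by eapply evP_ev; [evs | exact: erefl] | move=> _ ? <-].

(** * Correctness and costs of the programs *)

Section Specs.
Variables (R : realFieldType) (W : nat).
Hypothesis W_gt4 : (4 < W)%N.
Let W_gt2 : (2 < W)%N := ltnW (ltnW W_gt4).
Let W_gt1 : (1 < W)%N := ltnW W_gt2.
Let W_gt0 : (0 < W)%N := ltnW W_gt1.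
Notation value := (value R).

Lemma ev_vsum (e : seq value) a k s g v w1 d1 : (2 ^ k < W)%N -> (s < W)%N ->
  srep (2 ^ k) s 0 g v -> ev W e a (Pair (Word k) v) w1 d1 ->
  ev W e (App t_vsum a) (Real (\sum_(j < 2 ^ k) g j))
    (w1 + (k + 1) * ((s + 1) * 300)) (d1 + (k + 1) * 300).
Proof.
move=> kW sW Hv ha; rewrite /t_vsum -iter_collapse0; eapply ev_le.
eapply ev_let; first exact ha.
move=> ?; apply: (@ev_fold _ _ W_gt2 _ _ _ v (fun _ => +%R) k 20 s 0 g);
  last (by eapply ev_eq; [evs | reflexivity]); try assumption.
- by move=> _; exact: addr0.
- by move=> c x y _ /=; eapply ev_le; [evs | |].
all: nia.
Qed.

Lemma ev_vprod (e : seq value) a k s g v w1 d1 : (2 ^ k < W)%N -> (s < W)%N ->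
  srep (2 ^ k) s 1 g v -> ev W e a (Pair (Word k) v) w1 d1 ->
  ev W e (App t_vprod a) (Real (\prod_(j < 2 ^ k) g j))
    (w1 + (k + 1) * ((s + 1) * 300)) (d1 + (k + 1) * 300).
Proof.
move=> kW sW Hv ha; rewrite /t_vprod -iter_collapse0; eapply ev_le.
eapply ev_let; first exact ha.
move=> ?; apply: (@ev_fold _ _ W_gt2 _ _ _ v (fun _ => *%R) k 20 s 1 g);
  last (by eapply ev_eq; [evs | reflexivity]); try assumption.
- by move=> _; exact: mulr1.
- by move=> c x y _ /=; eapply ev_le; [evs | |].
all: nia.
Qed.

Lemma evP_map_fun (e : seq value) b a v G k N s d d' g w1 d1 :
  (N < W)%N -> (s < W)%N -> (forall c, G c d = d') -> srep N s d g v ->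
  ev W e a v w1 d1 ->
  (forall c x self, (c < N)%N ->
    ev W [:: Pair (Word c) (Real x), self & e] b (Real (G c x)) k k) ->
  evP W e (App t_map (MkPair (Fun b) a)) (srep N s d' (fun c => G c (g c)))
    (w1 + 32 + s * (k + 30)) (d1 + k + 62).
Proof.
move=> NW sW Gd Hv ha hb; eapply evP_le.
apply: (@evP_map _ _ W_gt2 _ _ _ _ G k _ _ _ d' _ _ _ NW sW Gd _ Hv); last by evs; exact: ha.
  by move=> c x cN; exact: hb.
all: lia.
Qed.

Lemma evP_collapse_fun (e : seq value) b t a v F k N s d d' g w1 d1 w2 d2 :
  (N < W)%N -> (s < W)%N -> (forall c, F c d d = d') -> srep N s d g v ->
  ev W e t (Real d) w1 d1 -> ev W e a v w2 d2 ->
  (forall c x y self, (c < N)%N ->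
    ev W [:: Pair (Word c) (Pair (Real x) (Real y)), self & e] b
      (Real (F c x y)) k k) ->
  evP W e (App t_collapse (MkPair (Fun b) (MkPair t a))) (srep N s d' (collapse F g))
    (w1 + w2 + 33 + s * (k + 80)) (d1 + d2 + k + 113).
Proof.
move=> NW sW Fd Hv ht ha hb; eapply evP_le.
apply: (@evP_collapse _ _ W_gt2 _ _ _ _ F k _ N _ _ _ _ _ _ NW sW _ Fd _ Hv);
  last by evs; [exact: ht | exact: ha].
- by move=> c cN; apply: leq_ltn_trans cN; rewrite leq_div.
- by move=> c x y cN; exact: hb.
all: lia.
Qed.

Lemma evP_iter_fun (e : seq value) b t k (I : nat -> value -> Prop) a x w1 d1 w2 d2 w d :
  (k < W)%N -> ev W e t (Word k) w1 d1 -> ev W e a x w2 d2 -> I 0%N x ->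
  (forall i y self, (i < k)%N -> I i y -> evP W [:: y, self & e] b (I i.+1) w d) ->
  evP W e (App t_iter (MkPair t (MkPair (Fun b) a))) (I k)
    (w1 + w2 + 33 + k * (w + 30)) (d1 + d2 + 33 + k * (d + 30)).
Proof.
move=> kW ht ha I0 hb; eapply evP_le.
apply: (@evP_iter _ _ W_gt2 _ _ _ _ I x _ _ w d kW _ I0); last by evs; [exact: ht | exact: ha].
  by move=> i y ik Iy; exact: hb.
all: lia.
Qed.

Definition chain (r : seq (nat * R)) : value :=
  Arr (mkseq (fun p => Pair (Word (nth (0%N, 0) r p).1)
                         (Pair (Real (nth (0%N, 0) r p).2) (Word (p + 1)))) (size r)).

Lemma srep_chain N d r : incr r -> (forall x, x \in r -> (x.1 < N)%N) ->
  srep N (size r) d (assoc d r) (chain r).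
Proof.
move=> ir rN; pose l : seq (cell R) :=
  mkseq (fun p => ((nth (0%N, 0) r p).1, (nth (0%N, 0) r p).2, (p + 1)%N)) (size r).
exists l, r; split=> //.
- by rewrite /chain /svec /l /mkseq -map_comp.
- by rewrite size_mkseq.
- move=> x /mapP[p]; rewrite mem_iota add0n => /andP[_ pr] -> /=.
  by rewrite size_mkseq addn1 pr; split=> //; apply/rN/mem_nth.
- suff H j p : (p + j = size r)%N -> linked l p (drop p r).
    by rewrite -[X in linked l 0 X]drop0; exact: (H (size r)).
  elim: j p => [|j IH] p pj.
    rewrite drop_oversize; last by lia.
    have -> : p = size l by rewrite size_mkseq; lia.
    exact: linked_nil.
  have pr : (p < size r)%N by lia.
  rewrite (drop_nth (0%N, 0)) // [nth _ _ _]surjective_pairing.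
  apply: (@linked_cons _ _ _ _ _ (p + 1)); last by rewrite addn1; apply: IH; lia.
  by rewrite (onth_nth_some (cell0 R)) ?size_mkseq // nth_mkseq.
Qed.

Definition rarr (f : nat -> R) n : value := Arr (mkseq (fun i => Real (f i)) n).

Lemma evP_nth (e : seq value) a b i n (P : nat -> value -> Prop) vs w1 d1 w2 d2 :
  (forall i, (i < n)%N -> P i (vs i)) -> (i < n)%N ->
  ev W e a (Arr (mkseq vs n)) w1 d1 -> ev W e b (Word i) w2 d2 ->
  evP W e (Get a b) (P i) (w1 + w2).+1 (d1 + d2).+1.
Proof.
move=> Pvs i_n ha hb; exists (vs i); first exact: Pvs.
by apply: ev_get ha hb _; exact: onth_mkseq.
Qed.

Lemma assoc_mkseq (f : nat -> R) n d c :
  assoc d (mkseq (fun i => (i, f i)) n) c = if (c < n)%N then f c else d.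
Proof.
elim: n => [//|n IH]; rewrite mkseqS -cats1.
have cat (r1 : seq (nat * R)) x : assoc d (r1 ++ [:: x]) c =
    if c \in map fst r1 then assoc d r1 c else if x.1 == c then x.2 else d.
  elim: r1 => [|[y v] r1 IHr] /=; first by case: x => x1 x2.
  by rewrite IHr in_cons eq_sym; case: eqP.
rewrite cat IH /= /mkseq -map_comp map_id mem_iota /= add0n.
by rewrite ltnS; case: (ltngtP c n) => //= ->.
Qed.

Lemma incr_mkseq (f : nat -> R) n : incr (mkseq (fun i => (i, f i)) n).
Proof.
rewrite /incr /mkseq -map_comp map_id.
by rewrite -sorted_pairwise; [exact: iota_ltn_sorted | exact: ltn_trans].
Qed.

Lemma ev_sum (e : seq value) a k n f w1 d1 : (2 ^ k < W)%N -> (n <= 2 ^ k)%N ->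
  ev W e a (Pair (Word k) (rarr f n)) w1 d1 ->
  ev W e (App t_sum a) (Real (\sum_(j < n) f j))
    (w1 + (k + 1) * ((n + 1) * 350)) (d1 + (k + 1) * 350).
Proof.
move=> kW nk ha.
pose r := mkseq (fun i => (i, f i)) n.
have -> : \sum_(j < n) f j = \sum_(j < 2 ^ k) assoc 0 r j.
  under [RHS]eq_bigr => j _ do rewrite assoc_mkseq.
  by rewrite -big_mkcond /= (big_ord_widen _ f nk).
have Hr : srep (2 ^ k) (size r) 0 (assoc 0 r) (chain r).
  apply: srep_chain; first exact: incr_mkseq.
  move=> x /mapP[p]; rewrite mem_iota add0n => /andP[_ pr] -> /=.
  exact: leq_trans nk.
have sr : size r = n by rewrite size_mkseq.
have nW : (n < W)%N := leq_ltn_trans nk kW.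
rewrite /t_sum; eapply ev_le.
eapply ev_let; first exact ha.
move=> ?; eapply ev_let; first by evs.
move=> ?; eapply ev_let.
  rewrite /rarr; eapply (@ev_tab_const _ _ _ _ _ _ (fun p => Pair (Word p)
    (Pair (Real (f p)) (Word (p + 1)))) _ _ 20 20); first by evs; exact: nW.
  by move=> i i_n ?; eapply ev_le; first evs; lia.
move=> ?; apply: (@ev_vsum _ _ k (size r) _ (chain r)) => //.
- by rewrite sr; lia.
- rewrite /chain sr; set u := mkseq _ n; set u' := mkseq _ n.
  have <- : u = u'.
    apply/eq_in_map => p; rewrite mem_iota add0n => /andP[_ pr].
    by rewrite /r nth_mkseq.
  by evs.
all: rewrite ?sr; nia.
Qed.

End Specs.

Section Prep.
Variables (R : realFieldType) (W : nat).
Hypothesis W_gt4 : (4 < W)%N.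
Let W_gt2 : (2 < W)%N := ltnW (ltnW W_gt4).
Let W_gt1 : (1 < W)%N := ltnW W_gt2.
Let W_gt0 : (0 < W)%N := ltnW W_gt1.
Notation value := (value R).

Definition vrow (r : seq (nat * R)) : value :=
  Arr (map (fun x => Pair (Word x.1) (Real x.2)) r).

Lemma evP_prep (e : seq value) a D l n r w1 d1 :
  (2 ^ D < W)%N -> (l < W)%N -> (D + l < W)%N -> (n < W)%N -> (size r < W)%N ->
  incr r -> (forall x, x \in r -> (x.1 < 2 ^ D)%N) ->
  ev W e a (Pair (Word D) (Pair (Word l) (Pair (Word n) (vrow r)))) w1 d1 ->
  evP W e (App t_prep a)
    (srep (2 ^ D) (size r) 1 (fun c => start (scale n D l (assoc 0 r)) (assoc 0 r c)))
    (w1 + (D + l + 1) * ((size r + 1) * 2000)) (d1 + (D + l + 1) * 2000).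
Proof.
move=> DW lW DlW nW rW ir rD ha; rewrite /t_prep; eapply evP_le.
apply: evP_let; first exact: (evP_ev ha (erefl _)).
move=> _ ? <-; do 4 pure_let.
apply: evP_let.
  eapply evP_ev; last exact: erefl.
  rewrite /vrow; eapply (@ev_tab_const _ _ _ _ _ _ (fun p =>
    Pair (Word (nth (0%N, 0) r p).1)
      (Pair (Real (nth (0%N, 0) r p).2) (Word (p + 1)))) _ _ 40 40); first by evs.
  move=> p pr ?; eapply ev_le; first evs; try lia.
  by rewrite onth_map (onth_nth_some (0%N, 0)).
move=> _ ? <-; rewrite -/(chain r).
have Hr := srep_chain W_gt4 0 ir rD.
apply: evP_let.
  apply: (evP_map_fun (d' := 0) (G := fun _ x => x * x) (k := 20) W_gt4 DW rW _ Hr).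
  - by move=> _; rewrite mulr0.
  - by evs.
  - by move=> c x ? _; eapply ev_le; [evs | |].
move=> sq ? Hsq; apply: evP_let.
  by eapply evP_ev; [apply: (ev_vsum W_gt4 DW rW Hsq); evs | exact: erefl].
move=> _ ? <-; rewrite -/(sqr_norm D (assoc 0 r)).
have absE (x : R) : (if 0 <= x then x else 0 - x) = `|x|.
  by case: (lerP 0 x) => x0; rewrite ?sub0r // ?(ltr0_norm x0) ?(ger0_norm x0).
apply: evP_let.
  apply: (evP_map_fun (d' := 0) (G := fun _ x => if 0 <= x then x else 0 - x) (k := 40)
    W_gt4 DW rW _ Hr).
  - by move=> _; rewrite lexx.
  - by evs.
  - move=> c x ? _; eapply ev_le; [eapply ev_eq; [by evs|] | |]; try lia.
    by rewrite ?mulr0n; case: (0 <= x).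
move=> ab ? Hab; apply: evP_let.
  by eapply evP_ev; [apply: (ev_vsum W_gt4 DW rW Hab); evs | exact: erefl].
move=> _ ? <-; under eq_bigr => j _ do rewrite absE.
rewrite -/(l1_norm D (assoc 0 r)).
apply: evP_let.
  apply: (evP_iter_fun (w := 50) (d := 50) (I := fun i v => v = Real (iter i
    (grow l (sqr_norm D (assoc 0 r))) (l1_norm D (assoc 0 r) / (n%:R * l%:R)))) W_gt4 DlW).
  - by evs.
  - by evs.
  - by [].
  - move=> i x ? _ ->; eapply evP_ev; last exact: erefl.
    rewrite iterS [grow _ _ _]/grow; eapply ev_le; [eapply ev_eq; [by evs|] | |]; try lia.
    by case: ifP.
move=> _ ? ->; rewrite -/(scale n D l (assoc 0 r)).
apply: (evP_map_fun (d' := 1) (G := fun _ => start (scale n D l (assoc 0 r))) (k := 60)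
  W_gt4 DW rW _ Hr).
- by move=> _; rewrite start0.
- by evs.
- move=> c x ? _; rewrite /start; eapply ev_le; [eapply ev_eq; [evs|] | |]; try lia.
  by case: ifP.
all: set s := size r; have := leq0n (D * s); have := leq0n (l * s); move: s => s; lia.
Qed.

End Prep.

(* [(D, (N, (l, wu)))] *)
Definition t_inner : term := COMPILE (
  FUN arg =>
  LET D := bfst arg IN
  LET N := bfst (bsnd arg) IN
  LET l := bfst (bsnd (bsnd arg)) IN
  LET wu0 := bsnd (bsnd (bsnd arg)) IN
  LET eps0 := TAB c < N OF (c ;; breal #1) IN
  bcall t_iter (D ;; (FUN st =>
    LET eps := bfst st IN
    LET wu := bsnd st IN
    LET prods := TAB i < blen wu OF
      (LET r := wu.[i] IN
       LET p := bcall t_collapse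
         ((FUN z => bfst (bsnd z) * bsnd (bsnd z)) ;; breal #0 ;; bsnd r) IN
       LET s := bcall t_vsum (D ;; p) IN
       bfst r * s) IN
    LET k := bcall t_sum (l ;; prods) IN
    LET sg := IF k <= breal #0 THEN breal #1 ELSE breal #0 - breal #1 IN
    LET eps' := TAB c < N OF
      (LET x := eps.[c] IN
       LET h := bfst x / #2 IN
       (h ;; IF bfst x <= h * #2 THEN bsnd x ELSE bsnd x * sg)) IN
    LET wu' := TAB i < blen wu OF
      (LET r := wu.[i] IN
       LET u := bcall t_collapse
         ((FUN z => bfst (bsnd z) + sg * bsnd (bsnd z)) ;; breal #0 ;; bsnd r) IN
       (bfst r ;; u)) IN
    (eps' ;; wu')) ;; (eps0 ;; wu0)))%bld.

(** The data size [X] counts the columns and the cells, plus one for each row so that empty rows are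
    paid for. Here the per-row costs are charged to it. *)
Lemma sum_sizes (m N : nat) (sz : nat -> nat) X c :
  (N + \sum_(i < m) (sz i + 1) <= X)%N ->
  (\sum_(i < m) c * (sz i + 1) <= c * (X - N))%N.
Proof.
rewrite -big_distrr /= leq_mul2l => h; apply/orP; right.
by move: h; set s := (\sum_(i < m) _)%N; lia.
Qed.

Lemma rows_le (m N : nat) (sz : nat -> nat) X :
  (N + \sum_(i < m) (sz i + 1) <= X)%N -> (m + N <= X)%N.
Proof.
apply: leq_trans; rewrite addnC leq_add2l -[Y in (Y <= _)%N]card_ord -sum1_card.
by apply: leq_sum => i _; rewrite addn1.
Qed.

Lemma cost_products (m D l X : nat) : (m + 2 ^ D <= X)%N ->
  [/\ (D + 1) * (2 ^ D + 1) <= 2 * ((D + l + 1) * X),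
      (l + 1) * (m + 1) <= (D + l + 1) * X, X <= (D + l + 1) * X, 0 < X &
      (D + l + 1) * X <= (D + l + 1) * (D + l + 1) * X /\ D + l + 1 <= (D + l + 1) * X]%N.
Proof.
move=> mX; have N0 : (0 < 2 ^ D)%N by rewrite expn_gt0.
have X0 : (0 < X)%N by lia.
have D2 : (2 ^ D + 1 <= 2 * X)%N by lia.
split=> //; last split.
- by rewrite mulnCA leq_mul //; lia.
- by rewrite leq_mul //; lia.
- by rewrite leq_pmull //; lia.
- by rewrite leq_mul2r leq_pmull ?orbT //; lia.
- by rewrite leq_pmulr.
Qed.

Section Inner.
Variables (R : realFieldType) (W : nat) (m D l : nat) (sz : nat -> nat) (X : nat).
Local Notation N := (2 ^ D)%N.
Notation value := (value R).
Hypothesis W_gt4 : (4 < W)%N.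
Hypotheses (NW : (N < W)%N) (lW : (2 ^ l < W)%N) (ml : (m <= 2 ^ l)%N).
Hypothesis szW : forall i, (i < m)%N -> (sz i < W)%N.
Hypothesis X_ge : (N + \sum_(i < m) (sz i + 1) <= X)%N.
Let W_gt2 : (2 < W)%N := ltnW (ltnW W_gt4).
Let W_gt1 : (1 < W)%N := ltnW W_gt2.
Let W_gt0 : (0 < W)%N := ltnW W_gt1.
Let mW : (m < W)%N := leq_ltn_trans ml lW.
Let DW : (D < W)%N. Proof. by apply: ltn_trans NW; rewrite ltn_expl. Qed.
Let K := (D + l + 1)%N.

Definition weighted_row (d : R) (w : nat -> R) (u : nat -> nat -> R) i (x : value) : Prop :=
  exists y, x = Pair (Real (w i)) y /\ srep N (sz i) d (u i) y.

Definition weighted (d : R) w u : value -> Prop := is_array m (weighted_row d w u).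

(** The word is the column shifted by [k] binary digits. The program halves it in each round, so
    that its parity is the digit needed next. *)
Definition sign_array k (f : nat -> R) : value :=
  Arr (mkseq (fun c => Pair (Word (c %/ 2 ^ k)) (Real (f c))) N).

(** There are [D] rounds, and the sums over columns and rows give each of them depth [O(D + l)] and
    work [O((D + l) X)]. *)
Lemma evP_inner (e : seq value) a w u v w1 d1 :
  weighted 0 w u v ->
  ev W e a (Pair (Word D) (Pair (Word N) (Pair (Word l) v))) w1 d1 ->
  evP W e (App t_inner a) (fun x => exists y,
      x = Pair (sign_array D (inner m D w u D).1) y /\
      weighted 0 w (inner m D w u D).2 y)
    (w1 + K * K * X * 3000) (d1 + K * K * 3000).
Proof.
move=> Hv ha; rewrite /t_inner; eapply evP_le.
apply: evP_let; first exact: (evP_ev ha (erefl _)).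
move=> _ ? <-; do 4 pure_let.
apply: evP_let.
  eapply evP_ev; last exact: erefl.
  eapply (@ev_tab_const _ _ _ _ _ _ (fun c => Pair (Word c) (Real 1)) _ _ 20 20); first by evs.
  by move=> c cN ?; eapply ev_le; [evs | |].
move=> _ ? <-.
apply: (evP_iter_fun (w := K * X * 2000) (d := K * 2000) (I := fun k x => exists y,
      x = Pair (sign_array k (inner m D w u k).1) y /\
      weighted 0 w (inner m D w u k).2 y) W_gt4 DW).
- by evs.
- by evs.
- exists v; split=> //; congr (Pair (Arr _) _).
  by apply: eq_map => c; rewrite divn1.
- move=> k _ ? kD [y [-> Hy]]; rewrite [inner _ _ _ _ k.+1]/=.
  case: (inner m D w u k) Hy => eps uk /= Hy.
  have [vs -> Hvs] := Hy; eapply evP_le.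
  do 2 pure_let.
  apply: evP_let.
    apply: (@evP_tab _ _ _ _ _ _ (fun i x => x = Real (w i *
      \sum_(c < N) (uk i (c * 2)%N * uk i (c * 2 + 1)%N))) _ _
      (fun i => K * 500 * (sz i + 1))%N (K * 600)%N); first by evs; exact: mW.
    move=> i ? im; eapply evP_le.
    apply: evP_let.
      by apply: (evP_nth Hvs im); evs.
    move=> _ ? [yi [-> Hyi]]; apply: evP_let.
      apply: (evP_collapse_fun (F := fun _ => *%R) (d := 0) (d' := 0) (k := 20)
        W_gt4 NW (szW im) _ Hyi).
      + by move=> _; rewrite mulr0.
      + by evs.
      + by evs.
      + by move=> c x1 x2 ? _; eapply ev_le; [evs | |].
    move=> p ? Hp; apply: evP_let.
      by eapply evP_ev; [apply: (ev_vsum W_gt4 NW (szW im) Hp); evs | exact: erefl].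
    move=> _ ? <-; eapply evP_ev; first by evs.
    by [].
    1,2: have := leq0n (D * sz i); have := leq0n (l * sz i); rewrite /K; lia.
  move=> _ ? [ps -> Hps]; apply: evP_let.
    eapply evP_ev; last exact: erefl.
    apply: (@ev_sum _ _ W_gt4 _ _ l m (fun i => w i *
      \sum_(c < N) (uk i (c * 2)%N * uk i (c * 2 + 1)%N))) => //.
    eapply ev_eq; first by evs.
    by congr (Pair _ (Arr _)); apply/eq_in_map => i; rewrite mem_iota => /Hps.
  move=> _ ? <-; rewrite -/(corr m D w uk); apply: evP_let.
    eapply evP_ev; first by evs.
    exact: erefl.
  move=> _ ? <-.
  have -> : (if corr m D w uk <= 0%:R then Real 1%:R else Real (0%:R - 1%:R)) =
      Real (sg (corr m D w uk)).
    by rewrite /sg mulr0n; case: ifP; rewrite ?sub0r.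
  apply: evP_let.
    eapply evP_ev; last exact: erefl.
    eapply (@ev_tab_const _ _ _ _ _ _ (fun c => Pair (Word (c %/ 2 ^ k.+1))
      (Real (if odd (c %/ 2 ^ k) then eps c * sg (corr m D w uk) else eps c))) _ _ 40 40);
      first by evs.
    move=> c cN ?.
    have cW : (c %/ 2 ^ k < W)%N by apply: leq_ltn_trans (leq_div _ _) _; exact: ltn_trans NW.
    eapply ev_le; [eapply ev_eq; [evs|] | |]; try lia.
    rewrite expnSr divnMA; congr (Pair _ _).
    have -> : (c %/ 2 ^ k <= c %/ 2 ^ k %/ 2 * 2)%N = ~~ odd (c %/ 2 ^ k) by lia.
    by case: odd.
  move=> _ ? <-; apply: evP_let.
    apply: (@evP_tab _ _ _ _ _ _ (weighted_row 0 w
      (fun i c => uk i (c * 2)%N + sg (corr m D w uk) * uk i (c * 2 + 1)%N)) _ _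
      (fun i => K * 300 * (sz i + 1))%N (K * 300)%N); first by evs; exact: mW.
    move=> i ? im; eapply evP_le.
    apply: evP_let.
      by apply: (evP_nth Hvs im); evs.
    move=> _ ? [yi [-> Hyi]]; apply: evP_let.
      apply: (evP_collapse_fun (F := fun _ x y => x + sg (corr m D w uk) * y)
        (d := 0) (d' := 0) (k := 20) W_gt4 NW (szW im) _ Hyi).
      + by move=> _; rewrite mulr0 addr0.
      + by evs.
      + by evs.
      + by move=> c x1 x2 ? _; eapply ev_le; [evs | |].
    move=> p ? Hp; eapply evP_ev; first by evs.
    by exists p.
    1,2: have := leq0n (D * sz i); have := leq0n (l * sz i); rewrite /K; lia.
  move=> wu' ? Hwu'; eapply evP_ev; first by evs.
  by exists wu'.
  + have := sum_sizes (K * 500) X_ge; have := sum_sizes (K * 300) X_ge; have := rows_le X_ge.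
    set s1 := \sum_(i < m) _; set s2 := \sum_(i < m) _.
    by rewrite /K; nia.
  + by rewrite /K; nia.
all: have := rows_le X_ge; rewrite /K; nia.
Qed.

End Inner.

(* [((D, (N, (l, (q, b)))), (rows, (x, gamma)))] *)
Definition t_step : term := COMPILE (
  FUN arg =>
  LET D := bfst (bfst arg) IN
  LET N := bfst (bsnd (bfst arg)) IN
  LET l := bfst (bsnd (bsnd (bfst arg))) IN
  LET dl := breal #1 / breal (bfst (bsnd (bsnd (bsnd (bfst arg))))) IN
  LET th := breal #1 - breal #1 / breal (bsnd (bsnd (bsnd (bsnd (bfst arg))))) IN
  LET rows := bfst (bsnd arg) IN
  LET x := bfst (bsnd (bsnd arg)) IN
  LET g := bsnd (bsnd (bsnd arg)) / (breal #1 - dl * dl) IN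
  LET wu := TAB i < blen rows OF
    (LET r := rows.[i] IN
     LET f := bcall t_map ((FUN z => breal #1 + x.[bfst z] * bsnd z) ;; bsnd r) IN
     LET p := bcall t_vprod (D ;; f) IN
     LET u := bcall t_map ((FUN z => LET y := x.[bfst z] IN
       IF th * th <= y * y THEN breal #0
       ELSE dl * bsnd z / (breal #1 + y * bsnd z)) ;; bsnd r) IN
     (bfst r * p ;; u)) IN
  LET eu := bcall t_inner (D ;; N ;; l ;; wu) IN
  LET ls := TAB i < blen rows OF
    (LET r := (bsnd eu).[i] IN
     LET s := bcall t_vsum (D ;; bsnd r) IN
     bfst r * s) IN
  LET lin := bcall t_sum (l ;; ls) IN
  LET ds := TAB c < N OF
    (LET y := x.[c] IN
     IF th * th <= y * y THEN breal #0 ELSE y * bsnd ((bfst eu).[c])) IN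
  LET dr := bcall t_sum (D ;; ds) IN
  LET s := IF lin <= breal #2 * g * dl * dr THEN dl ELSE breal #0 - dl IN
  LET x' := TAB c < N OF
    (LET y := x.[c] IN
     IF th * th <= y * y THEN y ELSE y + s * bsnd ((bfst eu).[c])) IN
  (x' ;; g))%bld.

Section Step.
Variables (R : realFieldType) (W : nat) (m D l b : nat) (sz : nat -> nat) (X : nat).
Local Notation N := (2 ^ D)%N.
Notation value := (value R).
Hypothesis W_gt4 : (4 < W)%N.
Hypotheses (NW : (N < W)%N) (lW : (2 ^ l < W)%N) (ml : (m <= 2 ^ l)%N).
Hypothesis szW : forall i, (i < m)%N -> (sz i < W)%N.
Hypothesis X_ge : (N + \sum_(i < m) (sz i + 1) <= X)%N.
Let W_gt2 : (2 < W)%N := ltnW (ltnW W_gt4).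
Let W_gt1 : (1 < W)%N := ltnW W_gt2.
Let W_gt0 : (0 < W)%N := ltnW W_gt1.
Let mW : (m < W)%N := leq_ltn_trans ml lW.
Let K := (D + l + 1)%N.
Local Notation q := (steps_inv b).

Definition params : value :=
  Pair (Word D) (Pair (Word N) (Pair (Word l) (Pair (Word q) (Word b)))).

Lemma evP_step (e : seq value) a w t rows x g w1 d1 :
  weighted m D sz 0 w t rows ->
  ev W e a (Pair params (Pair rows (Pair (rarr x N) (Real g)))) w1 d1 ->
  evP W e (App t_step a)
    (eq (let: (x', g') := walk_step m D w t (delta R b) (beta R b) (x, g) in
         Pair (rarr x' N) (Real g')))
    (w1 + K * K * X * (3 * 2000)) (d1 + K * K * (3 * 2000)).
Proof.
move=> [vs -> Hvs] ha; rewrite /t_step; eapply evP_le.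
apply: evP_let; first exact: (evP_ev ha (erefl _)).
move=> _ ? <-; rewrite /params; do 5 pure_let.
rewrite [1%:R / q%:R]div1r -/(delta R b) [1%:R / b%:R]div1r -/(beta R b).
do 3 pure_let.
apply: evP_let.
  apply: (@evP_tab _ _ _ _ _ _ (weighted_row D sz 0 (weight D w t x)
    (incr_of t (delta R b) (beta R b) x)) _ _
    (fun i => K * 800 * (sz i + 1))%N (K * 800)%N); first by evs; exact: mW.
  move=> i ? im; eapply evP_le.
  apply: evP_let.
    by apply: (evP_nth Hvs im); evs.
  move=> _ ? [ti [-> Hti]]; apply: evP_let.
    apply: (evP_map_fun (d' := 1) (G := fun c y => 1 + x c * y) (k := 40) W_gt4 NW (szW im) _ Hti).
    + by move=> c; rewrite mulr0 addr0.
    + by evs.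
    + by move=> c y ? cN; eapply ev_le; [evs | |].
  move=> f ? Hf; apply: evP_let.
    by eapply evP_ev; [apply: (ev_vprod W_gt4 NW (szW im) Hf); evs | exact: erefl].
  move=> _ ? <-; apply: evP_let.
    apply: (evP_map_fun (d' := 0) (G := fun c y => if alive (beta R b) x c then
        delta R b * y / (1 + x c * y) else 0) (k := 60) W_gt4 NW (szW im) _ Hti).
    + by move=> c; case: ifP; rewrite ?mulr0 ?mul0r.
    + by evs.
    + move=> c y ? cN; eapply ev_le; [eapply ev_eq; [evs|] | |]; try lia.
      by rewrite /alive if_neg; case: ifP.
  move=> u ? Hu; eapply evP_ev; first by evs.
  by exists u.
  1,2: have := leq0n (D * sz i); have := leq0n (l * sz i); rewrite /K; lia.
move=> wu ? Hwu; apply: evP_let.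
  by apply: (evP_inner W_gt4 NW lW ml szW X_ge Hwu); evs.
rewrite /walk_step; case: (inner _ _ _ _ _) => eps u /=.
move=> _ ? [y [-> [us -> Hus]]]; apply: evP_let.
  apply: (@evP_tab _ _ _ _ _ _ (fun i x' => x' = Real (weight D w t x i * \sum_(c < N) u i c))
    _ _ (fun i => K * 400 * (sz i + 1))%N (K * 400)%N); first by evs; exact: mW.
  move=> i ? im; eapply evP_le.
  apply: evP_let.
    by apply: (evP_nth Hus im); evs.
  move=> _ ? [ui [-> Hui]]; apply: evP_let.
    by eapply evP_ev; [apply: (ev_vsum W_gt4 NW (szW im) Hui); evs | exact: erefl].
  move=> _ ? <-; eapply evP_ev; first by evs.
  by [].
  1,2: have := leq0n (D * sz i); have := leq0n (l * sz i); rewrite /K; lia.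
move=> _ ? [ps -> Hps]; apply: evP_let.
  eapply evP_ev; last exact: erefl.
  apply: (@ev_sum _ _ W_gt4 _ _ l m (fun i => weight D w t x i * \sum_(c < N) u i c)) => //.
  eapply ev_eq; first by evs.
  by congr (Pair _ (Arr _)); apply/eq_in_map => i; rewrite mem_iota => /Hps.
move=> _ ? <-; apply: evP_let.
  eapply evP_ev; last exact: erefl.
  eapply (@ev_tab_const _ _ _ _ _ _ (fun c => Real (if alive (beta R b) x c
    then x c * eps c else 0)) _ _ 60 60); first by evs.
  move=> c cN ?; eapply ev_le; [eapply ev_eq; [evs|] | |]; try lia.
  by rewrite /alive if_neg; case: ifP.
move=> _ ? <-; apply: evP_let.
  eapply evP_ev; last exact: erefl.
  apply: (@ev_sum _ _ W_gt4 _ _ D N (fun c => if alive (beta R b) x c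
    then x c * eps c else 0)) => //.
  by evs.
move=> _ ? <-; rewrite -/(drift D (beta R b) x eps); apply: evP_let.
  by eapply evP_ev; [evs | exact: erefl].
move=> _ ? <-; set s := (X in if X then Real _ else _).
have -> : (if s then Real (delta R b) else Real (0%:R - delta R b)) =
    Real (if s then delta R b else - delta R b).
  by rewrite mulr0n sub0r; case: (s).
apply: evP_let.
  eapply evP_ev; last exact: erefl.
  eapply (@ev_tab_const _ _ _ _ _ _ (fun c => Real (if alive (beta R b) x c
    then x c + (if s then delta R b else - delta R b) * eps c else x c)) _ _ 60 60);
    first by evs.
  move=> c cN ?; eapply ev_le; [eapply ev_eq; [evs|] | |]; try lia.
  by rewrite /alive if_neg; case: ifP.
move=> _ ? <-; eapply evP_ev; first by evs.
by [].
- have := sum_sizes (K * 800) X_ge; have := sum_sizes (K * 400) X_ge.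
  have KX : (K * (X - N) <= K * X)%N by rewrite leq_mul2l leq_subr orbT.
  have := rows_le X_ge => mX; have [+ + + + []] := cost_products l mX.
  set s1 := (\sum_(i < m) _)%N; set s2 := (\sum_(i < m) _)%N; move: KX mX.
  by rewrite /K; lia.
- have := leq0n (D * D); have := leq0n (D * l); have := leq0n (l * l).
  by rewrite /K; lia.
Qed.

End Step.

(* [((params, T), (rows, chi))] *)
Definition t_level : term := COMPILE (
  FUN arg =>
  LET par := bfst (bfst arg) IN
  LET D := bfst par IN
  LET N := bfst (bsnd par) IN
  LET l := bfst (bsnd (bsnd par)) IN
  LET rows := bfst (bsnd arg) IN
  LET tw := TAB i < blen rows OF
    (LET r := rows.[i] IN
     LET f := bcall t_map ((FUN z => (bsnd z + breal #1 / bsnd z) / breal #2) ;; r) IN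
     LET p := bcall t_vprod (D ;; f) IN
     LET t := bcall t_collapse ((FUN z =>
       LET u := bfst (bsnd z) IN
       LET v := bsnd (bsnd z) IN
       LET u' := breal #1 / u IN
       LET v' := breal #1 / v IN
       (u - u') / (u + u') * ((v - v') / (v + v'))) ;; breal #1 ;; r) IN
     (p ;; t)) IN
  LET ws := TAB i < blen rows OF bfst (tw.[i]) IN
  LET phi := bcall t_sum (l ;; ws) IN
  LET x0 := TAB c < N OF breal #0 IN
  LET xg := bcall t_iter (bsnd (bfst arg) ;; (FUN st => bcall t_step (par ;; tw ;; st)) ;;
    (x0 ;; phi / (breal N * breal D))) IN
  LET x := bfst xg IN
  LET rows' := TAB i < blen rows OF
    bcall t_collapse ((FUN z =>
      IF breal #0 <= x.[bfst z] THEN bfst (bsnd z) * bsnd (bsnd z)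
      ELSE bfst (bsnd z) / bsnd (bsnd z)) ;; breal #1 ;; rows.[i]) IN
  LET chi := TAB j < blen (bsnd (bsnd arg)) OF
    (LET y := (bsnd (bsnd arg)).[j] IN
     LET h := bfst y / #2 IN
     (h ;; IF bfst y <= h * #2 THEN bsnd y
           ELSE IF breal #0 <= x.[h] THEN bsnd y ELSE breal #0 - bsnd y)) IN
  (rows' ;; chi))%bld.

Section Level.
Variables (R : realFieldType) (W : nat) (n m D l b : nat) (sz : nat -> nat) (X : nat).
Local Notation N := (2 ^ D)%N.
Notation value := (value R).
Hypothesis W_gt4 : (4 < W)%N.
Hypotheses (NW : (N < W)%N) (lW : (2 ^ l < W)%N) (ml : (m <= 2 ^ l)%N).
Hypotheses (nN : (n <= N)%N) (TW : (num_steps b < W)%N).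
Hypothesis szW : forall i, (i < m)%N -> (sz i < W)%N.
Hypothesis X_ge : (N + \sum_(i < m) (sz i + 1) <= X)%N.
Let W_gt2 : (2 < W)%N := ltnW (ltnW W_gt4).
Let W_gt1 : (1 < W)%N := ltnW W_gt2.
Let W_gt0 : (0 < W)%N := ltnW W_gt1.
Let mW : (m < W)%N := leq_ltn_trans ml lW.
Let K := (D + l + 1)%N.
Local Notation T := (num_steps b).

Definition sparse_rows (z : nat -> nat -> R) : value -> Prop :=
  is_array m (fun i => srep N (sz i) 1 (z i)).

(** Shifted columns as in [sign_array], for the [n] columns of the input only. *)
Definition chi_array k (chi : nat -> R) : value :=
  Arr (mkseq (fun j => Pair (Word (j %/ 2 ^ k)) (Real (chi j))) n).

Lemma evP_walk (e : seq value) b1 t1 a w t rows w1 d1 w2 d2 :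
  weighted m D sz 0 w t rows ->
  ev W e t1 (Word T) w1 d1 ->
  ev W e a (Pair (rarr (fun=> 0) N) (Real (gamma0 m D w))) w2 d2 ->
  (forall st self, ev W [:: st, self & e] b1 (Pair (params R D l b) (Pair rows st)) 40 40) ->
  evP W e (App t_iter (MkPair t1 (MkPair (Fun (App t_step b1)) a)))
    (eq (Pair (rarr (walk m D b w t T).1 N) (Real (walk m D b w t T).2)))
    (w1 + w2 + 33 + T * (K * K * X * (3 * 2000) + 70))
    (d1 + d2 + 33 + T * (K * K * (3 * 2000) + 70)).
Proof.
move=> Hrows ht ha hb; eapply evP_le.
apply: (evP_iter_fun (w := K * K * X * (3 * 2000) + 40) (d := K * K * (3 * 2000) + 40)
  (I := fun k st => Pair (rarr (walk m D b w t k).1 N) (Real (walk m D b w t k).2) = st)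
  W_gt4 TW ht ha).
- by [].
- move=> k _ ? _ <-; eapply evP_le.
  apply: evP_sub.
    apply: (evP_step W_gt4 NW lW ml szW X_ge Hrows); exact: hb.
  move=> v <-.
  rewrite -[walk m D b w t k.+1]/(walk_step m D w t (delta R b) (beta R b) (walk m D b w t k)).
  by case: (walk m D b w t k) => x g /=; case: (inner _ _ _ _ _).
all: rewrite /K; lia.
Qed.

Lemma evP_level (e : seq value) a z chi k rows w1 d1 :
  sparse_rows z rows ->
  ev W e a (Pair (Pair (params R D l b) (Word T)) (Pair rows (chi_array k chi))) w1 d1 ->
  evP W e (App t_level a)
    (fun v => exists2 y, v = Pair y (chi_array k.+1 (flip (signs m D b z) k chi)) &
      sparse_rows (fun i c => combine (signs m D b z) c (z i (c * 2)%N) (z i (c * 2 + 1)%N)) y)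
    (w1 + (T + 1) * (K * K * X * (4 * 2000))) (d1 + (T + 1) * (K * K * (4 * 2000))).
Proof.
move=> [vs -> Hvs] ha; rewrite /t_level; eapply evP_le.
apply: evP_let; first exact: (evP_ev ha (erefl _)).
move=> _ ? <-; pure_let; rewrite /params; do 4 pure_let.
apply: evP_let.
  apply: (@evP_tab _ _ _ _ _ _ (weighted_row D sz 0 (row_weight D z) (pair_tanh z)) _ _
    (fun i => K * 800 * (sz i + 1))%N (K * 800)%N); first by evs; exact: mW.
  move=> i ? im; eapply evP_le.
  apply: evP_let.
    by apply: (evP_nth (P := fun i => srep N (sz i) 1 (z i)) Hvs im); evs.
  move=> ti ? Hti; apply: evP_let.
    apply: (evP_map_fun (d' := 1) (G := fun _ => @cosh_of R) (k := 40) W_gt4 NW (szW im) _ Hti).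
    + by move=> _; exact: cosh_of1.
    + by evs.
    + move=> c y ? cN; eapply ev_le; [eapply ev_eq; [evs|] | |]; try lia.
      by rewrite mulr1n div1r.
  move=> f ? Hf; apply: evP_let.
    by eapply evP_ev; [apply: (ev_vprod W_gt4 NW (szW im) Hf); evs | exact: erefl].
  move=> _ ? <-; apply: evP_let.
    apply: (evP_collapse_fun (F := fun _ x y => tanh_of x * tanh_of y) (d := 1) (d' := 0)
        (k := 80) W_gt4 NW (szW im) _ Hti).
    + by move=> c; rewrite tanh_of1 mulr0.
    + by evs.
    + by evs.
    + move=> c x y ? cN; eapply ev_le; [eapply ev_eq; [evs|] | |]; try lia.
      by rewrite mulr1n !div1r.
  move=> u ? Hu; eapply evP_ev; first by evs.
  by exists u.
  1,2: have := leq0n (D * sz i); have := leq0n (l * sz i); rewrite /K; lia.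
move=> _ ? [us -> Hus]; apply: evP_let.
  eapply evP_ev; last exact: erefl.
  eapply (@ev_tab_const _ _ _ _ _ _ (fun i => Real (row_weight D z i)) _ _ 20 20);
    first by evs; exact: mW.
  move=> i im ?; have [ti [E _]] := Hus i im.
  by eapply ev_le; [eapply ev_fst; eapply ev_eq; [evs | exact: E] | |].
move=> _ ? <-; apply: evP_let.
  eapply evP_ev; last exact: erefl.
  by apply: (@ev_sum _ _ W_gt4 _ _ l m (row_weight D z)) => //; evs.
move=> _ ? <-; apply: evP_let.
  eapply evP_ev; last exact: erefl.
  eapply (@ev_tab_const _ _ _ _ _ _ (fun i => Real 0) _ _ 20 20); first by evs.
  by move=> c cN ?; eapply ev_le; [evs | |].
move=> _ ? <-; apply: evP_let.
  apply: (@evP_walk _ _ _ _ (row_weight D z) (pair_tanh z)); first by exists us.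
  - by evs.
  - by evs.
  - by move=> st ?; eapply ev_le; [evs | |].
move=> _ ? <-; pure_let; rewrite -/(signs m D b z).
apply: evP_let.
  apply: (@evP_tab _ _ _ _ _ _ (fun i => srep N (sz i) 1
      (fun c => combine (signs m D b z) c (z i (c * 2)%N) (z i (c * 2 + 1)%N))) _ _
    (fun i => K * 300 * (sz i + 1))%N (K * 300)%N); first by evs; exact: mW.
  move=> i ? im; eapply evP_le.
  apply: (evP_collapse_fun (F := combine (signs m D b z)) (d := 1) (d' := 1)
        (k := 80) W_gt4 NW (szW im) _ (Hvs i im)).
  - by move=> c; rewrite /combine mulr1 divr1; case: ifP.
  - by evs.
  - by evs.
  - move=> c x y ? cN; eapply ev_le; [eapply ev_eq; [evs|] | |]; try lia.
    by rewrite /combine mulr0n; case: ifP.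
  1,2: have := leq0n (D * sz i); have := leq0n (l * sz i); rewrite /K; lia.
move=> rows' ? Hrows'; apply: evP_let.
  eapply evP_ev; last exact: erefl.
  eapply (@ev_tab_const _ _ _ _ _ _ (fun j => Pair (Word (j %/ 2 ^ k.+1))
    (Real (flip (signs m D b z) k chi j))) _ _ 80 80).
    by rewrite /chi_array; evs; exact: leq_ltn_trans NW.
  move=> j jn ?.
  have jN : (j < N)%N by exact: leq_trans nN.
  have hN : (j %/ 2 ^ k < N)%N by apply: leq_ltn_trans (leq_div _ _) _.
  have hN2 : (j %/ 2 ^ k %/ 2 < N)%N by apply: leq_ltn_trans (leq_div _ _) _.
  have hW : (j %/ 2 ^ k < W)%N by exact: ltn_trans NW.
  eapply ev_le; [eapply ev_eq; [rewrite /chi_array; evs|] | |]; try lia.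
  rewrite expnSr divnMA /flip mulr0n; congr (Pair _ _).
  have -> : (j %/ 2 ^ k <= j %/ 2 ^ k %/ 2 * 2)%N = ~~ odd (j %/ 2 ^ k) by lia.
  by case: odd => //=; case: ifP.
move=> _ ? <-; eapply evP_ev; first by evs.
by exists rows'.
- have := sum_sizes (K * 800) X_ge; have := sum_sizes (K * 300) X_ge.
  have KX : (K * (X - N) <= K * X)%N by rewrite leq_mul2l leq_subr orbT.
  have := rows_le X_ge => mX.
  have : (T <= T * (K * K * X))%N.
    by rewrite leq_pmulr // !muln_gt0 /K addn1 /=; have := cost_products l mX; case.
  have [+ + + + []] := cost_products l mX.
  set s1 := (\sum_(i < m) _)%N; set s2 := (\sum_(i < m) _)%N; move: KX mX.
  by rewrite /K; move: nN; lia.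
- have : (T <= T * (K * K))%N by rewrite leq_pmulr // muln_gt0 /K addn1.
  have := leq0n (D * D); have := leq0n (D * l); have := leq0n (l * l).
  by rewrite /K; lia.
Qed.

End Level.

Definition t_lg : term := COMPILE (
  REC self x => IF x <= #0 THEN #0 ELSE #1 + bapp self (x / #2))%bld.

(* [(n, (m, A))] *)
Definition t_main : term := COMPILE (
  FUN arg =>
  LET n := bfst arg IN
  LET m := bfst (bsnd arg) IN
  LET A := bsnd (bsnd arg) IN
  IF n <= #0 THEN TAB j < #0 OF j
  ELSE
    LET D := bcall t_lg n IN
    LET l := bcall t_lg m IN
    LET N := bcall t_iter (D ;; (FUN x => x + x) ;; #1) IN
    LET b := #4 * l * D IN
    LET b2 := b * b IN
    LET b4 := b2 * b2 IN
    LET b8 := b4 * b4 IN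
    LET T := #8 * (b8 * b8 * b) IN
    LET rows := TAB i < m OF bcall t_prep (D ;; l ;; n ;; A.[i]) IN
    LET chi := TAB j < n OF (j ;; breal #1) IN
    LET fin := bcall t_iter (D ;; (FUN st =>
      bcall t_level (((D ;; N ;; l ;; #2 * b8 ;; b) ;; T) ;; st)) ;; (rows ;; chi)) IN
    TAB j < n OF bsnd ((bsnd fin).[j]))%bld.

Lemma lg_le x : (0 < x)%N -> (lg x <= x)%N.
Proof.
move=> x0; rewrite /lg; apply: leq_trans (trunc_logP (isT : (1 < 2)%N) x0).
by rewrite ltn_expl.
Qed.

Lemma lt_exp_lg x : (x < 2 ^ lg x)%N.
Proof. exact: trunc_log_ltn. Qed.

Lemma exp_lg_le x : (0 < x)%N -> (2 ^ lg x <= 2 * x)%N.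
Proof. by move=> x0; rewrite /lg expnS leq_mul2l trunc_logP. Qed.

Lemma lgS x : (1 < x)%N -> lg x = (lg (x %/ 2)).+1.
Proof. by move=> x1; rewrite /lg trunc_log2S // divn2. Qed.

Section Main.
Variables (R : realFieldType) (W : nat).
Notation value := (value R).
Hypothesis W_gt4 : (4 < W)%N.
Let W_gt2 : (2 < W)%N := ltnW (ltnW W_gt4).
Let W_gt1 : (1 < W)%N := ltnW W_gt2.
Let W_gt0 : (0 < W)%N := ltnW W_gt1.

Lemma ev_lg (e : seq value) a x w1 d1 : (0 < x < W)%N ->
  ev W e a (Word x) w1 d1 ->
  ev W e (App t_lg a) (Word (lg x)) (w1 + lg x * 30 + 30) (d1 + lg x * 30 + 30).
Proof.
move=> /andP[x0 xW] ha; rewrite /t_lg; set body := (X in Fun X).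
(* The recursion ends at 0, where the program returns 0 whereas [lg 0] is 1; hence the case
   distinction. *)
suff H k y : (y < W)%N -> (y < 2 ^ k)%N -> calls W (Clos body e) (Word y)
    (Word (if y == 0%N then 0%N else lg y)) (k * 30 + 20) (k * 30 + 20).
  have := H (lg x) x xW (lt_exp_lg x); rewrite eqn0Ngt x0 /= => h.
  by eapply ev_le; first (eapply ev_app; [eapply ev_fun | exact: ha | exact: h]); lia.
elim: k y => [|k IH] y yW yk; rewrite /calls {1}/body.
- have y0 : y = 0%N by move: yk; rewrite expn0; lia.
  have -> : (if y == 0%N then 0%N else lg y) = 0%N by rewrite y0.
  eapply ev_le.
  eapply ev_if; [evs; lia | move=> _; evs; lia | by rewrite y0].
  1,2: lia.
- eapply ev_le.
  eapply ev_if; first (evs; lia).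
  + move=> y0; have -> : (if y == 0%N then 0%N else lg y) = 0%N.
      by case: eqP; lia.
    by eapply ev_le; [evs; lia | exact: leq_addl (k * 30 + 39)%N 1%N |
                      exact: leq_addl (k * 30 + 39)%N 1%N].
  + move=> y0; eapply ev_le.
    eapply ev_eq.
    eapply ev_bin; [exact: W_gt1 | evs; lia | eapply ev_app; [evs | evs; lia | apply: IH] |].
    * by apply: leq_ltn_trans yW; rewrite leq_div.
    * by move: yk; rewrite expnS; lia.
    * constructor; have := @lg_le (y %/ 2); case: eqP; lia.
    * congr Word; have -> : (y == 0)%N = false by lia.
      case: (ltnP 1 y) => y1; first by rewrite (lgS y1); case: eqP; lia.
      by have -> : y = 1%N by lia.
    * lia.
    * lia.
  1,2: lia.
Qed.

End Main.

Section Input.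
Variables (R : realFieldType) (m n : nat) (A : 'M[R]_(m, n)).

(** Extension by 0 to all pairs of natural numbers, over which the analysis ranges. *)
Definition entry i j : R :=
  if insub i is Some i' then if insub j is Some j' then A i' j' else 0 else 0.

Definition row_cells i : seq (nat * R) :=
  if insub i is Some i' then [seq (val j, A i' j) | j <- enum 'I_n & A i' j != 0]
  else [::].

Lemma entryE (i : 'I_m) (j : 'I_n) : entry i j = A i j.
Proof. by rewrite /entry !valK. Qed.

Lemma entry_supp i c : (n <= c)%N || (m <= i)%N -> entry i c = 0.
Proof.
rewrite /entry => /orP[h|h].
  by case: insub => // i'; rewrite insubF //; lia.
by rewrite insubF //; lia.
Qed.

Lemma incr_row_cells i : incr (row_cells i).
Proof.
rewrite /row_cells; case: insubP => // i' _ _; rewrite /incr -map_comp.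
rewrite (eq_map (g := val)) // -sorted_pairwise; last exact: ltn_trans.
apply: (subseq_sorted ltn_trans (s2 := map val (enum 'I_n))).
  exact/map_subseq/filter_subseq.
by rewrite val_enum_ord iota_ltn_sorted.
Qed.

Lemma row_cells_lt i x : x \in row_cells i -> (x.1 < n)%N.
Proof. by rewrite /row_cells; case: insubP => // i' _ _ /mapP[j _ ->] /=. Qed.

Lemma size_row_cells i : (size (row_cells i) <= n)%N.
Proof.
rewrite /row_cells; case: insubP => // i' _ _; rewrite size_map size_filter.
by rewrite (leq_trans (count_size _ _)) // size_enum_ord.
Qed.

Lemma assoc_row_cells i c : assoc 0 (row_cells i) c = entry i c.
Proof.
rewrite /row_cells /entry; case: insubP => // i' _ _.
have H (s : seq 'I_n) : assoc 0 [seq (val j, A i' j) | j <- s & A i' j != 0] c =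
    if insub c is Some j' then if j' \in s then A i' j' else 0 else 0.
  case: insubP => [j' _ <-|nc].
    elim: s => [//|j s IH] /=; rewrite in_cons.
    case: ifP => [Aj|/negbFE/eqP Aj] /=; rewrite IH.
      by rewrite val_eqE [j == j']eq_sym; case: eqP => [->|].
    by case: (j' =P j) => [->|] //=; rewrite Aj; case: ifP.
  elim: s => [//|j s IH] /=; case: ifP => //= _; rewrite IH.
  by case: eqP => // E; rewrite -E ltn_ord in nc.
by rewrite H; case: insub => // j'; rewrite mem_enum.
Qed.

Lemma sum_size_row_cells : (\sum_(i < m) size (row_cells i))%N = nnz A.
Proof.
rewrite /nnz -sum1_card.
under eq_bigl => ij do rewrite inE.
rewrite -(pair_big_dep xpredT (fun i j => A i j != 0) (fun _ _ => 1%N)) /=.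
apply: eq_bigr => i _; rewrite sum1_card /row_cells valK size_map size_filter.
rewrite cardE -size_filter; congr size; rewrite [RHS]/enum_mem -enumT.
by apply: eq_filter.
Qed.

Lemma onth_sparse i : (i < m)%N ->
  onth [seq sparse_row A i | i <- enum 'I_m] i = Some (vrow (row_cells i)).
Proof.
move=> im; rewrite onth_map (onth_nth_some (Ordinal im)) ?size_enum_ord //=.
rewrite (_ : nth _ _ _ = Ordinal im); last by apply: val_inj => /=; rewrite nth_enum_ord.
by rewrite /sparse_row /row_cells insubT /vrow -map_comp.
Qed.

End Input.

Section Run.
Variables (R : realFieldType) (W : nat) (m n : nat) (A : 'M[R]_(m, n)).
Local Notation D := (lg n).
Local Notation l := (lg m).
Local Notation N := (2 ^ D)%N.
Local Notation b := (4 * l * D)%N.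
Local Notation T := (num_steps b).
Hypotheses (n_gt0 : (0 < n)%N) (m_gt0 : (0 < m)%N).
Hypotheses (W_gt8 : (8 < W)%N) (NW : (N < W)%N) (lW : (2 ^ l < W)%N) (DlW : (D + l < W)%N).
Hypotheses (TW : (T < W)%N) (nW : (n < W)%N) (mW : (m < W)%N).
Let W_gt4 : (4 < W)%N := ltnW (ltnW (ltnW (ltnW W_gt8))).
Let W_gt2 : (2 < W)%N := ltnW (ltnW W_gt4).
Let W_gt1 : (1 < W)%N := ltnW W_gt2.
Let W_gt0 : (0 < W)%N := ltnW W_gt1.
Let K := (D + l + 1)%N.
Let sz i := size (row_cells A i).
Let X := (N + \sum_(i < m) (sz i + 1))%N.
Let dense i := assoc 0 (row_cells A i).
Let z : nat -> nat -> R := start_mx n D l dense.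
Notation value := (value R).

Lemma evP_main (e : seq value) a w1 d1 :
  ev W e a (Pair (Word n) (Pair (Word m) (sparse A))) w1 d1 ->
  evP W e (App t_main a) (eq (rarr (coloring n m D l dense) n))
    (w1 + (D + 1) * ((T + 1) * (K * K * X * (10 * 2000))))
    (d1 + (D + 1) * ((T + 1) * (K * K * (10 * 2000)))).
Proof.
move=> ha; rewrite /t_main; eapply evP_le.
apply: evP_let; first exact: (evP_ev ha (erefl _)).
move=> _ ? <-; do 3 pure_let.
apply: (@evP_if _ _ _ _ _ _ (n <= 0)%N _ _ _ 0 0); first by evs.
  by move=> n0; exfalso; move: n_gt0 n0; clear; lia.
move=> _.
have D0 : (0 < D)%N by [].
have l0 : (0 < l)%N by [].
have DW : (D < W)%N by move: DlW; clear; lia.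
have lW' : (l < W)%N by move: DlW; clear; lia.
have b0 : (0 < b)%N by rewrite !muln_gt0 D0 l0.
have bT k : (k <= 17)%N -> (8 * b ^ k < W)%N.
  by move=> k17; apply: leq_ltn_trans TW; rewrite leq_pmul2l // leq_pexp2l.
apply: evP_let.
  eapply evP_ev; last exact: erefl.
  by apply: (ev_lg W_gt4); last (by evs); rewrite n_gt0.
move=> _ ? <-; apply: evP_let.
  eapply evP_ev; last exact: erefl.
  by apply: (ev_lg W_gt4); last (by evs); rewrite m_gt0.
move=> _ ? <-; apply: evP_let.
  apply: (evP_iter_fun (w := 20) (d := 20) (I := fun i v => Word (2 ^ i) = v) W_gt4 DW).
  - by evs.
  - by evs.
  - by [].
  - move=> i _ ? iD <-; eapply evP_ev; last exact: erefl.
    eapply ev_le; [eapply ev_eq; [evs|] | |] => //; last first.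
      by congr Word; rewrite expnS mul2n addnn.
    by apply: leq_ltn_trans NW; rewrite addnn -mul2n -expnS leq_exp2l.
move=> _ ? <-.
have b8W : (8 * b ^ 17 < W)%N by exact: bT.
apply: evP_let.
  eapply evP_ev; first (evs; rewrite ?W_gt4 //).
  - apply: leq_ltn_trans (bT 1%N isT); rewrite expn1.
    by apply: (@leq_trans b); rewrite ?leq_pmulr ?leq_pmull.
  - by apply: leq_ltn_trans (bT 1%N isT); rewrite expn1 leq_pmull.
  - exact: erefl.
move=> _ ? <-; apply: evP_let.
  eapply evP_ev; first (evs; rewrite mulnn).
  - by apply: leq_ltn_trans (bT 2%N isT); rewrite leq_pmull.
  - exact: erefl.
move=> _ ? <-; rewrite mulnn; apply: evP_let.
  eapply evP_ev; first (evs; rewrite -expnD).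
  - by apply: leq_ltn_trans (bT 4%N isT); rewrite leq_pmull.
  - exact: erefl.
move=> _ ? <-; rewrite -expnD; apply: evP_let.
  eapply evP_ev; first (evs; rewrite -expnD).
  - by apply: leq_ltn_trans (bT 8%N isT); rewrite leq_pmull.
  - exact: erefl.
move=> _ ? <-; rewrite -expnD; apply: evP_let.
  eapply evP_ev; first (evs; rewrite -?expnD -?expnSr ?W_gt8 //).
  - by apply: leq_ltn_trans (bT 16%N isT); rewrite leq_pmull.
  - by apply: leq_ltn_trans (bT 17%N isT); rewrite leq_pmull.
  - exact: erefl.
move=> _ ? <-; rewrite -expnD -expnSr -num_stepsE.
apply: evP_let.
  apply: (@evP_tab _ _ _ _ _ _ (fun i => srep N (sz i) 1 (z i)) _ _
    (fun i => K * 2020 * (sz i + 1))%N (K * 2020)%N); first by evs.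
  move=> i ? im; eapply evP_le.
  apply: (evP_prep W_gt4 NW lW' DlW nW); last by evs; rewrite (onth_sparse A im).
  - by apply: leq_ltn_trans nW; exact: size_row_cells.
  - exact: incr_row_cells.
  - by move=> x /row_cells_lt /leq_trans; apply; rewrite ltnW ?lt_exp_lg.
  1,2: have := leq0n (D * sz i); have := leq0n (l * sz i); rewrite /K /sz; lia.
move=> rows ? Hrows; apply: evP_let.
  eapply evP_ev; last exact: erefl.
  eapply (@ev_tab_const _ _ _ _ _ _ (fun j => Pair (Word j) (Real 1)) _ _ 20 20);
    first by evs.
  by move=> j jn ?; eapply ev_le; [evs | |].
move=> _ ? <-; apply: evP_let.
  apply: (evP_iter_fun (w := (T + 1) * (K * K * X * (4 * 2000)) + 60)
    (d := (T + 1) * (K * K * (4 * 2000)) + 60)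
    (I := fun k v => exists2 y, v = Pair y (chi_array n k (tree m D b z k).2) &
      sparse_rows m D sz (tree m D b z k).1 y) W_gt4 DW).
  - by evs.
  - by evs.
  - exists rows => //; congr (Pair _ (Arr _)).
    by apply: eq_map => j; rewrite expn0 divn1.
  - move=> k _ ? kD [y -> Hy]; eapply evP_le.
    apply: evP_sub.
      apply: (evP_level (n := n) W_gt4 NW lW _ _ TW _ (leqnn X) Hy).
      + by rewrite ltnW ?lt_exp_lg.
      + by rewrite ltnW ?lt_exp_lg.
      + by move=> i im; apply: leq_ltn_trans nW; exact: size_row_cells.
      + evs; rewrite ?W_gt2 //.
        by apply: leq_ltn_trans (bT 8%N isT); rewrite leq_mul2r orbT.
    move=> v [y' -> Hy']; exists y'; rewrite [tree _ _ _ _ k.+1]/=.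
      by case: (tree m D b z k).
    by move: Hy'; case: (tree m D b z k).
    1,2: by rewrite /K /= -/K; lia.
move=> _ ? [y -> Hy]; eapply evP_ev.
  eapply (@ev_tab_const _ _ _ _ _ _ (fun j => Real (coloring n m D l dense j)) _ _ 20 20);
    first by evs.
  by move=> j jn ?; eapply ev_le; [rewrite /chi_array; evs | |].
by [].
- have := sum_sizes (K * 2020) (leqnn X); rewrite mulnAC.
  have mX := rows_le (leqnn X); have [_ _ h1 h2 [h3 h4]] := cost_products l mX.
  have : (K * (X - N) <= K * X)%N by rewrite leq_mul2l leq_subr orbT.
  have nX : (n <= X)%N.
    by apply: leq_trans mX; apply: leq_trans (leq_addl _ _); rewrite ltnW ?lt_exp_lg.
  move: h1 h3 h4 nX; rewrite -/K; set s1 := (\sum_(i < m) _)%N.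
  have lK : (D + l + 1 <= K)%N by [].
  set A' := (K * K * X)%N; move: (A') (num_steps b) (K * X)%N (K * (X - N))%N lK => {}A' T' KX KN.
  move: K s1 => K' s1 lK h1 h3 h4 nX hKN hs.
  have DA : (D <= D * A')%N by rewrite leq_pmulr //; lia.
  by have := leq0n (D * T' * A'); have := leq0n (T' * A'); lia.
- have K0 : (0 < K * K)%N by rewrite muln_gt0 /K addn1.
  have lK : (D + l + 1 <= K)%N by [].
  have : (K <= K * K)%N by rewrite leq_pmulr // /K addn1.
  move: (K * K)%N (num_steps b) K0 lK => A' T' K0; move: K => K' lK KA.
  have DA : (D <= D * A')%N by rewrite leq_pmulr.
  by have := leq0n (D * T' * A'); have := leq0n (T' * A'); lia.
Qed.

End Run.

Definition program : term := App t_main (MkPair (Var 0) (MkPair (Var 1) (Var 2))).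
(** With [G = lg (n * m)] and size [S], this collects [D + 1 <= 2 * G], at most
    [9 * 4 ^ 17 * G ^ 34] steps per level, [(3 * G) ^ 2] for a step, the data size [2 * S] and the
    constant of [evP_main]. The powers of [G] add up to 37. *)
Definition cost_factor : nat := (9 * (10 * 2000) * 36 + 10) * 4 ^ 17.

Lemma runs_empty (R : realFieldType) (W m : nat) (A : 'M[R]_(m, 0)) : (1 < W)%N ->
  exists w d, [/\ runs W program [:: Word 0; Word m; sparse A] (Arr [::]) w d,
    (w <= 100)%N & (d <= 100)%N].
Proof.
move=> W1; apply: ev_runs; rewrite /program /t_main; eapply ev_le.
do 4 (eapply ev_let; [by evs | move=> ?]).
eapply (@ev_if _ _ _ _ _ _ (0 <= 0)%N); [evs; lia | move=> _ | by []].
apply: (@ev_tab_const _ _ _ _ 0 _ (fun i => Word i) 1 1 1 1); first by evs; lia.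
by [].
all: by [].
Qed.

(** The largest word is the number of steps [8 * b ^ 17]. Since
    [b = 4 * l * D <= 4 * m * n <= Y ^ 2], it is at most [Y ^ 36]. *)
Lemma word_bounds n m (Y := (n + m + 2)%N) (D := lg n) (l := lg m) :
  (0 < n)%N -> (1 < m)%N ->
  [/\ 8 < Y ^ 40, 2 ^ D < Y ^ 40, 2 ^ l < Y ^ 40, D + l < Y ^ 40 &
    [/\ num_steps (4 * l * D) < Y ^ 40, n < Y ^ 40 & m < Y ^ 40]]%N.
Proof.
move=> n0 m1; have Y5 : (5 <= Y)%N by rewrite /Y; lia.
have lt x : (x <= Y ^ 36)%N -> (x < Y ^ 40)%N.
  by move=> h; apply: leq_ltn_trans h _; rewrite ltn_exp2l //; lia.
have le2 x : (x <= Y * Y)%N -> (x <= Y ^ 36)%N.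
  by move=> h; apply: leq_trans h _; rewrite mulnn leq_exp2l //; lia.
have YY : (5 * Y <= Y * Y)%N by rewrite leq_mul2r Y5 orbT.
have Dn : (D <= n)%N by apply: lg_le.
have lm : (l <= m)%N by apply: lg_le; lia.
split; first 4 last.
- split; try (by apply/lt/le2; rewrite /Y in YY *; lia).
  apply: lt; rewrite /num_steps.
  have b2 : (4 * l * D <= Y ^ 2)%N.
    apply: leq_trans (_ : 4 * m * n <= _)%N; first by rewrite leq_mul // leq_mul2l.
    rewrite -mulnA; apply: leq_trans (nat_AGM2 m n) _.
    by rewrite leq_exp2r // /Y; lia.
  have b17 : ((4 * l * D) ^ 17 <= (Y ^ 2) ^ 17)%N by rewrite leq_exp2r.
  apply: leq_trans (leq_mul (_ : (8 <= Y ^ 2)%N) b17) _; first by rewrite -mulnn; lia.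
  by rewrite -expnM -expnD.
- by apply/lt/le2; lia.
- by apply/lt/le2; have := exp_lg_le n0; rewrite -/D /Y in YY *; lia.
- by apply/lt/le2; have := exp_lg_le (ltnW m1); rewrite -/l /Y in YY *; lia.
- by apply/lt/le2; rewrite /Y in YY *; lia.
Qed.

(** Serves the work with [S = nnz A + n + m] and the depth with [S = 1]. *)
Lemma cost_bound n m S (D := lg n) (l := lg m) (G := lg (n * m)) :
  (0 < n)%N -> (1 < m)%N -> (0 < S)%N ->
  (10 + (D + 1) * ((num_steps (4 * l * D) + 1) *
      ((D + l + 1) * (D + l + 1) * (2 * S) * (10 * 2000))) <=
    cost_factor * S * G ^ 37)%N.
Proof.
move=> n0 m1 S0.
have G0 : (0 < G)%N by [].
have DG : (D <= G)%N by rewrite /D /G /lg ltnS leq_trunc_log // leq_pmulr //; lia.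
have lG : (l <= G)%N by rewrite /l /G /lg ltnS leq_trunc_log // leq_pmull.
have D0 : (0 < D)%N by []. have l0 : (0 < l)%N by [].
have b0 : (0 < 4 * l * D)%N by rewrite !muln_gt0 l0 D0.
have bG : (4 * l * D <= 4 * G ^ 2)%N by rewrite -mulnA leq_mul2l /= -mulnn leq_mul.
have TG : (num_steps (4 * l * D) + 1 <= 9 * (4 ^ 17 * G ^ 34))%N.
  apply: leq_trans (_ : 9 * (4 * l * D) ^ 17 <= _)%N.
    rewrite /num_steps; have : (0 < (4 * l * D) ^ 17)%N by rewrite expn_gt0 b0.
    by set x := (_ ^ 17)%N; lia.
  by rewrite leq_mul2l /= -[34%N]/(2 * 17)%N expnM -expnMn leq_exp2r.
have D2 : (D + 1 <= 2 * G)%N by lia.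
have KG : ((D + l + 1) * (D + l + 1) <= (3 * G) * (3 * G))%N by rewrite leq_mul //; lia.
have S1 : (10 <= 10 * (4 ^ 17 * S * G ^ 37))%N.
  have h1 : (0 < 4 ^ 17)%N by rewrite expn_gt0.
  have h2 : (0 < G ^ 37)%N by rewrite expn_gt0 G0.
  by rewrite leq_pmulr // (muln_gt0 _ (G ^ 37)) (muln_gt0 _ S) h1 h2 S0.
apply: leq_trans (leq_add S1 (leq_mul D2 (leq_mul TG
  (leq_mul (leq_mul KG (leqnn (2 * S)%N)) (leqnn (10 * 2000)%N))))) _.
rewrite /cost_factor.
have -> : (G ^ 37 = G ^ 34 * (G * G * G))%N by rewrite (expnD G 34 3) !expnS expn0 muln1 !mulnA.
by move: (4 ^ 17)%N (G ^ 34)%N => x y; lia.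
Qed.

(** From [ln 2 >= 1 / 2], both the binary logarithm and the additional 1 are at most [2 * ln m]. *)
Lemma lg_le_ln (R : realType) m : (2 <= m)%N -> (lg m)%:R <= 4 * ln (m%:R : R).
Proof.
move=> m2; rewrite /lg; set k := trunc_log 2 m.
have m0 : 0 < m%:R :> R by rewrite ltr0n; lia.
have ln2 : 1 / 2 <= ln (2 : R).
  have h : 0 < 2^-1 :> R by rewrite invr_gt0.
  have := @le_ln1Dx R (- (2^-1)); have -> : 1 + - 2^-1 = 2^-1 :> R by lra.
  by rewrite lnV ?posrE // => h'; have := h' ltac:(lra); lra.
have lm : ln (2 : R) <= ln m%:R by rewrite ler_ln ?posrE // ler_nat.
have km : k%:R * ln (2 : R) <= ln m%:R.
  rewrite mulr_natl -lnXn // ler_ln ?posrE ?exprn_gt0 // -natrX ler_nat.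
  by apply: trunc_logP => //; lia.
have k0 : 0 <= k%:R :> R by [].
by rewrite -natr1; nra.
Qed.

Theorem theorem1p2 (R : realType) :
  exists (p : term) (c C k : nat) (K : R),
  forall (n m : nat) (A : 'M[R]_(m, n)), (2 <= m)%N ->
  exists (chi : 'I_n -> R) (work depth : nat),
    [/\ runs ((n + m + 2) ^ c)%N p [:: Word n; Word m; sparse A] (vec chi)
          work depth,
        (work <= C * (nnz A + n + m) * lg (n * m) ^ k)%N,
        (depth <= C * lg (n * m) ^ k)%N,
        forall j : 'I_n, chi j = 1 \/ chi j = -1
      & forall i : 'I_m,
          disc A chi i <=
            K * Num.sqrt ((\sum_(j < n) A i j ^+ 2) * ln (m%:R : R))].
Proof.
(* The 28 comes from [scale ^+ 2 * l <= 4 * S] and [l <= 4 * ln m], where [S] is the squared norm of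
   the row: the square of [7 * l * scale] is at most [49 * 4 * 4 * S * ln m = 28 ^+ 2 * S * ln
   m]. *)
exists program, 40%N, cost_factor, 37%N, 28 => n m A m2.
have CC : (100 <= cost_factor)%N.
  have h : (4 ^ 2 <= 4 ^ 17)%N by rewrite leq_exp2l.
  rewrite /cost_factor; move: (4 ^ 17)%N h => x; lia.
(* Without columns the program stops at once; as [lg 0 = 1], a constant cost is within the
   bounds. *)
have [n0|n0] := posnP n.
  subst n; have W1 : (1 < (0 + m + 2) ^ 40)%N.
    by rewrite -[1%N](exp1n 40) ltn_exp2r //; lia.
  have [w [d [run wC dC]]] := runs_empty A W1.
  exists (fun=> 1), w, d; split.
  - rewrite /vec; suff -> : enum 'I_0 = [::] by [].
    by apply: size0nil; rewrite size_enum_ord.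
  - rewrite mul0n /lg /= exp1n muln1; apply: leq_trans wC _.
    by apply: leq_trans CC _; rewrite leq_pmulr //; lia.
  - by rewrite mul0n /lg /= exp1n muln1; apply: leq_trans CC.
  - by case.
  - by move=> i; rewrite /disc big_ord0 normr0 mulr_ge0 // sqrtr_ge0.
have [W8 NW lW DlW [TW nW mW]] := word_bounds n0 m2.
pose dense i := assoc 0 (row_cells A i).
have denseE i c : dense i c = entry A i c by exact: assoc_row_cells.
pose chi (j : 'I_n) : R := coloring n m (lg n) (lg m) dense j.
have ha : ev ((n + m + 2) ^ 40) [:: Word n; Word m; sparse A]
    (MkPair (Var 0) (MkPair (Var 1) (Var 2)))
    (Pair (Word n) (Pair (Word m) (sparse A))) 5 5 by eapply ev_le; [evs | |].
have [v vE hv] := evP_main n0 (ltnW m2) W8 NW lW DlW TW nW mW ha.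
have {hv} [w [d [run wC dC]]] := ev_runs hv.
exists chi, w, d; split.
- suff -> : vec chi = v by [].
  rewrite -vE /vec /rarr /mkseq -val_enum_ord -map_comp; congr Arr; exact: eq_map.
- apply: leq_trans wC _.
  have S0 : (0 < nnz A + n + m)%N by rewrite addn_gt0 (ltnW m2) orbT.
  apply: leq_trans (cost_bound n0 m2 S0).
  apply: (leq_add (isT : (5 <= 10)%N)); do 2!apply: (leq_mul (leqnn _)).
  apply: leq_mul (leqnn _); apply: (leq_mul (leqnn _)).
  (* The data size is [2 ^ lg n + nnz A + m], and [2 ^ lg n <= 2 * n]. *)
  rewrite big_split /= sum_size_row_cells sum1_card card_ord.
  by move: (exp_lg_le n0); clear; lia.
- apply: leq_trans dC _.
  rewrite -[cost_factor]muln1; apply: leq_trans (cost_bound n0 m2 (isT : (0 < 1)%N)).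
  apply: (leq_add (isT : (5 <= 10)%N)); do 2!apply: (leq_mul (leqnn _)).
  by apply: leq_mul (leqnn _); rewrite leq_pmulr.
- by move=> j; exact: tree_sign.
- move=> i.
  have l2 : (1 < lg m)%N by rewrite /lg ltnS trunc_log_gt0 m2.
  have nN : (n <= 2 ^ lg n)%N by rewrite ltnW ?lt_exp_lg.
  have mN : (m <= 2 ^ lg m)%N by rewrite ltnW ?lt_exp_lg.
  have supp i' c : (n <= c)%N || (m <= i')%N -> dense i' c = 0.
    by move=> h; rewrite denseE entry_supp.
  have supp' c : (n <= c)%N -> dense i c = 0 by move=> h; rewrite supp ?h.
  have restrict (g : nat -> R) : (forall c, (n <= c)%N -> g c = 0) ->
      \sum_(c < 2 ^ lg n) g c = \sum_(c < n) g c.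
    move=> g0; rewrite (big_ord_widen _ g nN) [RHS]big_mkcond /=.
    by apply: eq_bigr => c _; case: ltnP => // /g0.
  have := coloring_disc n0 nN isT m2 mN l2 supp (ltn_ord i).
  rewrite (restrict (fun c => dense i c * coloring n m (lg n) (lg m) dense c));
    last by move=> c /supp' ->; rewrite mul0r.
  have -> : \sum_(c < n) dense i c * coloring n m (lg n) (lg m) dense c =
      \sum_(j < n) A i j * chi j.
    by apply: eq_bigr => j _; rewrite denseE entryE.
  move=> h; apply: le_trans h _.
  have [s0 _ s2] := scale_bounds n0 nN (ltnW l2) supp'.
  have SE : sqr_norm (lg n) (dense i) = \sum_(j < n) A i j ^+ 2.
    rewrite /sqr_norm (restrict (fun c => dense i c * dense i c)).
      by apply: eq_bigr => j _; rewrite denseE entryE expr2.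
    by move=> c /supp' ->; rewrite mul0r.
  rewrite SE in s2; have lnm := lg_le_ln R m2.
  set sc := scale _ _ _ _ in s0 s2 *; set S := \sum_(j < n) _ in s2 *.
  have S0 : 0 <= S by apply: sumr_ge0 => j _; exact: sqr_ge0.
  have p0 : 0 <= sc * (7 * (lg m)%:R) by rewrite mulr_ge0 // mulr_ge0.
  rewrite -[X in X <= _](ger0_norm p0) -sqrtr_sqr.
  have -> : 28 * Num.sqrt (S * ln m%:R) = Num.sqrt (28 ^+ 2 * (S * ln m%:R)).
    by rewrite [in RHS]sqrtrM ?exprn_ge0 // sqrtr_sqr ger0_norm.
  apply: ler_wsqrtr.
  have -> : (sc * (7 * (lg m)%:R)) ^+ 2 = 49 * (lg m)%:R * (sc ^+ 2 * (lg m)%:R) by ring.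
  apply: le_trans (ler_wpM2l _ s2) _; first by rewrite mulr_ge0.
  have -> : 49 * (lg m)%:R * (4 * S) = 196 * (S * (lg m)%:R) by ring.
  have -> : 28 ^+ 2 * (S * ln m%:R) = 196 * (S * (4 * ln m%:R)) by ring.
  by rewrite ler_wpM2l // ler_wpM2l.
Qed.
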